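(* Let $\mathbb{K}$ be a field with more than two elements, let $n$ be a positive integer and let $r$ be an integer with $1<r<n$. Write $r=2s+\epsilon$ with $s$ a positive integer and $\epsilon\in\{0,1\}$. Let $S$ be a linear subspace of $\mathrm{S}_n(\mathbb{K})$ such that $$\dim S>\max\bigl(s_{n,1,r-2},\,s_{n,s-1,2+\epsilon}\bigr)\quad\text{and}\quad \operatorname{urk} S\leq r.$$ Then one of the following holds: (i) $S$ is congruent to a subspace of $\mathrm{WS}_{n,0,r}(\mathbb{K})$; (ii) $S$ is congruent to a subspace of $\mathrm{WS}_{n,s,\epsilon}(\mathbb{K})$; (iii) $\mathbb{K}$ has characteristic $2$, $r$ is even, and $S$ is congruent to a subspace of $\mathrm{WA}_{n,0,r+1}(\mathbb{K})$.
   Context: $\mathrm{S}_n(\mathbb{K})$ denotes the space of $n\times n$ symmetric matrices over $\mathbb{K}$ and $\mathrm{A}_n(\mathbb{K})$ the space of $n\times n$ alternating matrices (skew-symmetric with zero diagonal, equivalently $X^TAX=0$ for all $X\in\mathbb{K}^n$). Two subsets $\mathcal{V},\mathcal{W}$ of $\mathrm{M}_n(\mathbb{K})$ are congruent if $\mathcal{V}=P\mathcal{W}P^T$ for some $P\in\mathrm{GL}_n(\mathbb{K})$. The upper-rank $\operatorname{urk}\mathcal{V}$ of a nonempty set of matrices is the maximal rank of its elements. For non-negative integers $n,s,t$ with $2s+t\leq n$, $\mathrm{WS}_{n,s,t}(\mathbb{K})$ (resp. $\mathrm{WA}_{n,s,t}(\mathbb{K})$) is the space of all matrices $M=(m_{i,j})$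 in $\mathrm{S}_n(\mathbb{K})$ (resp. in $\mathrm{A}_n(\mathbb{K})$) such that $m_{i,j}=0$ whenever $i>s$, $j>s$ and $\max(i,j)>s+t$ (i.e. block form with block sizes $s,t,n-s-t$ where the $(2,3)$, $(3,2)$, $(3,3)$ blocks are zero). One sets $s_{n,s,t}:=\dim\mathrm{WS}_{n,s,t}(\mathbb{K})=\binom{s+1}{2}+\binom{t+1}{2}+s(n-s)$ and $a_{n,s,t}:=\dim\mathrm{WA}_{n,s,t}(\mathbb{K})=\binom{s}{2}+\binom{t}{2}+s(n-s)$. *)

(* Defs.v *)
From HB Require Import structures.
From mathcomp Require Import all_boot all_order all_algebra.
Set Implicit Arguments. Unset Strict Implicit. Unset Printing Implicit Defensive.
Import Order.TTheory GRing.Theory Num.Theory.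
Local Open Scope ring_scope.

(* Indices are 0-based: 1-based "i > s" becomes "s <= i". *)

Definition sym_mx (K : fieldType) (n : nat) (M : 'M[K]_n) : Prop :=
  M^T = M.

Definition alt_mx (K : fieldType) (n : nat) (M : 'M[K]_n) : Prop :=
  M^T = - M /\ forall i, M i i = 0.

Definition zero_pattern (K : fieldType) (n s t : nat) (M : 'M[K]_n) : Prop :=
  forall i j : 'I_n, (s <= i)%N -> (s <= j)%N -> (s + t <= maxn i j)%N ->
    M i j = 0.

Definition inWS (K : fieldType) (n s t : nat) (M : 'M[K]_n) : Prop :=
  sym_mx M /\ zero_pattern s t M.

Definition inWA (K : fieldType) (n s t : nat) (M : 'M[K]_n) : Prop :=
  alt_mx M /\ zero_pattern s t M.

Definition congr_into (K : fieldType) (n : nat) (S : {vspace 'M[K]_n})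
  (W : 'M[K]_n -> Prop) : Prop :=
  exists2 P : 'M[K]_n, P \in unitmx & forall M, M \in S -> W (P *m M *m P^T).

Definition urk_le (K : fieldType) (n : nat) (S : {vspace 'M[K]_n}) (r : nat) : Prop :=
  forall M, M \in S -> (\rank M <= r)%N.

Definition s_dim (n s t : nat) : nat :=
  ('C(s.+1, 2) + 'C(t.+1, 2) + s * (n - s))%N.

Definition a_dim (n s t : nat) : nat :=
  ('C(s, 2) + 'C(t, 2) + s * (n - s))%N.

(* Main.v *)
(* Matrices act on row vectors, and a linear form [l] is itself a row vector, applied by [dot].
   For a linear form [l], let S_l be the space of all M in S that vanish on ker l.

   Dividing out the common kernel, one may assume that it is trivial. Take M0 in S of maximal
   rank (among the nonalternating elements in one case of characteristic 2) and l nonzero on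
   ker M0. Comparing the ranks of M0 + tQ for several t shows that every Q in S_l is a product
   [l mu] with mu = w M0 and w isotropic for M0. If dim S_l >= s for all these l, the spaces of
   vectors w are totally isotropic for M0 and pairwise orthogonal, hence coincide for dimension
   reasons; they provide s common factors, which forces an (n - s)-dimensional subspace on which
   all elements of S have rank at most eps: this is case (ii).

   Otherwise fix l with dim S_l < s minimal and proceed by induction on n. Restriction to ker l
   loses only dim S_l dimensions. When the bound on dim S does not survive this restriction,
   there are at least two independent products [l mu] in S_l and one restricts to
   ker l and ker mu, which loses more dimensions but also lowers the rank by two. Minimality of l
   rules out a common kernel of the restriction, so cases (i) and (iii) contradict the dimension
   bounds. Case (ii) is lifted to S: for every y in the isotropic subspace there is a linear
   relation expressing y M p^T, p outside ker l, through y M B^T (B a basis of ker l), and bounds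
   on affine spaces of singular matrices show that one relation serves for all y. The same gluing
   excludes n = r + 1. *)

Require Import Defs.
From HB Require Import structures.
From mathcomp Require Import all_boot all_order all_algebra.
From mathcomp Require Import zify ring.
From Stdlib Require Import Classical.
Set Implicit Arguments. Unset Strict Implicit. Unset Printing Implicit Defensive.
Import Order.TTheory GRing.Theory Num.Theory.
Local Open Scope ring_scope.


(** More than two elements of the field are used to test pencils M + tQ: a polynomial of degree two
    with leading coefficient -1 cannot vanish at 0, 1 and a third scalar t0. Characteristic 2 is the
    main obstacle. Products [l mu] are alternating there, comparing two products leaves an unknown c
    with 2c = 0, and relations along alternating matrices are determined only modulo y itself. What
    helps is that v -> v M0 v^T is additive: a vector d at which it is nonzero moves l to l + d M0,
    and c = 0 follows. This is why M0 has to be nonalternating when ker M0 may be a line. Three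
    spaces of vectors w are compared, not two: that W1 + W2 is orthogonal to W3 bounds its dimension
    by n - s, and only then is the intersection of W1 and W2 large enough. The two thresholds drop
    by 1 and s - 1 from n to n - 1, and by 2r - 3 and n + s - 2 when n and r are lowered by two and
    s by one. The losses, dim S_l for one kernel and at most dim S_l + n - 1 for two, are weighed
    against these numbers. *)

(** * Row vectors as points and as linear forms *)

Section Dot.
Variable K : fieldType.

Definition dot n (u v : 'rV[K]_n) : K := (u *m v^T) 0 0.

Lemma mulmx_dot n (u v : 'rV[K]_n) : u *m v^T = (dot u v)%:M.
Proof. by rewrite [LHS]mx11_scalar. Qed.

Lemma dotC n (u v : 'rV[K]_n) : dot u v = dot v u.
Proof. by rewrite /dot -[u *m v^T]trmxK trmx_mul trmxK mxE. Qed.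

Lemma dotDl n (u v w : 'rV[K]_n) : dot (u + v) w = dot u w + dot v w.
Proof. by rewrite /dot mulmxDl mxE. Qed.

Lemma dotZl n a (u w : 'rV[K]_n) : dot (a *: u) w = a * dot u w.
Proof. by rewrite /dot -scalemxAl mxE. Qed.

Lemma dotNl n (u w : 'rV[K]_n) : dot (- u) w = - dot u w.
Proof. by rewrite -scaleN1r dotZl mulN1r. Qed.

Lemma dot0l n (w : 'rV[K]_n) : dot 0 w = 0.
Proof. by rewrite /dot mul0mx mxE. Qed.

Lemma dotBl n (u v w : 'rV[K]_n) : dot (u - v) w = dot u w - dot v w.
Proof. by rewrite dotDl dotNl. Qed.

Lemma dotDr n (u v w : 'rV[K]_n) : dot w (u + v) = dot w u + dot w v.
Proof. by rewrite !(dotC w) dotDl. Qed.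

Lemma dotZr n a (u w : 'rV[K]_n) : dot w (a *: u) = a * dot w u.
Proof. by rewrite !(dotC w) dotZl. Qed.

Lemma dotNr n (u w : 'rV[K]_n) : dot w (- u) = - dot w u.
Proof. by rewrite !(dotC w) dotNl. Qed.

Lemma dot0r n (w : 'rV[K]_n) : dot w 0 = 0.
Proof. by rewrite dotC dot0l. Qed.

Lemma dotBr n (u v w : 'rV[K]_n) : dot w (u - v) = dot w u - dot w v.
Proof. by rewrite dotDr dotNr. Qed.

Definition dotE := (dotDl, dotDr, dotBl, dotBr, dotZl, dotZr, dotNl, dotNr, dot0l, dot0r).

Lemma dot_mulmxl m n (u : 'rV[K]_m) (M : 'M_(m, n)) v : dot (u *m M) v = dot u (v *m M^T).
Proof. by rewrite /dot trmx_mul trmxK mulmxA. Qed.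

Lemma dot_mulmxr m n (u : 'rV[K]_m) (M : 'M_(n, m)) v : dot u (v *m M) = dot (u *m M^T) v.
Proof. by rewrite dotC dot_mulmxl dotC. Qed.

Lemma mul_outer m n (u v : 'rV[K]_m) (w : 'rV[K]_n) : u *m (v^T *m w) = dot u v *: w.
Proof. by rewrite mulmxA mulmx_dot mul_scalar_mx. Qed.

Lemma dot_delta n (u : 'rV[K]_n) i : dot u (delta_mx 0 i) = u 0 i.
Proof.
rewrite /dot mxE (bigD1 i) //= big1 ?addr0 => [|j ji]; first by rewrite !mxE !eqxx mulr1.
by rewrite !mxE (negPf ji) andbF mulr0.
Qed.

Lemma dot_inj n (u v : 'rV[K]_n) : (forall w, dot w u = dot w v) -> u = v.
Proof.
by move=> h; apply/rowP=> i; rewrite -!dot_delta dotC h dotC.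
Qed.

Lemma mulmx_tr0 m n (B : 'M[K]_(m, n)) (l : 'rV[K]_n) :
  B *m l^T = 0 -> forall u, dot (u *m B) l = 0.
Proof. by move=> Bl u; rewrite /dot -mulmxA Bl mulmx0 mxE. Qed.

Lemma mulmx_tr0P m n (B : 'M[K]_(m, n)) (l : 'rV[K]_n) :
  (B *m l^T = 0) <-> (l *m B^T = 0).
Proof.
by split=> h; apply: trmx_inj; rewrite trmx_mul ?trmxK h trmx0.
Qed.

Lemma dot_ker n (l u : 'rV[K]_n) : (u <= kermx l^T)%MS = (dot u l == 0).
Proof.
apply/idP/eqP=> [/sub_kermxP h|h]; first by rewrite /dot h mxE.
by apply/sub_kermxP; rewrite mulmx_dot h -scalemx1 scale0r.
Qed.

Lemma sub_mulmx0 m1 m2 n p (A : 'M[K]_(m1, n)) (B : 'M_(m2, n)) (C : 'M_(n, p)) :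
  (A <= B)%MS -> B *m C = 0 -> A *m C = 0.
Proof. by case/submxP=> D ->; rewrite -mulmxA => ->; rewrite mulmx0. Qed.

(** A column of [cokermx P] on which [phi] does not vanish, rescaled. *)
Lemma sep m n (phi : 'rV[K]_n) (P : 'M_(m, n)) :
  ~~ (phi <= P)%MS -> exists2 a : 'rV_n, a *m P^T = 0 & dot a phi = 1.
Proof.
rewrite submxE => nz.
have [j nzj]: exists j, (phi *m cokermx P) 0 j != 0.
  apply/existsP; apply: contraNT nz; rewrite negb_exists => /forallP h.
  by apply/eqP/rowP=> j; rewrite [RHS]mxE; apply/eqP; rewrite -[_ == _]negbK h.
set c := (phi *m cokermx P) 0 j in nzj *.
exists (c^-1 *: (col j (cokermx P))^T).
  rewrite -scalemxAl -trmx_mul colE mulmxA mulmx_coker mul0mx trmx0 scaler0 //.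
by rewrite dotZl dotC /dot trmxK colE mulmxA -colE mxE -/c mulVf.
Qed.

Lemma sep0 n (phi : 'rV[K]_n) : phi != 0 -> exists a : 'rV_n, dot a phi = 1.
Proof.
move=> nz; have h : ~~ (phi <= (0 : 'M_n))%MS by rewrite submx0.
by have [a _ ha] := sep h; exists a.
Qed.

Lemma sep2 n (l m : 'rV[K]_n) : ~~ (m <= l)%MS ->
  exists2 z : 'rV_n, dot z l = 0 & dot z m = 1.
Proof.
move=> h; have [a a0 a1] := sep h.
by exists a => //; rewrite /dot a0 mxE.
Qed.

Lemma nsubC n (l m : 'rV[K]_n) : l != 0 -> ~~ (m <= l)%MS -> ~~ (l <= m)%MS.
Proof.
move=> l0; apply: contra => /sub_rVP [a la].
have a0 : a != 0 by apply: contraNneq l0 => a0; rewrite la a0 scale0r.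
by apply/sub_rVP; exists a^-1; rewrite la scalerA mulVf // scale1r.
Qed.

Lemma rank_ge k n m (N : 'M[K]_(k, n)) (M : 'M_(n, m)) :
  (forall c : 'rV_k, c *m N *m M = 0 -> c = 0) -> (k <= \rank M)%N.
Proof.
move=> h; apply: leq_trans (mxrankM_maxr N M).
suff /eqP -> : row_free (N *m M) by [].
by apply: inj_row_free => v; rewrite mulmxA => /h.
Qed.

(** A nondegenerate compression in every characteristic, without diagonalisation: for a right
    inverse [R] of [row_base M], symmetry makes [R^T *m M] span the row space of [M], and [M *m R]
    is [col_base M]. The rank bounds [rank_hyper], [rank_prod] and [rank_sq] start from such a
    block. *)
Lemma sym_unit_sub n (M : 'M[K]_n) : M^T = M ->
  exists Y : 'M_(\rank M, n), Y *m M *m Y^T \in unitmx.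
Proof.
move=> sM; set k := \rank M.
have [R hR] : exists R : 'M_(n, k), row_base M *m R = 1%:M.
  exact/row_freeP/row_base_free.
have [L hL] : exists L : 'M_(k, n), L *m col_base M = 1%:M.
  apply/row_fullP; exact: col_base_full.
exists R^T.
have sub : (R^T *m M :=: M)%MS.
  apply/eqmxP; rewrite submxMl /=.
  have -> : R^T *m M = (M *m R)^T by rewrite trmx_mul sM.
  rewrite -{1}sM -[X in (X^T <= _)%MS]mulmx_base -[X in (_ <= (X *m _)^T)%MS]mulmx_base.
  rewrite -mulmxA hR mulmx1 trmx_mul; exact: submxMl.
rewrite trmxK -row_free_unit /row_free.
have e : (R^T *m M *m R :=: M *m R)%MS by apply: eqmxMr.
rewrite e -[X in \rank (X *m _)]mulmx_base -mulmxA hR mulmx1.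
by rewrite -mxrank_tr; apply/eqP; rewrite mxrank_tr; apply/eqP; rewrite -/(row_full _) col_base_full.
Qed.

Lemma rank_congr m n (B : 'M[K]_(m, n)) (M : 'M_n) : (\rank (B *m M *m B^T) <= \rank M)%N.
Proof. exact: leq_trans (mxrankM_maxl _ _) (mxrankM_maxr _ _). Qed.

Lemma sym_congr m n (B : 'M[K]_(m, n)) (M : 'M_n) : M^T = M -> (B *m M *m B^T)^T = B *m M *m B^T.
Proof. by move=> sM; rewrite !trmx_mul trmxK sM mulmxA. Qed.

Lemma dot_sym n (M : 'M[K]_n) u v : M^T = M -> dot (u *m M) v = dot (v *m M) u.
Proof. by move=> sM; rewrite dot_mulmxl sM dotC. Qed.

Lemma ex_basis m n (A : 'M[K]_(m, n)) k : \rank A = k ->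
  exists2 B : 'M_(k, n), row_free B & (B :=: A)%MS.
Proof. by move=> <-; exists (row_base A); [exact: row_base_free | exact: eq_row_base]. Qed.

Lemma row_vec0 n (u : 'rV[K]_n) : (forall w, dot u w = 0) -> u = 0.
Proof. by move=> h; apply: dot_inj => w; rewrite dotC h dot0r. Qed.

End Dot.

(** * Rank of a form against the rank of its restrictions *)

Section Rank.
Variable K : fieldType.

(** A nonsingular block [Z] inside ker v is enlarged by [x] and a vector [p] with v(p) = 1. Pairing
    a combination killed by [M] with [x] isolates the coefficient of [p]; pairing with [Z] removes
    [Z]. The pair x, p contributes two to the rank. *)
Lemma rank_hyper n (M : 'M[K]_n) (x v : 'rV_n) m (W : 'M_(m, n)) :
  M^T = M -> x *m M = v -> v != 0 -> dot x v = 0 -> W *m v^T = 0 ->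
  (\rank (W *m M *m W^T) + 2 <= \rank M)%N.
Proof.
move=> sM xM v0 xv Wv.
have [Y uY] := sym_unit_sub (sym_congr W sM).
set k := \rank _ in Y uY *.
set Z := Y *m W; have Zv : Z *m v^T = 0 by rewrite -mulmxA Wv mulmx0.
have uZ : Z *m M *m Z^T \in unitmx by rewrite /Z trmx_mul !mulmxA in uY *.
have [p pv] := sep0 v0.
rewrite addnC; apply: (@rank_ge K (1 + 1 + k) n n (col_mx (col_mx x p) Z)) => c.
rewrite -(hsubmxK c) -(hsubmxK (lsubmx c)).
move: (lsubmx (lsubmx c)) (rsubmx (lsubmx c)) (rsubmx c) => a b z {c}.
rewrite !mul_row_col [a]mx11_scalar [b]mx11_scalar !mul_scalar_mx.
move: (a 0 0) (b 0 0) => {}a {}b e.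
have ev w : dot (a *: x + b *: p + z *m Z) (w *m M) = 0.
  by rewrite dot_mulmxr sM e dot0l.
have b0 : b = 0.
  by move: (ev x); rewrite xM !dotE xv pv (mulmx_tr0 Zv) mulr0 mulr1 add0r addr0.
have z0 : z = 0.
  have : z *m (Z *m M *m Z^T) = 0.
    rewrite b0 scale0r addr0 in e.
    move/(congr1 (mulmx^~ Z^T)): e.
    rewrite mul0mx !mulmxDl -!scalemxAl xM.
    by move/mulmx_tr0P: Zv => ->; rewrite scaler0 add0r !mulmxA.
  by move/(congr1 (mulmx^~ (invmx (Z *m M *m Z^T)))); rewrite mulmxK // mul0mx.
move: e; rewrite z0 b0 mul0mx scale0r !addr0 -scalemxAl xM => /eqP.
by rewrite scaler_eq0 (negPf v0) orbF => /eqP ->; rewrite !raddf0 !row_mx0.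
Qed.

(** Here [x] is anisotropic and orthogonal to ker v, so it adds one to the rank of any part of ker
    v. *)
Lemma rank_aniso n (M : 'M[K]_n) (x v : 'rV_n) m (W : 'M_(m, n)) :
  M^T = M -> x *m M = v -> dot x v != 0 -> W *m v^T = 0 ->
  (\rank (W *m M *m W^T) + 1 <= \rank M)%N.
Proof.
move=> sM xM xv Wv.
have [Y uY] := sym_unit_sub (sym_congr W sM).
set k := \rank _ in Y uY *.
set Z := Y *m W; have Zv : Z *m v^T = 0 by rewrite -mulmxA Wv mulmx0.
have uZ : Z *m M *m Z^T \in unitmx by rewrite /Z trmx_mul !mulmxA in uY *.
rewrite addnC; apply: (@rank_ge K (1 + k) n n (col_mx x Z)) => c.
rewrite -(hsubmxK c); move: (lsubmx c) (rsubmx c) => a z {c}.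
rewrite !mul_row_col [a]mx11_scalar !mul_scalar_mx.
move: (a 0 0) => {}a e.
have a0 : a = 0.
  have : dot (a *: x + z *m Z) (x *m M) = 0 by rewrite dot_mulmxr sM e dot0l.
  rewrite xM !dotE (mulmx_tr0 Zv) addr0 => /eqP.
  by rewrite mulf_eq0 (negPf xv) orbF => /eqP.
have z0 : z = 0.
  have : z *m (Z *m M *m Z^T) = 0.
    by move/(congr1 (mulmx^~ Z^T)): e; rewrite a0 scale0r add0r mul0mx !mulmxA.
  by move/(congr1 (mulmx^~ (invmx (Z *m M *m Z^T)))); rewrite mulmxK // mul0mx.
by rewrite z0 a0 !raddf0 !row_mx0.
Qed.

(** The polar form of v -> l(v) m(v), that is the product [l m]. In characteristic 2 it is
    alternating and [prodf l l] vanishes, so squares [l^T *m l] are treated separately. *)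
Definition prodf n (l m : 'rV[K]_n) : 'M_n := l^T *m m + m^T *m l.

Lemma prodfC n (l m : 'rV[K]_n) : prodf l m = prodf m l.
Proof. by rewrite /prodf addrC. Qed.

Lemma prodf_sym n (l m : 'rV[K]_n) : (prodf l m)^T = prodf l m.
Proof. by rewrite /prodf linearD /= !trmx_mul !trmxK addrC. Qed.

Lemma sqf_sym n (l : 'rV[K]_n) : (l^T *m l)^T = l^T *m l.
Proof. by rewrite trmx_mul trmxK. Qed.

Lemma mul_prodf n (u l m : 'rV[K]_n) : u *m prodf l m = dot u l *: m + dot u m *: l.
Proof. by rewrite mulmxDr !mul_outer. Qed.

Lemma prodfDl n (l l' m : 'rV[K]_n) : prodf (l + l') m = prodf l m + prodf l' m.
Proof. by rewrite /prodf linearD /= mulmxDl mulmxDr addrACA. Qed.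

Lemma prodfZl n a (l m : 'rV[K]_n) : prodf (a *: l) m = a *: prodf l m.
Proof. by rewrite /prodf linearZ /= -scalemxAl -scalemxAr scalerDr. Qed.

Lemma prodfDr n (l m m' : 'rV[K]_n) : prodf l (m + m') = prodf l m + prodf l m'.
Proof. by rewrite !(prodfC l) prodfDl. Qed.

Lemma prodfZr n a (l m : 'rV[K]_n) : prodf l (a *: m) = a *: prodf l m.
Proof. by rewrite !(prodfC l) prodfZl. Qed.

Lemma prodf_congr m n (B : 'M[K]_(m, n)) (l l' : 'rV_n) :
  B *m prodf l l' *m B^T = prodf (l *m B^T) (l' *m B^T).
Proof. by rewrite /prodf !trmx_mul !trmxK mulmxDr mulmxDl !mulmxA. Qed.

Lemma sqf_congr m n (B : 'M[K]_(m, n)) (l : 'rV_n) :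
  B *m (l^T *m l) *m B^T = (l *m B^T)^T *m (l *m B^T).
Proof. by rewrite trmx_mul trmxK !mulmxA. Qed.

(** A polynomial of degree at most two with the distinct roots 0, 1, t0 vanishes. *)
Lemma quad_zero (t0 a0 a1 a2 : K) : t0 != 0 -> t0 != 1 ->
  a0 = 0 -> a0 + a1 + a2 = 0 -> a0 + a1 * t0 + a2 * t0 ^+ 2 = 0 -> a1 = 0 /\ a2 = 0.
Proof.
move=> h0 h1 -> ; rewrite !add0r => e1 e2.
have e3 : a1 = - a2 by apply/eqP; rewrite -subr_eq0 opprK e1.
move: e2; rewrite e3 mulNr addrC expr2 mulrA -mulrBl -[X in _ - X]mulr1 -mulrBr => /eqP.
rewrite !mulf_eq0 (negPf h0) orbF subr_eq0 (negPf h1) orbF => /eqP ->.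
by rewrite oppr0.
Qed.

(** Vectors dual to [l], [mu] are made orthogonal to a nonsingular block on the common kernel. The
    determinant of what remains is quadratic in t with leading coefficient -1, hence nonzero at 0, 1
    or t0. *)
Lemma rank_prod n (M : 'M[K]_n) (l mu : 'rV_n) (a : K) m (B : 'M_(m, n)) :
  (exists x : K, x != 0 /\ x != 1) -> M^T = M ->
  l != 0 -> ~~ (mu <= l)%MS -> B *m l^T = 0 -> B *m mu^T = 0 ->
  exists t, (\rank (B *m M *m B^T) + 2 <= \rank (M + t *: (prodf l mu + a *: (l^T *m l)))%R)%N.
Proof.
move=> [t0 [t00 t01]] sM l0 nml Bl Bm.
have [Y uY] := sym_unit_sub (sym_congr B sM).
set k := \rank _ in Y uY *.
set Z := Y *m B.
have Zl : Z *m l^T = 0 by rewrite -mulmxA Bl mulmx0.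
have Zm : Z *m mu^T = 0 by rewrite -mulmxA Bm mulmx0.
have uZ : Z *m M *m Z^T \in unitmx by rewrite /Z trmx_mul !mulmxA in uY *.
have [z zl zm] := sep2 nml.
have [x xm xl] := sep2 (nsubC l0 nml).
pose A := Z *m M *m Z^T.
(* Projection onto the M-orthogonal of [Z]; the values of [l] and [mu] do not change, since both
   vanish on [Z]. *)
pose fix_ (u : 'rV[K]_n) : 'rV_n := u - u *m M *m Z^T *m invmx A *m Z.
have fixl u : dot (fix_ u) l = dot u l by rewrite dotBl (mulmx_tr0 Zl) subr0.
have fixm u : dot (fix_ u) mu = dot u mu by rewrite dotBl (mulmx_tr0 Zm) subr0.
have fixZ (u : 'rV_n) : fix_ u *m M *m Z^T = 0.
  rewrite !mulmxBl.
  have -> : u *m M *m Z^T *m invmx A *m Z *m M *m Z^T = u *m M *m Z^T *m (invmx A *m A).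
    by rewrite /A !mulmxA.
  by rewrite mulVmx // mulmx1 subrr.
move: (fix_ x) (fix_ z) (fixl x) (fixl z) (fixm x) (fixm z) (fixZ x) (fixZ z).
rewrite xl zl xm zm => {xl zl xm zm fixl fixm fixZ} {}x {}z xl zl xm zm xZ zZ.
pose al := dot (x *m M) x; pose be := dot (x *m M) z; pose ga := dot (z *m M) z.
pose Q : 'M_n := prodf l mu + a *: (l^T *m l).
have QZ (u : 'rV_n) : u *m Q *m Z^T = 0.
  rewrite /Q mulmxDr mul_prodf -scalemxAr mul_outer !mulmxDl -!scalemxAl.
  by move/mulmx_tr0P: Zl => ->; move/mulmx_tr0P: Zm => ->; rewrite !scaler0 !addr0.
have dQ (u w : 'rV_n) : dot (u *m Q) w =
    dot u l * dot mu w + dot u mu * dot l w + a * (dot u l * dot l w).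
  by rewrite /Q mulmxDr mul_prodf -scalemxAr mul_outer !dotE.
have [t dt] : exists t, (al + t * a) * ga - (be + t) ^+ 2 != 0.
  case: (eqVneq ((al + 0 * a) * ga - (be + 0) ^+ 2) 0) => [e0|]; last by exists 0.
  case: (eqVneq ((al + 1 * a) * ga - (be + 1) ^+ 2) 0) => [e1|]; last by exists 1.
  case: (eqVneq ((al + t0 * a) * ga - (be + t0) ^+ 2) 0) => [e2|]; last by exists t0.
  have [] := @quad_zero t0 (al * ga - be ^+ 2) (a * ga - 2%:R * be) (-1) t00 t01.
  - by rewrite -e0; ring.
  - by rewrite -e1; ring.
  - by rewrite -e2; ring.
  - by move=> _ /eqP; rewrite oppr_eq0 oner_eq0.
exists t; rewrite -/Q; move: Q QZ dQ => Q QZ dQ.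
rewrite addnC; apply: (@rank_ge K (1 + 1 + k) n n (col_mx (col_mx x z) Z)) => c.
rewrite -(hsubmxK c) -(hsubmxK (lsubmx c)).
move: (lsubmx (lsubmx c)) (rsubmx (lsubmx c)) (rsubmx c) => ca cb cz {c}.
rewrite !mul_row_col [ca]mx11_scalar [cb]mx11_scalar !mul_scalar_mx.
move: (ca 0 0) (cb 0 0) => {}ca {}cb e.
have cz0 : cz = 0.
  have : cz *m (Z *m M *m Z^T) = 0.
    move/(congr1 (mulmx^~ Z^T)): e.
    rewrite mul0mx mulmxDr mulmxDl -scalemxAr -scalemxAl QZ scaler0 addr0.
    by rewrite !mulmxDl -!scalemxAl xZ zZ !scaler0 !add0r !mulmxA.
  by move/(congr1 (mulmx^~ (invmx (Z *m M *m Z^T)))); rewrite mulmxK // mul0mx.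
move: e; rewrite cz0 mul0mx addr0 => e.
have zx : dot (z *m M) x = be by rewrite dot_sym.
have dM w : ca * dot (x *m M) w + cb * dot (z *m M) w
    + t * (ca * dot (x *m Q) w + cb * dot (z *m Q) w) = 0.
  move/(congr1 (fun u => dot u w)): e.
  by rewrite dot0l mulmxDr -scalemxAr !mulmxDl -!scalemxAl !dotE.
have ex : ca * (al + t * a) + cb * (be + t) = 0.
  rewrite -(dM x) !dQ zx -/al -/be !(dotC l) !(dotC mu) xl xm zl zm; ring.
have ez : ca * (be + t) + cb * ga = 0.
  rewrite -(dM z) !dQ -/be -/ga !(dotC l) !(dotC mu) xl xm zl zm; ring.
have ca0 : ca * ((al + t * a) * ga - (be + t) ^+ 2) = 0.
  transitivity (ga * (ca * (al + t * a) + cb * (be + t)) - (be + t) * (ca * (be + t) + cb * ga)).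
    ring.
  by rewrite ex ez !mulr0 subr0.
have cb0 : cb * ((al + t * a) * ga - (be + t) ^+ 2) = 0.
  transitivity ((al + t * a) * (ca * (be + t) + cb * ga) - (be + t) * (ca * (al + t * a) + cb * (be + t))).
    ring.
  by rewrite ex ez !mulr0 subr0.
move/eqP: ca0; rewrite mulf_eq0 (negPf dt) orbF => /eqP ->.
move/eqP: cb0; rewrite mulf_eq0 (negPf dt) orbF => /eqP ->.
by rewrite !raddf0 !row_mx0.
Qed.

(** As for [rank_prod], with one vector: the remaining determinant is al + t, and t = 1 - al makes
    it 1. *)
Lemma rank_sq n (M : 'M[K]_n) (l : 'rV_n) m (B : 'M_(m, n)) :
  M^T = M -> l != 0 -> B *m l^T = 0 ->
  exists t, (\rank (B *m M *m B^T) + 1 <= \rank (M + t *: (l^T *m l))%R)%N.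
Proof.
move=> sM l0 Bl.
have [Y uY] := sym_unit_sub (sym_congr B sM).
set k := \rank _ in Y uY *.
set Z := Y *m B.
have Zl : Z *m l^T = 0 by rewrite -mulmxA Bl mulmx0.
have uZ : Z *m M *m Z^T \in unitmx by rewrite /Z trmx_mul !mulmxA in uY *.
have [x0 x0l] := sep0 l0.
pose A := Z *m M *m Z^T.
pose x := x0 - x0 *m M *m Z^T *m invmx A *m Z.
have xl : dot x l = 1 by rewrite dotBl (mulmx_tr0 Zl) subr0.
have xZ : x *m M *m Z^T = 0.
  rewrite !mulmxBl.
  have -> : x0 *m M *m Z^T *m invmx A *m Z *m M *m Z^T = x0 *m M *m Z^T *m (invmx A *m A).
    by rewrite /A !mulmxA.
  by rewrite mulVmx // mulmx1 subrr.
clearbody x; pose al := dot (x *m M) x.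
exists (1 - al).
rewrite addnC; apply: (@rank_ge K (1 + k) n n (col_mx x Z)) => c.
rewrite -(hsubmxK c); move: (lsubmx c) (rsubmx c) => ca cz {c}.
rewrite !mul_row_col [ca]mx11_scalar !mul_scalar_mx.
move: (ca 0 0) => {}ca e.
have cz0 : cz = 0.
  have : cz *m (Z *m M *m Z^T) = 0.
    move/(congr1 (mulmx^~ Z^T)): e.
    rewrite mul0mx mulmxDr mulmxDl -scalemxAr mul_outer -2!scalemxAl.
    move/mulmx_tr0P: Zl => ->; rewrite !scaler0 addr0.
    by rewrite !mulmxDl -!scalemxAl xZ !scaler0 !add0r !mulmxA.
  by move/(congr1 (mulmx^~ (invmx (Z *m M *m Z^T)))); rewrite mulmxK // mul0mx.
move: e; rewrite cz0 mul0mx addr0 => e.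
move/(congr1 (fun w => dot w x)): e; rewrite dot0l mulmxDr -scalemxAr.
rewrite mul_outer -scalemxAl !dotE (dotC l) xl -/al => e.
have -> : ca = 0 by rewrite -e; ring.
by rewrite !raddf0 !row_mx0.
Qed.

End Rank.


(** * Restriction maps on spaces of forms *)

Section Spaces.
Variable K : fieldType.

(** Restriction of a bilinear form to the row space of [B], in the coordinates given by [B]. *)
Definition rs m n (B : 'M[K]_(m, n)) : 'Hom('M[K]_n, 'M[K]_m) :=
  linfun (mulmxr B^T \o mulmx B).

Lemma rsE m n (B : 'M[K]_(m, n)) M : rs B M = B *m M *m B^T.
Proof. by rewrite lfunE. Qed.

Definition vec n (y : 'rV[K]_n) : 'Hom('M[K]_n, 'rV[K]_n) := linfun (mulmx y).

Lemma vecE n (y : 'rV[K]_n) M : vec y M = y *m M.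
Proof. by rewrite lfunE. Qed.

(** With [B] a basis of ker l this is the space S_l. *)
Definition Sl n (S : {vspace 'M[K]_n}) m (B : 'M[K]_(m, n)) := (S :&: lker (rs B))%VS.

Lemma mem_Sl n (S : {vspace 'M[K]_n}) m (B : 'M[K]_(m, n)) M :
  (M \in Sl S B) = (M \in S) && (B *m M *m B^T == 0).
Proof. by rewrite memv_cap memv_ker rsE. Qed.

Lemma dim_rs n (S : {vspace 'M[K]_n}) m (B : 'M[K]_(m, n)) :
  (\dim (Sl S B) + \dim (rs B @: S) = \dim S)%N.
Proof. exact: limg_ker_dim. Qed.

Lemma mem_rs n (S : {vspace 'M[K]_n}) m (B : 'M[K]_(m, n)) N :
  N \in (rs B @: S)%VS -> exists2 M, M \in S & N = B *m M *m B^T.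
Proof. by case/memv_imgP=> M MS ->; exists M => //; rewrite rsE. Qed.

Lemma rs_mem n (S : {vspace 'M[K]_n}) m (B : 'M[K]_(m, n)) M :
  M \in S -> B *m M *m B^T \in (rs B @: S)%VS.
Proof. by move=> MS; rewrite -rsE memv_img. Qed.

Lemma zero_sub n m m' (B : 'M[K]_(m, n)) (C : 'M_(m', n)) M :
  (C <= B)%MS -> B *m M *m B^T = 0 -> C *m M *m C^T = 0.
Proof.
case/submxP=> D -> h; rewrite trmx_mul -!mulmxA (mulmxA M) (mulmxA B) (mulmxA B) h.
by rewrite mul0mx mulmx0.
Qed.

Lemma zero_full n m (B : 'M[K]_(m, n)) M : row_full B -> B *m M *m B^T = 0 -> M = 0.
Proof.
move=> fB h; have : ((1%:M : 'M_n) <= B)%MS by exact: submx_full.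
by move/zero_sub => /(_ M h); rewrite mul1mx trmx1 mulmx1.
Qed.

Lemma dim_le_inj (aT rT : vectType K) (f : 'Hom(aT, rT)) (S : {vspace aT}) (W : {vspace rT}) :
  (forall v, v \in S -> f v = 0 -> v = 0) -> (forall v, v \in S -> f v \in W) ->
  (\dim S <= \dim W)%N.
Proof.
move=> inj sub; rewrite -(limg_ker_dim f S).
have -> : (S :&: lker f = 0)%VS.
  apply/eqP; rewrite -subv0; apply/subvP=> v; rewrite memv_cap memv_ker => /andP[vS /eqP fv].
  by rewrite memv0; apply/eqP; exact: inj.
rewrite dimv0 add0n dimvS //; apply/subvP=> _ /memv_imgP[v vS ->]; exact: sub.
Qed.

Lemma dim_ker_le (aT rT : vectType K) (f : 'Hom(aT, rT)) (S : {vspace aT}) (W : {vspace rT}) :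
  (forall v, v \in S -> f v \in W) ->
  (\dim S <= \dim (S :&: lker f) + \dim W)%N.
Proof.
move=> sub; rewrite -{1}(limg_ker_dim f S) leq_add2l.
by rewrite dimvS //; apply/subvP=> _ /memv_imgP[v vS ->]; exact: sub.
Qed.

Lemma dim_ker_full (aT rT : vectType K) (f : 'Hom(aT, rT)) (S : {vspace aT}) :
  (\dim S <= \dim (S :&: lker f) + dim rT)%N.
Proof.
by rewrite -dimvf; apply: dim_ker_le => v _; rewrite memvf.
Qed.

Definition symsp n (S : {vspace 'M[K]_n}) := forall M, M \in S -> M^T = M.

Lemma symsp_rs n (S : {vspace 'M[K]_n}) m (B : 'M[K]_(m, n)) : symsp S -> symsp (rs B @: S).
Proof. by move=> sS N /mem_rs[M /sS sM ->]; exact: sym_congr. Qed.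

Lemma symsp_sub n (S T : {vspace 'M[K]_n}) : (T <= S)%VS -> symsp S -> symsp T.
Proof. by move=> /subvP TS sS M /TS /sS. Qed.

Lemma Sl_subv n (S : {vspace 'M[K]_n}) m (B : 'M[K]_(m, n)) : (Sl S B <= S)%VS.
Proof. exact: capvSl. Qed.

Lemma dim_rV n : \dim {:'rV[K]_n} = n.
Proof. by rewrite dimvf dim_matrix; exact: mul1n. Qed.

(** A form vanishing on ker l is determined by the row x M for one [x] with l(x) = 1. *)
Lemma dim_Sl_le n (S : {vspace 'M[K]_n}) m (B : 'M[K]_(m, n)) (l : 'rV_n) :
  symsp S -> l != 0 -> (kermx l^T <= B)%MS -> (\dim (Sl S B) <= n)%N.
Proof.
move=> sS l0 kB.
have [x xl] := sep0 l0.
rewrite -[leqRHS](dim_rV n); apply: (@dim_le_inj _ _ (vec x)) => [M|M _]; last exact: memvf.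
rewrite mem_Sl vecE => /andP[MS /eqP BM] xM.
have kM := zero_sub kB BM.
apply: (@zero_full n _ (col_mx x (kermx l^T))).
  rewrite -sub1mx; apply/row_subP => i; set e := row i _.
  have -> : e = dot e l *: x + (e - dot e l *: x) by rewrite addrC subrK.
  rewrite -addsmxE addmx_sub_adds //; first by rewrite scalemx_sub.
  by rewrite dot_ker !dotE xl mulr1 subrr.
rewrite mul_col_mx tr_col_mx mul_mx_row !mul_col_mx xM kM mul0mx.
have -> : kermx l^T *m M *m x^T = 0.
  by apply: trmx_inj; rewrite !trmx_mul trmxK (sS _ MS) mulmxA xM mul0mx trmx0.
by rewrite mul0mx; apply/matrixP=> i j; rewrite !mxE; case: splitP => k _; rewrite !mxE; case: splitP => k' _; rewrite !mxE.
Qed.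

Lemma bin2S n : 'C(n.+1, 2) = ('C(n, 2) + n)%N.
Proof. by rewrite binS bin1. Qed.

Lemma dim_sym n (S : {vspace 'M[K]_n}) : symsp S -> (\dim S <= 'C(n.+1, 2))%N.
Proof.
elim: n S => [|n IH] S sS.
  by apply: leq_trans (dimvS (subvf S)) _; rewrite dimvf.
pose l : 'rV[K]_n.+1 := delta_mx 0 0.
have l0 : l != 0.
  by apply/eqP=> /rowP/(_ 0); rewrite !mxE eqxx => /eqP; rewrite oner_eq0.
have rk : \rank (kermx l^T) = n.
  by rewrite mxrank_ker mxrank_tr rank_rV l0 subn1.
have [B fB eB] := ex_basis rk.
rewrite -(dim_rs S B) bin2S addnC leq_add //.
  by apply: IH; exact: symsp_rs.
by apply: dim_Sl_le sS l0 _; rewrite eB.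
Qed.

Lemma ex_kerbasis n (l : 'rV[K]_n) : l != 0 ->
  exists2 B : 'M[K]_(n.-1, n), row_free B & (B :=: kermx l^T)%MS.
Proof.
by move=> l0; apply: ex_basis; rewrite mxrank_ker mxrank_tr rank_rV l0 subn1.
Qed.

(** Both sides agree on ker l and against [x]; the square corrects the value at (x, x), which the
    product counts twice. *)
Lemma form_hyper n (M : 'M[K]_n) l x m (B : 'M[K]_(m, n)) :
  M^T = M -> dot x l = 1 -> (kermx l^T <= B)%MS -> B *m M *m B^T = 0 ->
  M = prodf l (x *m M) + (- dot (x *m M) x) *: (l^T *m l).
Proof.
move=> sM xl kB BM.
have kM := zero_sub kB BM.
set xi := x *m M; set N := RHS.
have sN : N^T = N by rewrite linearD linearZ /= prodf_sym sqf_sym.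
have xN : x *m N = xi.
  rewrite mulmxDr mul_prodf -scalemxAr mul_outer xl !scale1r (dotC x) scaleNr.
  by rewrite addrK.
apply/eqP; rewrite -subr_eq0; apply/eqP.
apply: (@zero_full n _ (col_mx x (kermx l^T))).
  rewrite -sub1mx; apply/row_subP => i; set e := row i _.
  have -> : e = dot e l *: x + (e - dot e l *: x) by rewrite addrC subrK.
  rewrite -addsmxE addmx_sub_adds //; first by rewrite scalemx_sub.
  by rewrite dot_ker !dotE xl mulr1 subrr.
set D := M - N.
have sD : D^T = D by rewrite linearB /= sM sN.
have xD : x *m D = 0 by rewrite mulmxBr xN subrr.
have kD : kermx l^T *m D *m (kermx l^T)^T = 0.
  rewrite mulmxBr mulmxBl kM /N mulmxDr mulmxDl prodf_congr -scalemxAr -scalemxAl sqf_congr.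
  have -> : l *m (kermx l^T)^T = 0 by apply: trmx_inj; rewrite trmx_mul trmxK mulmx_ker trmx0.
  by rewrite /prodf !trmx0 !mul0mx mulmx0 scaler0 !addr0 subrr.
rewrite mul_col_mx tr_col_mx mul_mx_row !mul_col_mx xD kD mul0mx.
have -> : kermx l^T *m D *m x^T = 0.
  by apply: trmx_inj; rewrite !trmx_mul trmxK sD mulmxA xD mul0mx trmx0.
by rewrite mul0mx; apply/matrixP=> i j; rewrite !mxE; case: splitP => k _; rewrite !mxE; case: splitP => k' _; rewrite !mxE.
Qed.

(** Equality in [dim_Sl_le] makes M -> x M surjective on S_l. *)
Lemma Sl_full n (S : {vspace 'M[K]_n}) m (B : 'M[K]_(m, n)) l x :
  symsp S -> dot x l = 1 -> (kermx l^T <= B)%MS -> (n <= \dim (Sl S B))%N ->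
  forall xi, prodf l xi + (- dot xi x) *: (l^T *m l) \in S.
Proof.
move=> sS xl kB nd xi.
have im : ((vec x @: Sl S B) = fullv)%VS.
  apply/eqP; rewrite eqEdim subvf dim_rV.
  rewrite limg_dim_eq //; apply/eqP; rewrite -subv0; apply/subvP=> M.
  rewrite memv_cap memv_ker vecE mem_Sl => /andP[/andP[MS /eqP BM] /eqP xM].
  rewrite (form_hyper (sS _ MS) xl kB BM) xM /prodf dot0l oppr0 scale0r.
  by rewrite trmx0 mulmx0 mul0mx !addr0 memv0.
have : xi \in (vec x @: Sl S B)%VS by rewrite im memvf.
case/memv_imgP=> M; rewrite mem_Sl vecE => /andP[MS /eqP BM] ->.
by rewrite -(form_hyper (sS _ MS) xl kB BM).
Qed.

Definition ev n (i : 'I_n) : 'rV[K]_n := delta_mx 0 i.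

Lemma sym_decomp n (N : 'M[K]_n) : N^T = N ->
  N = \sum_i prodf (ev i) (\row_(j < n) (if (i < j)%N then N i j else 0))
      + \sum_i N i i *: ((ev i)^T *m ev i : 'M_n).
Proof.
move=> sN; apply/matrixP=> a b; rewrite !mxE !summxE.
have e1 i : (prodf (ev i) (\row_(j < n) (if (i < j)%N then N i j else 0)) : 'M_n) a b =
   (i == a)%:R * (if (i < b)%N then N i b else 0) + (if (i < a)%N then N i a else 0) * (i == b)%:R.
  by rewrite /prodf /ev !mxE !big_ord1 !mxE !eqxx /= ![_ == i]eq_sym.
under eq_bigr do rewrite e1.
have e2 i : (N i i *: ((ev i)^T *m ev i : 'M_n)) a b = (i == a)%:R * ((i == b)%:R * N i i).
  by rewrite /ev !mxE !big_ord1 !mxE !eqxx /= ![_ == i]eq_sym mulrC -mulrA.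
under [X in _ = _ + X]eq_bigr do rewrite e2.
rewrite big_split /=.
have d (F : 'I_n -> K) c : \sum_i (i == c)%:R * F i = F c.
  by rewrite (bigD1 c) //= eqxx mul1r big1 ?addr0 // => i /negPf ->; rewrite mul0r.
rewrite !d; under eq_bigr do rewrite mulrC.
rewrite d; case: (ltngtP a b) => [ab|ba|/val_inj ->].
- by rewrite (_ : (a == b) = false) ?mul0r ?addr0 //; apply: negbTE; rewrite neq_ltn ab.
- rewrite (_ : (a == b) = false) ?mul0r ?addr0 ?add0r; last by apply: negbTE; rewrite neq_ltn ba orbT.
  by rewrite -[in LHS]sN mxE.
- by rewrite eqxx mul1r !add0r.
Qed.

Lemma sym_span n (S : {vspace 'M[K]_n}) :
  (forall i xi, prodf (ev i) xi + (- xi 0 i) *: ((ev i)^T *m ev i) \in S) ->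
  forall N, N^T = N -> N \in S.
Proof.
move=> h N /sym_decomp ->.
have sq i : (ev i)^T *m ev i \in S.
  (* At xi = e_i the hypothesis gives twice the square of e_i minus that square. *)
  have := h i (ev i); rewrite [ev i 0 i]mxE !eqxx /= /prodf scaleN1r.
  by rewrite addrK.
apply: rpredD; apply: rpred_sum => i _; last by rewrite rpredZ.
have := h i (\row_j (if (i < j)%N then N i j else 0)).
by rewrite mxE ltnn oppr0 scale0r addr0.
Qed.

Lemma delta_neq0 n (i : 'I_n) : (ev i) != 0.
Proof.
by apply/eqP=> /rowP/(_ i); rewrite !mxE !eqxx => /eqP; rewrite oner_eq0.
Qed.

Lemma ker_sub n m (l : 'rV[K]_n) (B : 'M[K]_(m, n)) :
  l != 0 -> B *m l^T = 0 -> \rank B = n.-1 -> (B :=: kermx l^T)%MS.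
Proof.
move=> l0 Bl rB; apply/eqmxP.
have h : (B <= kermx l^T)%MS by apply/sub_kermxP.
rewrite -(geq_leqif (mxrank_leqif_eq h)).
by rewrite rB mxrank_ker mxrank_tr rank_rV l0 subn1.
Qed.

Lemma ker2_rank n (l mu : 'rV[K]_n) : l != 0 -> ~~ (mu <= l)%MS ->
  \rank (kermx (col_mx l mu)^T) = n.-2.
Proof.
move=> l0 nml; rewrite mxrank_ker mxrank_tr.
suff -> : \rank (col_mx l mu) = 2%N by rewrite subn2.
have /eqP -> // : row_free (col_mx l mu).
apply: inj_row_free => v; rewrite -(hsubmxK v) mul_row_col [lsubmx v]mx11_scalar [rsubmx v]mx11_scalar.
move: (lsubmx v 0 0) (rsubmx v 0 0) => a b; rewrite !mul_scalar_mx => e.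
have [z zl zm] := sep2 nml.
have b0 : b = 0 by move/(congr1 (dot z)): e; rewrite !dotE zl zm mulr0 mulr1 add0r.
move/eqP: e; rewrite b0 scale0r addr0 scaler_eq0 (negPf l0) orbF => /eqP ->.
by rewrite !raddf0 row_mx0.
Qed.

Lemma ex_ker2basis n (l mu : 'rV[K]_n) : l != 0 -> ~~ (mu <= l)%MS ->
  exists C : 'M[K]_(n.-2, n), [/\ row_free C, C *m l^T = 0, C *m mu^T = 0
    & forall u, dot u l = 0 -> dot u mu = 0 -> (u <= C)%MS].
Proof.
move=> l0 nml; have [C fC eC] := ex_basis (ker2_rank l0 nml).
exists C; split => //.
- have : C *m (col_mx l mu)^T = 0 by apply/sub_kermxP; rewrite eC.
  by rewrite tr_col_mx mul_mx_row -row_mx0 => /eq_row_mx[].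
- have : C *m (col_mx l mu)^T = 0 by apply/sub_kermxP; rewrite eC.
  by rewrite tr_col_mx mul_mx_row -row_mx0 => /eq_row_mx[].
- move=> u ul um; rewrite eC; apply/sub_kermxP.
  by rewrite tr_col_mx mul_mx_row !mulmx_dot ul um !raddf0 row_mx0.
Qed.

Lemma row_free_mull m n p (D : 'M[K]_(m, n)) (B : 'M_(n, p)) : row_free (D *m B) -> row_free D.
Proof.
move=> fDB; apply: inj_row_free => v vD; apply: (row_free_inj fDB).
by rewrite mulmxA vD !mul0mx.
Qed.

End Spaces.

(** * Affine spaces of singular matrices *)

(** The ledger shared by the symmetric and the alternating case: a dimension above the target leaves
    no slack, so S_l and the trace on ker l of the forms vanishing on two kernels both reach their
    maximum q. *)
Lemma tight_dims a c d p q t u v : (v + t = a)%N -> (a + u = d)%N -> (u <= p)%N -> (v <= c)%N ->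
  (c <= q)%N -> (t <= q)%N -> (p + q.-1 + q < d)%N -> c = q /\ (q <= t)%N.
Proof. lia. Qed.

Section Affine.
Variable K : fieldType.

(** Induction along a coordinate form [l] for which S_l is not full. If the square of [l] lies in
    [S], [rank_sq] makes the restriction to ker l singular. Otherwise a dimension above the bound
    forces equality for every nonzero element of S_l; the trace of [S] on ker l then contains all
    symmetric matrices, although a compression of it inherits singularity from [rank_prod]. *)
Lemma dim_sing_sym (hK : exists x : K, x != 0 /\ x != 1) n (A : 'M[K]_n) (S : {vspace 'M[K]_n}) :
  A^T = A -> symsp S -> (forall M, M \in S -> (\rank (A + M)%R < n)%N) ->
  (\dim S <= 'C(n, 2))%N.
Proof.
elim/ltn_ind: n A S => n IH A S sA sS sing.
have rkE M : M \in S -> (A + M)^T = A + M by move=> MS; rewrite linearD /= sA sS.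
case: (boolP [exists i : 'I_n, (\dim (Sl S (kermx (ev K i)^T)) < n)%N]); last first.
  rewrite negb_exists => /forallP full.
  have all N : N^T = N -> N \in S.
    apply: sym_span => i xi.
    have := @Sl_full K n S n (kermx (ev K i)^T) (ev K i) (ev K i) sS _ _ _ xi.
    rewrite !dot_delta; apply => //; first by rewrite mxE !eqxx.
    by rewrite leqNgt.
  have h : 1%:M - A \in S by apply: all; rewrite linearB /= trmx1 sA.
  by have := sing _ h; rewrite addrCA subrr addr0 mxrank1 ltnn.
case/existsP=> i; set l := ev K i; set c := \dim _ => cn.
have l0 : l != 0 by exact: delta_neq0.
have xl : dot l l = 1 by rewrite dot_delta mxE !eqxx.
have [B fB eB] := ex_kerbasis l0.
have Bl : B *m l^T = 0 by apply/sub_kermxP; rewrite eB.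
have kB : (kermx l^T <= B)%MS by rewrite eB.
have n0 : (0 < n)%N by apply: leq_ltn_trans (ltn_ord i).
have cE : c = \dim (Sl S B).
  congr (\dim _); apply/vspaceP=> M; rewrite !mem_Sl.
  by apply/andP/andP=> -[-> /eqP h]; split=> //; apply/eqP; apply: zero_sub h; rewrite eB.
have dT := dim_rs S B; rewrite -cE in dT.
have bn : 'C(n, 2) = ('C(n.-1, 2) + n.-1)%N by rewrite -bin2S prednK.
have sBA : (B *m A *m B^T)^T = B *m A *m B^T by exact: sym_congr.
have sT : symsp (rs B @: S) by exact: symsp_rs.
case: (boolP (l^T *m l \in S)) => [lS|lS].
  have : (\dim (rs B @: S) <= 'C(n.-1, 2))%N.
    apply: (IH _ _ (B *m A *m B^T)) => //; first by rewrite prednK.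
    move=> _ /mem_rs[M MS ->]; rewrite -mulmxDl -mulmxDr.
    have [t ht] := rank_sq (rkE M MS) l0 Bl.
    have := sing _ (rpredD MS (rpredZ t lS)); rewrite addrA => /(leq_ltn_trans ht).
    by rewrite addn1 ltn_predRL.
  lia.
case: (posnP c) => [c0|cpos].
  by rewrite -dT c0 add0n; apply: leq_trans (dim_sym sT) _; rewrite prednK.
rewrite leqNgt; apply/negP => big.
have nt Q : Q \in Sl S B -> Q != 0 -> ~~ (l *m Q <= l)%MS.
  rewrite mem_Sl => /andP[QS /eqP BQ]; apply: contra => /sub_rVP[a ha].
  have QE : Q = a *: (l^T *m l).
    rewrite (form_hyper (sS _ QS) xl kB BQ) ha dotZl xl prodfZr /prodf mulr1 scalerDr scaleNr.
    by rewrite addrK.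
  have [a0|a0] := eqVneq a 0; first by rewrite QE a0 scale0r.
  by case/negP: lS; rewrite -[_ *m _](scalerK a0) -QE rpredZ.
have n2 : n = n.-2.+2 by lia.
have b2 : 'C(n, 2) = ('C(n.-2, 2) + n.-2 + n.-1)%N.
  by rewrite bn [in 'C(n.-1, 2)](_ : n.-1 = n.-2.+1) ?bin2S //; lia.
have big2 : ('C(n.-2, 2) + n.-2 + n.-1 < \dim S)%N by rewrite -b2.
have cq1 : (c <= n.-1)%N by rewrite -ltnS prednK.
have om0 Q : Q \in Sl S B -> Q != 0 -> l *m Q *m B^T != 0.
  move=> QS Q0; apply: contraNneq (nt Q QS Q0) => h.
  have -> : l *m Q = dot (l *m Q) l *: l.
    apply: dot_inj => w; rewrite dotZr.
    have -> : w = dot w l *: l + (w - dot w l *: l) by rewrite addrC subrK.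
    have : (w - dot w l *: l <= B)%MS by apply: submx_trans kB; rewrite dot_ker !dotE xl mulr1 subrr.
    case/submxP=> E ->; rewrite !dotE !(dot_mulmxl E) h dot0r addr0.
    have -> : l *m B^T = 0 by apply/mulmx_tr0P.
    by rewrite dot0r addr0 xl mulr1 mulrC (dotC l).
  by rewrite scalemx_sub.
(* Put xi = l Q. The trace on ker l of the forms of [S] vanishing on the common kernel of l and xi
   is as large as possible, so it contains every multiple of the restriction of xi to ker l. *)
have key Q : Q \in Sl S B -> Q != 0 -> exists D : 'M_(n.-2, n.-1),
    [/\ row_free D, forall M, M \in S -> (\rank (D *m (B *m (A + M) *m B^T) *m D^T)%R < n.-2)%N,
     c = n.-1 & forall x, dot x (l *m Q *m B^T) = 1 -> forall eta,
       prodf (l *m Q *m B^T) eta + (- dot eta x) *: ((l *m Q *m B^T)^T *m (l *m Q *m B^T))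
         \in (rs B @: S)%VS].
  move=> QS Q0; set xi := l *m Q.
  have nxi := nt Q QS Q0; rewrite -/xi in nxi.
  have [C [fC Cl Cxi sC]] := ex_ker2basis l0 nxi.
  have /submxP[D CD] : (C <= B)%MS by rewrite eB; apply/sub_kermxP.
  have fD : row_free D.
    by apply: (@row_free_mull _ _ _ _ D B); rewrite -CD.
  have BC M : C *m M *m C^T = D *m (B *m M *m B^T) *m D^T by rewrite CD trmx_mul !mulmxA.
  have singD M : M \in S -> (\rank (D *m (B *m (A + M) *m B^T) *m D^T)%R < n.-2)%N.
    move=> MS; rewrite -BC.
    have [t ht] := @rank_prod _ n (A + M) l xi (- dot xi l) _ C hK (rkE M MS) l0 nxi Cl Cxi.
    move: QS; rewrite mem_Sl => /andP[QS /eqP BQ].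
    rewrite -(form_hyper (sS _ QS) xl kB BQ) -addrA in ht.
    have := sing (M + t *: Q) (rpredD MS (rpredZ _ QS)) => /(leq_ltn_trans ht).
    by rewrite addn2 !ltn_predRL.
  have d1 : (\dim (rs C @: S) <= 'C(n.-2, 2))%N.
    apply: (IH _ _ (C *m A *m C^T)); rewrite ?sym_congr //; first by rewrite [ltnRHS]n2 ltnS leqnSn.
      exact: symsp_rs.
    by move=> _ /mem_rs[M MS ->]; rewrite -mulmxDl -mulmxDr BC; exact: singD.
  have d2 := dim_rs S C.
  have d3 := dim_rs (Sl S C) B.
  have d4 : (\dim (Sl (Sl S C) B) <= c)%N.
    rewrite cE dimvS //; apply/subvP=> M; rewrite !mem_Sl => /andP[/andP[-> _] ->] //.
  set T := (rs B @: Sl S C)%VS in d3.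
  have TD : (T <= Sl T D)%VS.
    apply/subvP=> N NT; rewrite mem_Sl NT; case/mem_rs: NT => M + ->.
    by rewrite mem_Sl BC => /andP[].
  have sTC : symsp T by apply: symsp_rs; apply: symsp_sub sS; exact: Sl_subv.
  have kD om : om = xi *m B^T -> (kermx om^T <= D)%MS.
    move=> omE; apply/row_subP=> j; set u := row j _.
    have uo : dot u om = 0.
      by apply/eqP; rewrite -dot_ker row_sub.
    have : (u *m B <= C)%MS.
      apply: sC; first by rewrite (mulmx_tr0 Bl).
      by rewrite dot_mulmxl -omE.
    rewrite CD; case/submxP=> E; rewrite mulmxA => /(row_free_inj fB) ->.
    exact: submxMl.
  have om0' := om0 Q QS Q0.
  have d5 : (\dim T <= n.-1)%N.
    apply: leq_trans (dimvS TD) _.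
    by apply: dim_Sl_le sTC om0' _; apply: kD.
  have [cq Tq] := tight_dims d3 d2 d1 d4 cq1 d5 big2.
  exists D; split => //.
  move=> x xo eta.
  have := @Sl_full K n.-1 T _ D (xi *m B^T) x sTC xo (kD _ erefl) _ eta.
  have h1 : (n.-1 <= \dim (Sl T D))%N by apply: leq_trans (dimvS TD).
  move=> /(_ h1); apply: subvP.
  by apply: limgS; exact: Sl_subv.
have [Q QS Q0] : exists2 Q, Q \in Sl S B & Q != 0.
  by exists (vpick (Sl S B)); rewrite ?memv_pick // vpick0 -dimv_eq0 -cE -lt0n.
have [D [fD sD cn1 _]] := key Q QS Q0.
(* S_l has dimension n - 1, so the restrictions of the xi fill the dual of ker l. *)
have all N : N^T = N -> N \in (rs B @: S)%VS.
  apply: sym_span => j xi.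
  have : (ev K j) \in (linfun (mulmxr B^T \o mulmx l) @: Sl S B)%VS.
    set f := linfun _.
    suff -> : (f @: Sl S B = fullv)%VS by rewrite memvf.
    apply/eqP; rewrite eqEdim subvf dim_rV limg_dim_eq.
      by rewrite /= -cE cn1.
    apply/eqP; rewrite -subv0; apply/subvP=> P; rewrite memv_cap memv_ker lfunE /= memv0.
    case/andP=> PS /eqP e; apply: contraT => P0.
    by have [_ [_ _ _ h]] := key P PS P0; move: (om0 P PS P0); rewrite e eqxx.
  case/memv_imgP=> P PS; rewrite lfunE /= => e.
  have P0 : P != 0.
    by apply: contraTneq (delta_neq0 K j) => P0; rewrite -/(ev K j) e P0 mulmx0 mul0mx eqxx.
  have [_ [_ _ _ h]] := key P PS P0.
  have := h (ev K j); rewrite -e !dot_delta mxE !eqxx => /(_ erefl xi).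
  by rewrite dot_delta.
have /row_freeP[R DR] := fD.
(* After adding [A], the compression by [D] of this matrix is the identity, since D R = 1. *)
have := all (R *m R^T - B *m A *m B^T); case/(_ _)/mem_rs.
  by rewrite linearB /= sBA trmx_mul trmxK.
move=> M MS ME; have := sD M MS.
rewrite mulmxDr mulmxDl -ME addrC subrK !mulmxA DR mul1mx -trmx_mul DR trmx1 mxrank1.
by rewrite ltnn.
Qed.

End Affine.

Section AffineRect.
Variable K : fieldType.

Lemma sub_rank_col k q (a : 'rV[K]_q) (P : 'M_(k, q)) : \rank P = k ->
  (\rank (col_mx a P) < k.+1)%N -> (a <= P)%MS.
Proof.
move=> rP rk.
have sub : (P <= col_mx a P)%MS by rewrite -addsmxE addsmxSr.
have : (col_mx a P <= P)%MS by rewrite -(geq_leqif (mxrank_leqif_sup sub)) rP -ltnS.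
by rewrite col_mx_sub => /andP[].
Qed.

(** Split off the first row; c counts the elements of [S] supported on it. For c = 0 the lower rows
    give the bound. The first row u of such an element lies in the span of the lower rows of [A + M]
    whenever these are independent, so cutting the columns down to ker u makes them dependent, and
    induction forces c = q. But then the lower rows are never independent, since they would span all
    rows of length q, and induction applies to them directly. *)
Lemma dim_sing_rect k q (A : 'M[K]_(k, q)) (S : {vspace 'M[K]_(k, q)}) :
  (k <= q)%N -> (forall M, M \in S -> (\rank (A + M)%R < k)%N) -> (\dim S <= k.-1 * q)%N.
Proof.
elim: k q A S => [|k IH] q A S kq sing; first by have := sing 0 (mem0v _).
case: k => [|k] in IH A S kq sing *.
  rewrite leqn0 dimv_eq0 -subv0; apply/subvP=> M MS; rewrite memv0.
  have z N : N \in S -> A + N = 0 by move=> /sing; rewrite ltnS leqn0 mxrank_eq0 => /eqP.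
  by have := z M MS; have := z 0 (mem0v _); rewrite addr0 => ->; rewrite add0r => ->.
pose f : 'Hom('M[K]_(1 + k.+1, q), 'M[K]_(k.+1, q)) := linfun dsubmx.
pose g : 'Hom('M[K]_(1 + k.+1, q), 'M[K]_(1, q)) := linfun usubmx.
pose T := (f @: S)%VS; pose Sd := (S :&: lker f)%VS; pose c := \dim Sd.
have dT : (c + \dim T = \dim S)%N by exact: limg_ker_dim.
have TE N : N \in T -> exists2 M, M \in S & N = dsubmx (M : 'M_(1 + k.+1, q)).
  by case/memv_imgP=> M MS ->; exists M => //; rewrite lfunE.
have fE M : f M = dsubmx (M : 'M_(1 + k.+1, q)) by rewrite lfunE.
have gE M : g M = usubmx (M : 'M_(1 + k.+1, q)) by rewrite lfunE.
have SdP Q : Q \in Sd -> Q \in S /\ Q = col_mx (g Q) 0.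
  rewrite memv_cap memv_ker gE fE => /andP[QS /eqP e]; split=> //.
  by rewrite -[LHS](vsubmxK (Q : 'M_(1 + k.+1, q))) e.
have g0 Q : Q \in Sd -> g Q = 0 -> Q = 0.
  by case/SdP=> _ {2}-> ->; rewrite col_mx0.
have cq : (c <= q)%N by rewrite -[leqRHS](dim_rV K q); apply: dim_le_inj g0 _ => *; exact: memvf.
have sub M Q : M \in S -> Q \in Sd -> \rank (dsubmx (A + M : 'M_(1 + k.+1, q))) = k.+1 ->
    (g Q <= dsubmx (A + M : 'M_(1 + k.+1, q)))%MS.
  move=> MS /SdP[QS QE] rk; set P := dsubmx _ in rk *.
  have h (a : 'rV_q) : (\rank (col_mx a P) < k.+2)%N -> (a <= P)%MS by exact: sub_rank_col.
  have h1 := h (usubmx (A + M : 'M_(1 + k.+1, q))); rewrite vsubmxK in h1.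
  have h2 := h (usubmx (A + M : 'M_(1 + k.+1, q)) + g Q).
  have e : col_mx (usubmx (A + M : 'M_(1 + k.+1, q)) + g Q) P = A + (M + Q).
    by rewrite {2}QE -[P]addr0 -add_col_mx vsubmxK addrA.
  rewrite e in h2.
  have -> : g Q = (usubmx (A + M : 'M_(1 + k.+1, q)) + g Q) - usubmx (A + M : 'M_(1 + k.+1, q)).
    by rewrite addrC addKr.
  apply: addmx_sub; first by apply: h2; apply: sing; rewrite rpredD.
  by rewrite eqmx_opp; apply: h1; apply: sing.
rewrite leqNgt /=; apply/negP=> big.
case: (posnP c) => [c0|cpos].
  move: big; rewrite -dT c0 add0n ltnNge; apply/negP/negPn.
  by apply: leq_trans (dimvS (subvf _)) _; rewrite dimvf dim_matrix.
have key Q : Q \in Sd -> Q != 0 -> c = q.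
  move=> QS Q0.
  have u0 : g Q != 0 by apply: contra_neq Q0; exact: g0.
  have [B fB eB] := ex_kerbasis u0.
  have Bu : B *m (g Q)^T = 0 by apply/sub_kermxP; rewrite eB.
  have uB : g Q *m B^T = 0 by apply/mulmx_tr0P.
  pose h : 'Hom('M[K]_(k.+1, q), 'M[K]_(k.+1, q.-1)) := linfun (mulmxr B^T).
  have d1 : (\dim (h @: T) <= k * q.-1)%N.
    apply: (IH _ (dsubmx (A : 'M_(1 + k.+1, q)) *m B^T)); first by lia.
    move=> _ /memv_imgP[N /TE[M MS ->] ->]; rewrite lfunE /= -mulmxDl -linearD /=.
    set P := dsubmx _.
    have [rP|rP] := eqVneq (\rank P) k.+1; last first.
      apply: leq_ltn_trans (mxrankM_maxl _ _) _.
      by rewrite ltn_neqAle rP rank_leq_row.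
    have /submxP[v vP] := sub M Q MS QS rP.
    rewrite ltn_neqAle rank_leq_row andbT; apply: contraNneq u0 => rk.
    have fP : row_free (P *m B^T) by rewrite /row_free rk.
    have : v *m (P *m B^T) = 0 *m (P *m B^T) by rewrite mulmxA -vP uB mul0mx.
    by move/(row_free_inj fP) => v0; rewrite vP v0 mul0mx.
  have d2 : (\dim (T :&: lker h) <= k.+1)%N.
    have [x xu] := sep0 u0.
    pose p : 'Hom('M[K]_(k.+1, q), 'M[K]_(k.+1, 1)) := linfun (mulmxr x^T).
    have dM : \dim {: 'M[K]_(k.+1, 1)} = k.+1 by rewrite dimvf dim_matrix; exact: muln1.
    rewrite -[leqRHS]dM; apply: (@dim_le_inj _ _ _ p) => [N|*]; last exact: memvf.
    rewrite memv_cap memv_ker !lfunE /= => /andP[_ /eqP NB] Nx.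
    apply: trmx_inj; rewrite trmx0.
    have: row_full (col_mx x B).
      rewrite -sub1mx; apply/row_subP => i; set e := row i _.
      have -> : e = dot e (g Q) *: x + (e - dot e (g Q) *: x) by rewrite addrC subrK.
      rewrite -addsmxE addmx_sub_adds //; first by rewrite scalemx_sub.
      by rewrite eB dot_ker !dotE xu mulr1 subrr.
    rewrite /row_full => /eqP rk.
    have fr : row_free (col_mx x B)^T by rewrite /row_free mxrank_tr rk.
    apply: trmx_inj; rewrite trmxK trmx0; apply: (row_free_inj fr).
    by rewrite tr_col_mx mul_mx_row Nx NB mul0mx row_mx0.
  have d3 := limg_ker_dim h T.
  nia.
have [Q QS Q0] : exists2 Q, Q \in Sd & Q != 0.
  by exists (vpick Sd); rewrite ?memv_pick // vpick0 -dimv_eq0 -lt0n.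
have cqE := key Q QS Q0.
suff : (\dim T <= k * q)%N by nia.
apply: (IH _ (dsubmx (A : 'M_(1 + k.+1, q)))); first by lia.
move=> _ /TE[M MS ->]; rewrite -linearD /=.
rewrite ltn_neqAle rank_leq_row andbT; apply/eqP=> rk.
have im : (g @: Sd = fullv)%VS.
  apply/eqP; rewrite eqEdim subvf dim_rV limg_dim_eq; first by rewrite -/c cqE leqnn.
  apply/eqP; rewrite -subv0; apply/subvP=> N; rewrite memv_cap memv_ker memv0.
  by case/andP=> NS /eqP gN; apply/eqP; apply: g0.
have full : (1%:M <= dsubmx (A + M : 'M_(1 + k.+1, q)))%MS.
  apply/row_subP=> i; have : row i 1%:M \in (g @: Sd)%VS by rewrite im memvf.
  by case/memv_imgP=> N NS ->; apply: sub.
have := mxrankS full; rewrite mxrank1 rk; lia.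
Qed.

End AffineRect.

(** * Alternating forms; singular affine spaces in characteristic 2 *)

Section Alternating.
Variable K : fieldType.

Definition altf n (M : 'M[K]_n) := forall v : 'rV_n, dot (v *m M) v = 0.

Definition altsp n (S : {vspace 'M[K]_n}) := forall M, M \in S -> altf M.

Lemma altf_congr m n (B : 'M[K]_(m, n)) M : altf M -> altf (B *m M *m B^T).
Proof. by move=> aM v; rewrite !mulmxA dot_mulmxl trmxK aM. Qed.

Lemma altfD n (M N : 'M[K]_n) : altf M -> altf N -> altf (M + N).
Proof. by move=> aM aN v; rewrite mulmxDr dotDl aM aN addr0. Qed.

Lemma altfZ n a (M : 'M[K]_n) : altf M -> altf (a *: M).
Proof. by move=> aM v; rewrite -scalemxAr dotZl aM mulr0. Qed.

Lemma altfB n (M N : 'M[K]_n) : altf M -> altf N -> altf (M - N).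
Proof. by move=> aM aN; rewrite -scaleN1r; apply/altfD/altfZ. Qed.

Lemma altsp_rs n (S : {vspace 'M[K]_n}) m (B : 'M[K]_(m, n)) : altsp S -> altsp (rs B @: S).
Proof. by move=> sS N /mem_rs[M /sS sM ->]; exact: altf_congr. Qed.

Lemma altsp_sub n (S T : {vspace 'M[K]_n}) : (T <= S)%VS -> altsp S -> altsp T.
Proof. by move=> /subvP TS sS M /TS /sS. Qed.

Lemma altf_diag n (M : 'M[K]_n) i : altf M -> M i i = 0.
Proof.
move=> /(_ (ev K i)); rewrite dot_delta => <-.
by rewrite -rowE mxE.
Qed.

Definition perp n (x : 'rV[K]_n) : {vspace 'rV[K]_n} := lker (linfun (mulmxr x^T)).

Lemma mem_perp n (x v : 'rV[K]_n) : (v \in perp x) = (dot v x == 0).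
Proof.
rewrite memv_ker lfunE /= mulmx_dot; apply/eqP/eqP=> [/(congr1 (fun A : 'M_1 => A 0 0))|->].
  by rewrite !mxE eqxx mulr1n.
by rewrite raddf0.
Qed.

Lemma dim_perp n (x : 'rV[K]_n) : x != 0 -> \dim (perp x) = n.-1.
Proof.
move=> x0; set f : 'Hom('rV[K]_n, 'M[K]_1) := linfun (mulmxr x^T).
have := limg_ker_dim f fullv; rewrite capfv dim_rV -/(perp x).
suff -> : \dim (f @: fullv) = 1%N.
  by rewrite addn1; move: (\dim _) => k kE; rewrite -[in RHS]kE.
apply/eqP; rewrite eqn_leq; apply/andP; split.
  by apply: leq_trans (dimvS (subvf _)) _; rewrite dimvf dim_matrix; exact: leqnn.
have [y yx] := sep0 x0.
rewrite lt0n dimv_eq0; apply: contraTneq (memv_img f (memvf y)) => ->.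
rewrite memv0 lfunE /= mulmx_dot yx; apply/eqP=> /(congr1 (fun A : 'M_1 => A 0 0)).
by rewrite !mxE eqxx => /eqP; rewrite oner_eq0.
Qed.

Lemma dim_Sl_alt_le n (S : {vspace 'M[K]_n}) m (B : 'M[K]_(m, n)) (l : 'rV_n) :
  symsp S -> altsp S -> l != 0 -> (kermx l^T <= B)%MS -> (\dim (Sl S B) <= n.-1)%N.
Proof.
move=> sS aS l0 kB.
have [x xl] := sep0 l0.
have x0 : x != 0 by apply: contra_eq_neq xl => ->; rewrite dot0l eq_sym oner_eq0.
rewrite -(dim_perp x0); apply: (@dim_le_inj _ _ _ (vec x)) => [M|M]; rewrite mem_Sl vecE.
  case/andP=> MS /eqP BM xM.
  by rewrite (form_hyper (sS _ MS) xl kB BM) xM /prodf dot0l oppr0 scale0r trmx0 mulmx0 mul0mx !addr0.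
by case/andP=> MS _; rewrite mem_perp; apply/eqP/aS.
Qed.

Lemma Sl_alt_full n (S : {vspace 'M[K]_n}) m (B : 'M[K]_(m, n)) l x :
  symsp S -> altsp S -> dot x l = 1 -> (kermx l^T <= B)%MS -> (n.-1 <= \dim (Sl S B))%N ->
  forall xi, dot xi x = 0 -> prodf l xi \in S.
Proof.
move=> sS aS xl kB nd xi xix.
have x0 : x != 0 by apply: contra_eq_neq xl => ->; rewrite dot0l eq_sym oner_eq0.
have im : (perp x <= vec x @: Sl S B)%VS.
  have sub : (vec x @: Sl S B <= perp x)%VS.
    apply/subvP=> _ /memv_imgP[M + ->]; rewrite mem_Sl vecE mem_perp => /andP[MS _].
    exact/eqP/aS.
  have /eqP -> // : (vec x @: Sl S B == perp x)%VS.
  rewrite eqEdim sub dim_perp // limg_dim_eq //; apply/eqP; rewrite -subv0; apply/subvP=> M.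
  rewrite memv_cap memv_ker vecE mem_Sl => /andP[/andP[MS /eqP BM] /eqP xM].
  rewrite (form_hyper (sS _ MS) xl kB BM) xM /prodf dot0l oppr0 scale0r.
  by rewrite trmx0 mulmx0 mul0mx !addr0 memv0.
have : xi \in (vec x @: Sl S B)%VS by apply: (subvP im); rewrite mem_perp xix.
case/memv_imgP=> M; rewrite mem_Sl vecE => /andP[MS /eqP BM] e.
have := form_hyper (sS _ MS) xl kB BM; rewrite -e xix oppr0 scale0r addr0 => <-.
exact: MS.
Qed.

Lemma dim_alt n (S : {vspace 'M[K]_n}) : symsp S -> altsp S -> (\dim S <= 'C(n, 2))%N.
Proof.
elim: n S => [|n IH] S sS aS.
  by apply: leq_trans (dimvS (subvf S)) _; rewrite dimvf.
pose l := ev K (0 : 'I_n.+1).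
have l0 : l != 0 by exact: delta_neq0.
have [B fB eB] := ex_kerbasis l0.
rewrite -(dim_rs S B) bin2S addnC leq_add //.
  by apply: IH; [exact: symsp_rs | exact: altsp_rs].
by apply: dim_Sl_alt_le sS aS l0 _; rewrite eB.
Qed.

Lemma alt_span n (S : {vspace 'M[K]_n}) :
  (forall i (xi : 'rV_n), xi 0 i = 0 -> prodf (ev K i) xi \in S) ->
  forall N, N^T = N -> altf N -> N \in S.
Proof.
move=> h N sN aN; rewrite (sym_decomp sN); apply: rpredD; apply: rpred_sum => i _.
  by apply: h; rewrite mxE ltnn.
by rewrite altf_diag // scale0r rpred0.
Qed.

Hypothesis char2 : (2%:R : K) = 0.

Lemma addrr2 (x : K) : x + x = 0.
Proof. by rewrite -mulr2n -mulr_natr char2 mulr0. Qed.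

Lemma altf_prodf n (l m : 'rV[K]_n) : altf (prodf l m).
Proof. by move=> v; rewrite mul_prodf !dotE (dotC m) (dotC l) mulrC addrr2. Qed.

Lemma prodf_self n (l : 'rV[K]_n) : prodf l l = 0.
Proof. by rewrite /prodf -mulr2n -scaler_nat char2 scale0r. Qed.

Lemma sym_diag_alt n (M : 'M[K]_n) : M^T = M -> (forall i, M i i = 0) -> altf M.
Proof.
move=> sM dM v; rewrite (sym_decomp sM) [X in _ + X]big1 ?addr0; last first.
  by move=> i _; rewrite dM scale0r.
rewrite mulmx_sumr; elim/big_rec: _ => [|i w _ h]; first by rewrite dot0l.
by rewrite dotDl h altf_prodf addr0.
Qed.

(** The antidiagonal permutation matrix: in even size the antidiagonal misses the diagonal. *)
Lemma ex_alt_unit n : ~~ odd n ->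
  exists J : 'M[K]_n, [/\ J^T = J, altf J & \rank J = n].
Proof.
move=> on; pose J : 'M[K]_n := \matrix_(i, j) (j == rev_ord i)%:R.
have sJ : J^T = J.
  by apply/matrixP=> i j; rewrite !mxE -(inj_eq rev_ord_inj) rev_ordK eq_sym.
exists J; split=> //.
  apply: sym_diag_alt => // i; rewrite mxE.
  case: eqP => // /(congr1 val) /= e; exfalso; move/negP: on; apply.
  have := ltn_ord i; move: e => /=; lia.
apply: mxrank_unit; suff: J *m J = 1%:M by case/mulmx1_unit.
apply/matrixP=> i j; rewrite !mxE (bigD1 (rev_ord i)) //= big1 => [|k ki].
  by rewrite !mxE eqxx rev_ordK mul1r addr0 eq_sym.
by rewrite !mxE (negPf ki) mul0r.
Qed.

(** The scheme of [dim_sing_sym]. Alternating matrices of odd size are always singular, so the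
    recursion goes directly from n to n - 2. The maximal dimensions are one less than in the
    symmetric case, because x M vanishes at [x]. *)
Lemma dim_sing_alt (hK : exists x : K, x != 0 /\ x != 1) n (A : 'M[K]_n) (S : {vspace 'M[K]_n}) :
  ~~ odd n -> A^T = A -> altf A -> symsp S -> altsp S ->
  (forall M, M \in S -> (\rank (A + M)%R < n)%N) ->
  (\dim S <= 'C(n.-1, 2))%N.
Proof.
elim/ltn_ind: n A S => n IH A S on sA aA sS aS sing.
have rkE M : M \in S -> (A + M)^T = A + M by move=> MS; rewrite linearD /= sA sS.
case: (boolP [exists i : 'I_n, (\dim (Sl S (kermx (ev K i)^T)) < n.-1)%N]); last first.
  rewrite negb_exists => /forallP full.
  have all N : N^T = N -> altf N -> N \in S.
    apply: alt_span => i xi xi0.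
    have := @Sl_alt_full n S n (kermx (ev K i)^T) (ev K i) (ev K i) sS aS _ _ _ xi.
    rewrite !dot_delta; apply => //; first by rewrite mxE !eqxx.
    by rewrite leqNgt.
  have [J [sJ aJ rJ]] := ex_alt_unit on.
  have h : J - A \in S by apply: all; [rewrite linearB /= sJ sA | exact: altfB].
  by have := sing _ h; rewrite addrCA subrr addr0 rJ ltnn.
case/existsP=> i; set l := ev K i; set c := \dim _ => cn.
have l0 : l != 0 by exact: delta_neq0.
have xl : dot l l = 1 by rewrite dot_delta mxE !eqxx.
have [B fB eB] := ex_kerbasis l0.
have Bl : B *m l^T = 0 by apply/sub_kermxP; rewrite eB.
have kB : (kermx l^T <= B)%MS by rewrite eB.
have n0 : (0 < n)%N by apply: leq_ltn_trans (ltn_ord i).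
have cE : c = \dim (Sl S B).
  congr (\dim _); apply/vspaceP=> M; rewrite !mem_Sl.
  by apply/andP/andP=> -[-> /eqP h]; split=> //; apply/eqP; apply: zero_sub h; rewrite eB.
have dT := dim_rs S B; rewrite -cE in dT.
have sT : symsp (rs B @: S) by exact: symsp_rs.
have aT : altsp (rs B @: S) by exact: altsp_rs.
have dT1 := dim_alt sT aT.
case: (posnP c) => [c0|cpos]; first by rewrite -dT c0 add0n.
rewrite leqNgt; apply/negP => big.
have Qf Q : Q \in Sl S B -> Q = prodf l (l *m Q).
  rewrite mem_Sl => /andP[QS /eqP BQ].
  by rewrite {1}(form_hyper (sS _ QS) xl kB BQ) (aS _ QS) oppr0 scale0r addr0.
have nt Q : Q \in Sl S B -> Q != 0 -> ~~ (l *m Q <= l)%MS.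
  move=> /Qf QE; apply: contra => /sub_rVP[a ha].
  by rewrite QE ha prodfZr prodf_self scaler0.
have n2 : n = n.-2.+2 by lia.
have n3 : (2 < n)%N by lia.
have b2 : 'C(n.-1, 2) = ('C(n.-2.-1, 2) + n.-2.-1 + n.-2)%N.
  have [k ->] : exists k, n = k.+3 by exists (n - 3)%N; lia.
  by rewrite /= bin2S bin2S.
have big2 : ('C(n.-2.-1, 2) + n.-2.-1 + n.-2 < \dim S)%N by rewrite -b2.
have cn2 : (c <= n.-2)%N by rewrite -ltnS; exact: leq_trans cn (leqSpred _).
have om0 Q : Q \in Sl S B -> Q != 0 -> l *m Q *m B^T != 0.
  move=> QS Q0; apply: contraNneq (nt Q QS Q0) => h.
  have -> : l *m Q = dot (l *m Q) l *: l.
    apply: dot_inj => w; rewrite dotZr.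
    have -> : w = dot w l *: l + (w - dot w l *: l) by rewrite addrC subrK.
    have : (w - dot w l *: l <= B)%MS by apply: submx_trans kB; rewrite dot_ker !dotE xl mulr1 subrr.
    case/submxP=> E ->; rewrite !dotE !(dot_mulmxl E) h dot0r addr0.
    have -> : l *m B^T = 0 by apply/mulmx_tr0P.
    by rewrite dot0r addr0 xl mulr1 mulrC (dotC l).
  by rewrite scalemx_sub.
have key Q : Q \in Sl S B -> Q != 0 -> exists D : 'M_(n.-2, n.-1),
    [/\ row_free D, forall M, M \in S -> (\rank (D *m (B *m (A + M) *m B^T) *m D^T)%R < n.-2)%N,
     c = n.-2 & forall eta, prodf (l *m Q *m B^T) eta \in (rs B @: S)%VS].
  move=> QS Q0; set xi := l *m Q.
  have nxi := nt Q QS Q0; rewrite -/xi in nxi.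
  have [C [fC Cl Cxi sC]] := ex_ker2basis l0 nxi.
  have /submxP[D CD] : (C <= B)%MS by rewrite eB; apply/sub_kermxP.
  have fD : row_free D.
    by apply: (@row_free_mull _ _ _ _ D B); rewrite -CD.
  have BC M : C *m M *m C^T = D *m (B *m M *m B^T) *m D^T by rewrite CD trmx_mul !mulmxA.
  have singD M : M \in S -> (\rank (D *m (B *m (A + M) *m B^T) *m D^T)%R < n.-2)%N.
    move=> MS; rewrite -BC.
    have [t ht] := @rank_prod _ n (A + M) l xi 0 _ C hK (rkE M MS) l0 nxi Cl Cxi.
    have QE := Qf Q QS; move: QS; rewrite mem_Sl => /andP[QS /eqP BQ].
    rewrite scale0r addr0 -QE -addrA in ht.
    have := sing (M + t *: Q) (rpredD MS (rpredZ _ QS)) => /(leq_ltn_trans ht).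
    by rewrite addn2 !ltn_predRL.
  have d1 : (\dim (rs C @: S) <= 'C(n.-2.-1, 2))%N.
    apply: (IH _ _ (C *m A *m C^T)); rewrite ?sym_congr //; first by rewrite [ltnRHS]n2 ltnS leqnSn.
    - by move: on; rewrite [in odd n]n2 /= negbK.
    - exact: altf_congr.
    - exact: symsp_rs.
    - exact: altsp_rs.
    by move=> _ /mem_rs[M MS ->]; rewrite -mulmxDl -mulmxDr BC; exact: singD.
  have d2 := dim_rs S C.
  have d3 := dim_rs (Sl S C) B.
  have d4 : (\dim (Sl (Sl S C) B) <= c)%N.
    rewrite cE dimvS //; apply/subvP=> M; rewrite !mem_Sl => /andP[/andP[-> _] ->] //.
  set T := (rs B @: Sl S C)%VS in d3.
  have TD : (T <= Sl T D)%VS.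
    apply/subvP=> N NT; rewrite mem_Sl NT; case/mem_rs: NT => M + ->.
    by rewrite mem_Sl BC => /andP[].
  have sTC : symsp T by apply: symsp_rs; apply: symsp_sub sS; exact: Sl_subv.
  have aTC : altsp T by apply: altsp_rs; apply: altsp_sub aS; exact: Sl_subv.
  have kD om : om = xi *m B^T -> (kermx om^T <= D)%MS.
    move=> omE; apply/row_subP=> j; set u := row j _.
    have uo : dot u om = 0.
      by apply/eqP; rewrite -dot_ker row_sub.
    have : (u *m B <= C)%MS.
      apply: sC; first by rewrite (mulmx_tr0 Bl).
      by rewrite dot_mulmxl -omE.
    rewrite CD; case/submxP=> E; rewrite mulmxA => /(row_free_inj fB) ->.
    exact: submxMl.
  have om0' := om0 Q QS Q0.
  have d5 : (\dim T <= n.-2)%N.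
    apply: leq_trans (dimvS TD) _.
    by apply: dim_Sl_alt_le sTC aTC om0' _; apply: kD.
  have [cq Tq] := tight_dims d3 d2 d1 d4 cn2 d5 big2.
  exists D; split => //.
  move=> eta.
  have [x xo] := sep0 om0'.
  have h1 : (n.-2 <= \dim (Sl T D))%N by apply: leq_trans (dimvS TD).
  have hf := @Sl_alt_full n.-1 T _ D (xi *m B^T) x sTC aTC xo (kD _ erefl) h1.
  have -> : eta = (eta - dot eta x *: (xi *m B^T)) + dot eta x *: (xi *m B^T) by rewrite subrK.
  rewrite prodfDr prodfZr prodf_self scaler0 addr0.
  have := hf (eta - dot eta x *: (xi *m B^T)); rewrite !dotE (dotC (xi *m B^T)) xo mulr1 subrr.
  move=> /(_ erefl); apply: subvP; apply: limgS; exact: Sl_subv.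
have [Q QS Q0] : exists2 Q, Q \in Sl S B & Q != 0.
  by exists (vpick (Sl S B)); rewrite ?memv_pick // vpick0 -dimv_eq0 -cE -lt0n.
have [D [fD sD cn1 _]] := key Q QS Q0.
set f : 'Hom('M[K]_n, 'rV[K]_n.-1) := linfun (mulmxr B^T \o mulmx l).
have fE P : f P = l *m P *m B^T by rewrite lfunE.
set W := (f @: Sl S B)%VS.
have Wmem w eta : w \in W -> prodf w eta \in (rs B @: S)%VS.
  case/memv_imgP=> P PS ->; rewrite fE.
  have [->|P0] := eqVneq P 0; last by have [_ [_ _ _ h]] := key P PS P0; exact: h.
  by rewrite mulmx0 mul0mx /prodf trmx0 mul0mx mulmx0 addr0 rpred0.
have dW : \dim W = n.-2.
  rewrite limg_dim_eq -?cE //; apply/eqP; rewrite -subv0; apply/subvP=> P.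
  rewrite memv_cap memv_ker fE memv0 => /andP[PS /eqP e]; apply: contraT => P0.
  by move: (om0 P PS P0); rewrite e eqxx.
(* The second factors fill only a hyperplane [W] of the dual of ker l. A complement is at most a
   line <u> with [prodf u u] = 0, so products with a factor in [W] still span all alternating
   forms. *)
have dC : (\dim (W^C) <= 1)%N.
  by rewrite dimv_compl dW dimvf dim_matrix; rewrite -[(1 * _)%R]/(1 * n.-1)%N mul1n; lia.
have split_W v : exists2 w, w \in W & exists2 u, u \in (W^C)%VS & v = w + u.
  have : v \in (W + W^C)%VS by rewrite addv_complf memvf.
  by case/memv_addP=> w wW [u uW ->]; exists w => //; exists u.
have all N : N^T = N -> altf N -> N \in (rs B @: S)%VS.
  apply: alt_span => j xi _.
  have [w wW [u uW ->]] := split_W (ev K j).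
  have [w' wW' [u' uW' ->]] := split_W xi.
  rewrite prodfDl; apply: rpredD; first exact: Wmem.
  rewrite prodfDr; apply: rpredD; first by rewrite prodfC Wmem.
  have [u0|u0] := eqVneq u 0; first by rewrite u0 /prodf trmx0 mul0mx mulmx0 addr0 rpred0.
  have /eqP e : (<[u]> == W^C)%VS by rewrite eqEdim -memvE uW dim_vline u0.
  move: uW'; rewrite -e => /vlineP[a ->]; by rewrite prodfZr prodf_self scaler0 rpred0.
have /row_freeP[R DR] := fD.
have [J [sJ aJ rJ]] : exists J : 'M[K]_n.-2, [/\ J^T = J, altf J & \rank J = n.-2].
  by apply: ex_alt_unit; move: on; rewrite [in odd n]n2 /= negbK.
have := all (R *m J *m R^T - B *m A *m B^T); case/(_ _ _)/mem_rs.
- by rewrite linearB /= !sym_congr.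
- by apply: altfB; exact: altf_congr.
move=> M MS ME; have := sD M MS.
rewrite mulmxDr mulmxDl -ME addrC subrK !mulmxA DR mul1mx -mulmxA -trmx_mul DR trmx1 mulmx1 rJ.
by rewrite ltnn.
Qed.

End Alternating.

(** * Gluing pointwise linear relations *)

Section Gluing.
Variable K : fieldType.

Lemma ann_adds k m1 m2 (A : 'M[K]_(m1, k)) (B : 'M_(m2, k)) (y : 'rV_k) :
  y *m (A + B)%MS^T = 0 <-> y *m A^T = 0 /\ y *m B^T = 0.
Proof.
have h m (C : 'M_(m, k)) : y *m C^T = 0 <-> (C <= kermx y^T)%MS.
  split=> [e|/sub_kermxP e]; first by apply/sub_kermxP/mulmx_tr0P.
  by apply/mulmx_tr0P.
rewrite !h; split=> [|[h1 h2]]; last by rewrite addsmx_sub h1 h2.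
by rewrite addsmx_sub => /andP.
Qed.

Lemma ann_row k (phi y : 'rV[K]_k) : y *m phi^T = 0 <-> dot y phi = 0.
Proof.
by split=> [h|h]; rewrite ?mulmx_dot ?h ?raddf0 // /dot h mxE.
Qed.

Lemma ex_nsub k m (P : 'M[K]_(m, k)) : (\rank P < k)%N -> exists phi : 'rV_k, ~~ (phi <= P)%MS.
Proof.
move=> rP; apply: NNPP => h; move: rP; rewrite ltnNge => /negP; apply.
rewrite -[leqLHS](@mxrank1 K k); apply: mxrankS; apply/row_subP=> i.
by apply: contraT => hi; case: h; exists (row i 1%:M).
Qed.

Lemma rank_adds_row k m (P : 'M[K]_(m, k)) (phi : 'rV_k) : (\rank (P + phi)%MS <= \rank P + 1)%N.
Proof.
by apply: leq_trans (mxrank_adds_leqif _ _) _; rewrite leq_add2l rank_rV leq_b1.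
Qed.

(* [st d Psi] reads: up to forms vanishing against the annihilator of [Psi], the
   available space has codimension at most [d]. *)
Lemma glue k e kap (R : 'rV[K]_k -> 'rV[K]_e -> Prop) (st : nat -> 'M[K]_k -> Prop) :
  (0 < kap)%N ->
  (forall a y z h, R y h -> R z h -> R (a *: y + z) h) ->
  (forall Psi, st 0%N Psi -> exists h, forall y, y *m Psi^T = 0 -> R y h) ->
  (forall Psi (U : 'M_k) h h', st 0%N Psi -> U *m Psi^T = 0 -> (kap <= \rank U)%N ->
     (forall y, (y <= U)%MS -> R y h /\ R y h') -> h = h') ->
  (forall d Psi (P : 'M_k), st d.+1 Psi -> (\rank P < k)%N ->
     exists2 phi : 'rV_k, ~~ (phi <= P)%MS & st d (Psi + phi)%MS) ->
  forall d Psi, st d Psi -> (\rank Psi + d + kap < k)%N ->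
  exists h, forall y, y *m Psi^T = 0 -> R y h.
Proof.
move=> kap0 lin base uniq step.
have good d Psi : st d Psi -> (\rank Psi + d <= k)%N -> exists Psi' : 'M_k,
    [/\ (Psi <= Psi')%MS, st 0%N Psi' & (\rank Psi' <= \rank Psi + d)%N].
  elim: d Psi => [|d IH] Psi sP rk; first by exists Psi; rewrite addn0.
  have [phi nphi sP'] := step _ _ Psi sP ltac:(lia).
  have rk' := rank_adds_row Psi phi.
  have [|Psi' [le st' rk'']] := IH _ sP'; first by lia.
  exists Psi'; split=> //; last by lia.
  by apply: submx_trans le; exact: addsmxSl.
elim=> [|d IH] Psi sP rk; first exact: base.
(* Two independent forms modulo [Psi] give relations on two subspaces that together span the
   annihilator of [Psi]; it remains to see that the relations agree. *)
have [phi1 n1 s1] := step _ _ Psi sP ltac:(lia).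
have r1 := rank_adds_row Psi phi1.
have [h1 L1] := IH _ s1 ltac:(lia).
have [phi2 n2 s2] := step _ _ (Psi + phi1)%MS sP ltac:(lia).
have r2 := rank_adds_row Psi phi2.
have [h2 L2] := IH _ s2 ltac:(lia).
(* They are compared on the annihilator [U] of Psi' + phi2, where uniqueness applies: its dimension
   is at least k - (rank Psi + d + 2), hence at least [kap]. *)
have [Psi' [le1 st' rk']] := good _ _ s1 ltac:(lia).
have r' := rank_adds_row Psi' phi2.
set U : 'M_k := kermx (Psi' + phi2)%MS^T.
have rU : \rank U = (k - \rank (Psi' + phi2)%MS)%N by rewrite mxrank_ker mxrank_tr.
have UP (y : 'rV_k) : (y <= U)%MS -> y *m Psi'^T = 0 /\ y *m phi2^T = 0.
  by move/sub_kermxP/ann_adds.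
have eh : h1 = h2.
  apply: (uniq Psi' U) => //; first by apply/row_matrixP=> i; rewrite row_mul row0; case: (UP _ (row_sub i U)).
    by lia.
  move=> y /UP[y1 y2].
  have yP : y *m (Psi + phi1)%MS^T = 0.
    by apply/mulmx_tr0P; move/mulmx_tr0P: y1; exact: sub_mulmx0.
  split; first exact: L1.
  by apply: L2; apply/ann_adds; split=> //; case/ann_adds: yP.
rewrite -{}eh in L2.
have [a aP a2] := sep n2.
exists h1 => y yP.
have -> : y = dot y phi2 *: a + (y - dot y phi2 *: a) by rewrite addrC subrK.
apply: lin; first exact: L1.
apply: L2; apply/ann_adds; split.
  case/ann_adds: aP => aP _.
  by rewrite mulmxBl -scalemxAl aP scaler0 subr0.
by apply/ann_row; rewrite !dotE a2 mulr1 subrr.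
Qed.

Section Instances.
Variables (aT : Type) (S : aT -> Prop) (k e : nat) (tau : aT -> 'M[K]_(k, e)) (del : aT -> 'M[K]_(k, 1)).
Variable (Full : {vspace 'M[K]_(k, e)}).

Definition Rel (y : 'rV[K]_k) (h : 'rV[K]_e) := forall M, S M -> y *m del M = y *m tau M *m h^T.

(** Every matrix in [X] is realised by some [tau M], as far as the rows annihilating [Psi] can
    see. *)
Definition Inv (X : {vspace 'M[K]_(k, e)}) (Psi : 'M[K]_k) :=
  forall g, g \in X -> exists2 M, S M & forall y : 'rV_k, y *m Psi^T = 0 -> y *m g = y *m tau M.

Definition State d Psi := exists X : {vspace 'M[K]_(k, e)},
  [/\ (X <= Full)%VS, Inv X Psi & (\dim Full <= \dim X + d)%N].

Lemma Rel_lin a (y z : 'rV_k) h : Rel y h -> Rel z h -> Rel (a *: y + z) h.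
Proof. by move=> Ry Rz M SM; rewrite !mulmxDl -!scalemxAl Ry ?Rz. Qed.

(** A matrix g killed by all rows annihilating the enlarged [Psi] is free of charge: whatever
    realises x also realises x + a g. Each new form can thus raise the dimension of [X] by one. *)
Lemma Inv_add X Psi (phi : 'rV_k) g : Inv X Psi -> (forall y : 'rV_k, y *m (Psi + phi)%MS^T = 0 -> y *m g = 0) ->
  Inv (X + <[g]>)%VS (Psi + phi)%MS.
Proof.
move=> IX kg _ /memv_addP[x xX [_ /vlineP[a ->] ->]].
have [M SM eM] := IX x xX; exists M => // y yP.
by rewrite mulmxDr -scalemxAr kg // scaler0 addr0; apply: eM; case/ann_adds: yP.
Qed.

Lemma dim_add_line (V : vectType K) (X : {vspace V}) g : g \notin X -> (\dim X < \dim (X + <[g]>))%N.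
Proof.
rewrite memvE; apply: contraNT; rewrite -leqNgt => h.
have /eqP -> : (X == X + <[g]>)%VS by rewrite eqEdim addvSl.
exact: addvSr.
Qed.

Lemma State0 Psi : State 0 Psi -> Inv Full Psi.
Proof.
case=> X [XF IX]; rewrite addn0 => h.
by have /eqP <- : (X == Full)%VS by rewrite eqEdim XF.
Qed.

Lemma State_step d X Psi (phi : 'rV_k) g : (X <= Full)%VS -> Inv X Psi -> (\dim Full <= \dim X + d.+1)%N ->
  g \in Full -> (g \notin X) || (Full <= X)%VS ->
  (forall y : 'rV_k, y *m (Psi + phi)%MS^T = 0 -> y *m g = 0) -> State d (Psi + phi)%MS.
Proof.
move=> XF IX dX gF gX kg; exists (X + <[g]>)%VS; split; last 1 first.
- case/orP: gX => [/dim_add_line|/dimvS]; first by lia.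
  by move=> h; apply: leq_trans h _; apply: leq_trans (leq_addr _ _); rewrite dimvS // addvSl.
- by rewrite subv_add XF -memvE.
- exact: Inv_add.
Qed.

End Instances.

Lemma tensor_zero k e (y z : 'rV[K]_k) (u v : 'rV[K]_e) : ~~ (z <= y)%MS -> y != 0 ->
  (forall P : 'M_(k, e), y *m P *m u^T + z *m P *m v^T = 0) -> u = 0 /\ v = 0.
Proof.
move=> nzy y0 h.
have [a ay az] := sep2 nzy; have [b bz yb] := sep2 (nsubC y0 nzy).
have hh (c : 'rV_k) w : dot y c * dot w u + dot z c * dot w v = 0.
  have := h (c^T *m w); rewrite !mul_outer -!scalemxAl !mulmx_dot => /(congr1 (fun A : 'M_1 => A 0 0)).
  by rewrite !mxE !mulr1n.
split; apply: row_vec0 => w; rewrite dotC.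
  by have := hh b w; rewrite (dotC y) yb (dotC z) bz mul1r mul0r addr0.
by have := hh a w; rewrite (dotC y) ay (dotC z) az mul1r mul0r add0r.
Qed.

(** The defect d of [T] is repaired by rank one matrices phi^T w, invisible on the annihilator of
    phi. Once all matrices are realised, the relations of y, z and y + z are forced to coincide by
    [tensor_zero]. *)
Lemma glue_tensor (aT : Type) (S : aT -> Prop) k e (tau : aT -> 'M[K]_(k, e)) (del : aT -> 'M[K]_(k, 1))
    (T : {vspace 'M[K]_(k, e)}) d :
  (forall g, g \in T -> exists2 M, S M & tau M = g) ->
  (forall y, exists h, Rel S tau del y h) ->
  (k * e <= \dim T + d)%N -> (d + 1 < k)%N ->
  exists h, forall y, Rel S tau del y h.
Proof.
move=> TS RC dT dk.
suff [h H] : exists h, forall y, y *m (0 : 'M_k)^T = 0 -> Rel S tau del y h.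
  by exists h => y; apply: H; rewrite trmx0 mulmx0.
have uniq Psi y h h' : Inv S tau fullv Psi -> y *m Psi^T = 0 -> y != 0 ->
    Rel S tau del y h -> Rel S tau del y h' -> h = h'.
  move=> IX yP y0 Rh Rh'; apply/eqP; rewrite -subr_eq0; apply/eqP/row_vec0 => w.
  have [b yb] := sep0 y0.
  have [M SM eM] := IX (b^T *m w) (memvf _).
  have : y *m (b^T *m w) *m (h - h')^T = 0.
    by rewrite eM // linearB /= mulmxBr -(Rh M SM) -(Rh' M SM) subrr.
  rewrite mul_outer dotC yb scale1r mulmx_dot => /(congr1 (fun A : 'M_1 => A 0 0)).
  by rewrite dotC !mxE mulr1n.
apply: (@glue k e 1 (Rel S tau del) (State S tau fullv) _ _ _ _ _ d) => //.
- by move=> a y z h; exact: Rel_lin.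
- move=> Psi /State0 IX.
  have pair y z hy hz : y *m Psi^T = 0 -> z *m Psi^T = 0 -> y != 0 -> ~~ (z <= y)%MS ->
      Rel S tau del y hy -> Rel S tau del z hz -> hy = hz.
    move=> yP zP y0 nzy Ry Rz; have [h Ryz] := RC (y + z).
    have [] := @tensor_zero _ _ y z (h - hy) (h - hz) nzy y0.
      move=> P; have [M SM eM] := IX P (memvf _).
      rewrite !eM // !linearB /= -(Ry M SM) -(Rz M SM).
      by rewrite addrACA -!mulmxDl -(Ryz M SM) -opprD mulmxDl subrr.
    by move=> /subr0_eq <- /subr0_eq <-.
  have [[y0 [y0P y0n]]|no] := classic (exists y : 'rV_k, y *m Psi^T = 0 /\ y != 0); last first.
    exists 0 => y yP; have [->|y0] := eqVneq y 0; first by move=> M SM; rewrite !mul0mx.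
    by case: no; exists y.
  have [h Rh] := RC y0; exists h => y yP.
  have [/sub_rVP[a ->]|ny] := boolP (y <= y0)%MS.
    by rewrite -[_ *: _]addr0; apply: Rel_lin => // M SM; rewrite !mul0mx.
  have [hy Ry] := RC y.
  by rewrite (pair y0 y h hy).
- move=> Psi U h h' /State0 IX UP rU HU.
  have [y yU y0] : exists2 y : 'rV_k, (y <= U)%MS & y != 0.
    apply: NNPP => no; move: rU; rewrite lt0n mxrank_eq0 => /eqP; apply.
    apply/row_matrixP=> i; rewrite row0; apply/eqP; apply: contraT => hi.
    by case: no; exists (row i U); rewrite ?row_sub.
  have [Rh Rh'] := HU y yU.
  by apply: (uniq Psi y) => //; apply: sub_mulmx0 yU UP.
- move=> c Psi P [X [XF IX dX]] rP.
  have [[phi [w [nphi hw]]]|no] :=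
    classic (exists (phi : 'rV_k) (w : 'rV_e), ~~ (phi <= P)%MS /\ phi^T *m w \notin X).
    exists phi => //; apply: (State_step XF IX dX (memvf (phi^T *m w))); first by rewrite hw.
    by move=> y /ann_adds[_ /ann_row yphi]; rewrite mul_outer yphi scale0r.
  have [phi nphi] := ex_nsub rP; exists phi => //.
  have inX (psi : 'rV_k) (w : 'rV_e) : ~~ (psi <= P)%MS -> psi^T *m w \in X.
    by move=> npsi; apply: contraT => hw; case: no; exists psi, w.
  have all (psi : 'rV_k) (w : 'rV_e) : psi^T *m w \in X.
    have [psiP|] := boolP (psi <= P)%MS; last exact: inX.
    have -> : psi = (psi + phi) - phi by rewrite addrK.
    rewrite linearB /= mulmxBl rpredB ?inX //.
    by apply: contra nphi => h; rewrite -(addKr psi phi) addmx_sub // eqmx_opp.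
  apply: (State_step XF IX dX (mem0v _)); last by move=> y _; rewrite mulmx0.
  apply/orP; right; apply/subvP=> M _.
  have -> : M = \sum_i (ev K i)^T *m row i M.
    rewrite -[LHS]mul1mx [X in X *m M](_ : _ = \sum_i (ev K i)^T *m ev K i).
      by rewrite mulmx_suml; apply: eq_bigr => i _; rewrite -mulmxA -rowE.
    apply/matrixP=> i j; rewrite summxE (bigD1 i) //= big1 => [|l li].
      by rewrite !mxE big_ord1 !mxE !eqxx addr0 mul1r eq_sym.
    by rewrite !mxE big_ord1 !mxE [i == l]eq_sym (negPf li) andbF mul0r.
  by apply: rpred_sum => i _; apply: all.
- exists T; split; first exact: subvf.
    by move=> g /TS[M SM <-]; exists M.
  by rewrite dimvf dim_matrix.
- by rewrite mxrank0; lia.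
Qed.

Definition symV k : {vspace 'M[K]_k} := lker (linfun (@trmx K k k) - \1)%VF.

Lemma mem_symV k (M : 'M[K]_k) : (M \in symV k) = (M^T == M).
Proof. by rewrite memv_ker add_lfunE opp_lfunE id_lfunE lfunE subr_eq0. Qed.

(** Symmetric test matrices cannot see the identity y P z^T = z P y^T; this is the only ambiguity
    left in comparison with [tensor_zero]. *)
Lemma sym_zero k (y z u v : 'rV[K]_k) : ~~ (z <= y)%MS -> y != 0 ->
  (forall P : 'M_k, P^T = P -> y *m P *m u^T + z *m P *m v^T = 0) ->
  exists2 al, u = al *: z & v = - al *: y.
Proof.
move=> nzy y0 h.
have [b by0 bz] := sep2 nzy; have [a az ay] := sep2 (nsubC y0 nzy).
have hp (c w : 'rV_k) : dot y c * dot w u + dot y w * dot c u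
    + (dot z c * dot w v + dot z w * dot c v) = 0.
  have := h _ (prodf_sym c w); rewrite !mul_prodf !mulmxDl -!scalemxAl !mulmx_dot.
  move=> /(congr1 (fun A : 'M_1 => A 0 0)); rewrite !mxE !mulr1n; exact.
have hq (c : 'rV_k) : dot y c * dot c u + dot z c * dot c v = 0.
  have := h _ (sqf_sym c); rewrite !mul_outer -!scalemxAl !mulmx_dot.
  move=> /(congr1 (fun A : 'M_1 => A 0 0)); rewrite !mxE !mulr1n; exact.
rewrite ![dot _ y]dotC ![dot _ z]dotC in by0 bz az ay.
have au : dot a u = 0 by have := hq a; rewrite ay az mul1r mul0r addr0.
have bv : dot b v = 0 by have := hq b; rewrite by0 bz mul1r mul0r add0r.
have ab : dot b u = - dot a v.
  by have := hp a b; rewrite ay az by0 bz !mul1r !mul0r addr0 add0r => /eqP; rewrite addr_eq0 => /eqP.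
exists (- dot a v).
  apply: dot_inj => w; have := hp a w; rewrite ay az au mul1r mul0r mulr0 addr0 add0r dotZr.
  by rewrite (dotC z) => /eqP; rewrite addr_eq0 => /eqP ->; rewrite mulrC mulNr.
apply: dot_inj => w; have := hp b w; rewrite by0 bz bv ab mul1r mul0r mulr0 addr0 add0r dotZr.
by rewrite (dotC y) addrC => /eqP; rewrite addr_eq0 => /eqP ->; rewrite mulrC !mulNr.
Qed.

Lemma ex_nz k (U : 'M[K]_k) : (0 < \rank U)%N -> exists2 y : 'rV_k, (y <= U)%MS & y != 0.
Proof.
move=> rU; apply: NNPP => no; move: rU; rewrite lt0n mxrank_eq0 => /eqP; apply.
apply/row_matrixP=> i; rewrite row0; apply/eqP; apply: contraT => hi.
by case: no; exists (row i U); rewrite ?row_sub.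
Qed.

(** As in [glue_tensor], with squares phi^T phi as the invisible matrices. *)
Lemma glue_sym (hK : exists x : K, x != 0 /\ x != 1) (aT : Type) (S : aT -> Prop) k
    (tau : aT -> 'M[K]_k) (del : aT -> 'M[K]_(k, 1)) (T : {vspace 'M[K]_k}) d :
  (forall g, g \in T -> exists2 M, S M & tau M = g) -> symsp T ->
  (forall y, exists h, Rel S tau del y h) ->
  ('C(k.+1, 2) <= \dim T + d)%N -> (d + 1 < k)%N ->
  exists h, forall y, Rel S tau del y h.
Proof.
move=> TS sT RC dT dk.
have [t0 [t00 t01]] := hK.
suff [h H] : exists h, forall y, y *m (0 : 'M_k)^T = 0 -> Rel S tau del y h.
  by exists h => y; apply: H; rewrite trmx0 mulmx0.
have symF (P : 'M_k) : P^T = P -> P \in symV k by rewrite mem_symV => ->.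
have uniq Psi y h h' : Inv S tau (symV k) Psi -> y *m Psi^T = 0 -> y != 0 ->
    Rel S tau del y h -> Rel S tau del y h' -> h = h'.
  move=> IX yP y0 Rh Rh'; apply/eqP; rewrite -subr_eq0; set u := h - h'.
  have hu (P : 'M_k) : P^T = P -> y *m P *m u^T = 0.
    move=> /symF/IX[M SM eM]; rewrite eM // linearB /= mulmxBr -(Rh M SM) -(Rh' M SM).
    exact: subrr.
  have [b yb] := sep0 y0; rewrite dotC in yb.
  have bu : dot b u = 0.
    by have := hu _ (sqf_sym b); rewrite mul_outer yb scale1r /dot => ->; rewrite mxE.
  apply/eqP/row_vec0 => w; have := hu _ (prodf_sym b w).
  rewrite mul_prodf yb scale1r mulmxDl -scalemxAl [b *m _]mulmx_dot bu raddf0 scaler0 addr0.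
  by rewrite dotC /dot => ->; rewrite mxE.
apply: (@glue k k 1 (Rel S tau del) (State S tau (symV k)) _ _ _ _ _ d) => //.
- by move=> a y z h; exact: Rel_lin.
- move=> Psi /State0 IX.
  have pair y z hy hz : y *m Psi^T = 0 -> z *m Psi^T = 0 -> y != 0 -> ~~ (z <= y)%MS ->
      Rel S tau del y hy -> Rel S tau del z hz -> hy = hz.
    move=> yP zP y0 nzy Ry Rz.
    (* Two parameters remove the ambiguity of [sym_zero]: the difference of the relations is a
       multiple both of y + z and of y + t0 z, which are independent. *)
    have E t : t != 0 -> exists al, hy - hz = al *: (y + t *: z).
      move=> t0n; have [h Ryz] := RC (y + t *: z).
      have [] := @sym_zero _ y (t *: z) (h - hy) (h - hz) _ y0.
      - by apply: contra nzy => /sub_rVP[a e]; apply/sub_rVP; exists (t^-1 * a); rewrite -scalerA -e scalerK.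
      - move=> P /symF/IX[M SM eM].
        have tz : t *: z *m Psi^T = 0 by rewrite -scalemxAl zP scaler0.
        rewrite !eM // !linearB /= -[X in _ - X + _](Ry M SM) -!scalemxAl -(Rz M SM).
        by rewrite addrACA !scalemxAl -!mulmxDl -(Ryz M SM) -opprD mulmxDl subrr.
      move=> al ey ez; exists (- al).
      have -> : hy - hz = (h - hz) - (h - hy) by rewrite opprB [RHS]addrC addrA subrK.
      by rewrite ey ez scalerDr !scaleNr.
    have [a1 e1] := E 1 (oner_neq0 _); have [a2 e2] := E t0 t00.
    have e : (a1 - a2) *: y = (a2 * t0 - a1) *: z.
      have := e1; rewrite e2 scale1r !scalerDr scalerA => /eqP.
      rewrite -subr_eq0 => /eqP e3; apply/eqP; rewrite -subr_eq0 -[X in _ == X]oppr0 -e3.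
      by apply/eqP/rowP=> i; rewrite !mxE; ring.
    have c0 : a2 * t0 - a1 = 0.
      apply: contraNeq nzy => c0; apply/sub_rVP; exists ((a2 * t0 - a1)^-1 * (a1 - a2)).
      by rewrite -scalerA e scalerK.
    move: e; rewrite c0 scale0r => /eqP; rewrite scaler_eq0 (negPf y0) orbF subr_eq0 => /eqP e.
    move: c0; rewrite -e -[X in _ - X]mulr1 -mulrBr => /eqP; rewrite mulf_eq0 subr_eq0 (negPf t01) orbF.
    by move=> /eqP z1; apply/eqP; rewrite -subr_eq0 e1 z1 scale0r.
  have [[y0 [y0P y0n]]|no] := classic (exists y : 'rV_k, y *m Psi^T = 0 /\ y != 0); last first.
    exists 0 => y yP; have [->|y0] := eqVneq y 0; first by move=> M SM; rewrite !mul0mx.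
    by case: no; exists y.
  have [h Rh] := RC y0; exists h => y yP.
  have [/sub_rVP[a ->]|ny] := boolP (y <= y0)%MS.
    by rewrite -[_ *: _]addr0; apply: Rel_lin => // M SM; rewrite !mul0mx.
  have [hy Ry] := RC y.
  by rewrite (pair y0 y h hy).
- move=> Psi U h h' /State0 IX UP rU HU.
  have [y yU y0] := ex_nz rU.
  have [Rh Rh'] := HU y yU.
  by apply: (uniq Psi y) => //; apply: sub_mulmx0 yU UP.
- move=> c Psi P [X [XF IX dX]] rP.
  have [[phi [nphi hw]]|no] :=
    classic (exists phi : 'rV_k, ~~ (phi <= P)%MS /\ phi^T *m phi \notin X).
    exists phi => //; apply: (State_step XF IX dX (symF _ (sqf_sym phi))); first by rewrite hw.
    by move=> y /ann_adds[_ /ann_row yphi]; rewrite mul_outer yphi scale0r.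
  have [phi nphi] := ex_nsub rP; exists phi => //.
  have inX (psi : 'rV_k) : ~~ (psi <= P)%MS -> psi^T *m psi \in X.
    by move=> npsi; apply: contraT => hw; case: no; exists psi.
  have sqD (a b : 'rV[K]_k) : (a + b)^T *m (a + b) = a^T *m a + b^T *m b + prodf a b.
    by rewrite [(a + b)^T]linearD /= mulmxDl !mulmxDr (addrC (b^T *m a)) addrACA.
  have sq (psi : 'rV_k) : psi^T *m psi \in X.
    have [psiP|] := boolP (psi <= P)%MS; last exact: inX.
    have nadd (t : K) : t != 0 -> ~~ ((psi + t *: phi)%R <= P)%MS.
      move=> tn; apply: contra nphi => h.
      rewrite -[phi](scalerK tn) scalemx_sub // -(addKr psi (t *: phi)) addmx_sub //.
      by rewrite eqmx_opp.
    (* The values x = 1 and x = t0 together isolate the square of psi. *)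
    have A : forall x : K, x != 0 -> psi^T *m psi + x *: prodf psi phi \in X.
      move=> x tn; have := inX _ (nadd x tn).
      have -> : (psi + x *: phi)^T *m (psi + x *: phi) = psi^T *m psi + x *: prodf psi phi + x *: (x *: (phi^T *m phi)).
        by rewrite sqD prodfZr [(x *: phi)^T]linearZ /= -scalemxAl -scalemxAr addrAC.
      move=> h.
      by have := rpredB h (rpredZ x (rpredZ x (inX _ nphi))); rewrite addrK.
    have := rpredB (A t0 t00) (rpredZ t0 (A 1 (oner_neq0 _))).
    rewrite scale1r [t0 *: (_ + prodf _ _)]scalerDr opprD addrACA addrN addr0 -[X in X - _]scale1r -scalerBl.
    have nz : 1 - t0 != 0 by rewrite subr_eq0 eq_sym.
    by move=> h; rewrite -[_ *m _](scalerK nz) rpredZ.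
  apply: (State_step XF IX dX (mem0v _)); last by move=> y _; rewrite mulmx0.
  apply/orP; right; apply/subvP=> M; rewrite mem_symV => /eqP sM.
  apply: sym_span sM => i xi.
  have -> : prodf (ev K i) xi = (ev K i + xi)^T *m (ev K i + xi) - (ev K i)^T *m ev K i - xi^T *m xi.
    by rewrite sqD (addrC (_ + _) (prodf _ _)) -addrA -opprD addrK.
  by rewrite rpredD ?rpredZ ?rpredB.
- exists T; split.
  + by apply/subvP=> M MT; rewrite symF // sT.
  + by move=> g /TS[M SM <-]; exists M.
  + apply: leq_trans dT; apply: dim_sym => M; rewrite mem_symV; exact: eqP.
- by rewrite mxrank0; lia.
Qed.

Section Char2.
Hypothesis char2 : (2%:R : K) = 0.

Lemma oppr2 (x : K) : - x = x.
Proof. by apply/eqP; rewrite eq_sym -addr_eq0 addrr2. Qed.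

(** In characteristic 2 the alternating matrices are exactly the sums A^T + A. *)
Definition altV k : {vspace 'M[K]_k} := (linfun (@trmx K k k) + \1)%VF @: fullv.

Lemma altV_mem k (M : 'M[K]_k) : M \in altV k -> M^T = M /\ altf M.
Proof.
case/memv_imgP=> A _ ->; rewrite add_lfunE id_lfunE lfunE /=.
split; first by rewrite linearD /= trmxK addrC.
by move=> v; rewrite mulmxDr dotDl dot_mulmxl trmxK (dotC v) addrr2.
Qed.

Lemma mem_altV k (M : 'M[K]_k) : M^T = M -> altf M -> M \in altV k.
Proof.
move: M; apply: alt_span => i xi _; apply/memv_imgP; exists ((ev K i)^T *m xi); first exact: memvf.
by rewrite add_lfunE id_lfunE lfunE /= trmx_mul trmxK addrC.
Qed.

Lemma alt_zero1 k (y u : 'rV[K]_k) : y != 0 ->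
  (forall P : 'M_k, P^T = P -> altf P -> y *m P *m u^T = 0) -> exists a, u = a *: y.
Proof.
move=> y0 h; have [b yb] := sep0 y0; rewrite dotC in yb; exists (dot b u).
apply: dot_inj => w; have := h _ (prodf_sym b w) (altf_prodf char2 b w).
rewrite mul_prodf yb scale1r mulmxDl -scalemxAl !mulmx_dot => /(congr1 (fun A : 'M_1 => A 0 0)).
rewrite !mxE !mulr1n => /eqP; rewrite addr_eq0 oppr2 => /eqP ->.
by rewrite dotZr (dotC w) mulrC.
Qed.

Lemma alt_zero k (y z u v : 'rV[K]_k) : ~~ (z <= y)%MS -> y != 0 ->
  (forall P : 'M_k, P^T = P -> altf P -> y *m P *m u^T + z *m P *m v^T = 0) ->
  exists p q s, u = p *: y + q *: z /\ v = q *: y + s *: z.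
Proof.
move=> nzy y0 h.
have [b by0 bz] := sep2 nzy; have [a az ay] := sep2 (nsubC y0 nzy).
have hp (c w : 'rV_k) : dot y c * dot w u + dot y w * dot c u
    + (dot z c * dot w v + dot z w * dot c v) = 0.
  have := h _ (prodf_sym c w) (altf_prodf char2 c w); rewrite !mul_prodf !mulmxDl -!scalemxAl !mulmx_dot.
  move=> /(congr1 (fun A : 'M_1 => A 0 0)); rewrite !mxE !mulr1n; exact.
rewrite ![dot _ y]dotC ![dot _ z]dotC in by0 bz az ay.
have ab : dot b u = dot a v.
  by have := hp a b; rewrite ay az by0 bz !mul1r !mul0r addr0 add0r => /eqP; rewrite addr_eq0 oppr2 => /eqP.
exists (dot a u), (dot a v), (dot b v); split; apply: dot_inj => w.
  have := hp a w; rewrite ay az mul1r mul0r add0r dotDr !dotZr (dotC y) (dotC z) => e.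
  by apply/eqP; rewrite -subr_eq0 oppr2 -e; apply/eqP; ring.
have := hp b w; rewrite by0 bz mul1r mul0r add0r dotDr !dotZr (dotC y) (dotC z) ab => e.
by apply/eqP; rewrite -subr_eq0 oppr2 -e; apply/eqP; ring.
Qed.

Lemma ex_indep k (U : 'M[K]_k) : (1 < \rank U)%N ->
  exists y z : 'rV_k, [/\ (y <= U)%MS, (z <= U)%MS, y != 0 & ~~ (z <= y)%MS].
Proof.
move=> rU; have [y yU y0] := @ex_nz k U ltac:(lia).
apply: NNPP => no; have : (U <= y)%MS.
  apply/row_subP=> i; apply: contraT => hi; case: no.
  by exists y, (row i U); rewrite row_sub.
by move/mxrankS; rewrite rank_rV y0; lia.
Qed.

(** A line of direction phi meets a subspace that does not contain phi at most once, and three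
    parameters 0, 1, t0 face two subspaces. *)
Lemma two_avoid (hK : exists x : K, x != 0 /\ x != 1) (V : lmodType K) (P Q : V -> Prop) phi :
  (forall a x y, P x -> P y -> P (a *: x + y)) -> (forall a x y, Q x -> Q y -> Q (a *: x + y)) ->
  ~ P phi -> ~ Q phi -> forall sigma, exists t, ~ P (sigma + t *: phi) /\ ~ Q (sigma + t *: phi).
Proof.
move=> lP lQ nP nQ sigma; have [t0 [t00 t01]] := hK.
have one (R : V -> Prop) t t' : (forall a x y, R x -> R y -> R (a *: x + y)) -> ~ R phi -> t != t' ->
    R (sigma + t *: phi) -> R (sigma + t' *: phi) -> False.
  move=> lR nR tt Rt Rt'; apply: nR.
  have R0 : R 0 by have := lR (-1) _ _ Rt Rt; rewrite scaleN1r addNr.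
  have nz : t' - t != 0 by rewrite subr_eq0 eq_sym.
  have := lR ((t' - t)^-1) _ _ (lR (-1) _ _ Rt Rt') R0.
  by rewrite addr0 scaleN1r opprD addrACA addNr add0r addrC -scalerBl scalerK.
apply: NNPP => no.
have h t : P (sigma + t *: phi) \/ Q (sigma + t *: phi).
  by apply: NNPP => /not_or_and; case=> h1 h2; apply: no; exists t.
have n1 : (1 : K) != t0 by rewrite eq_sym.
have n0 : (0 : K) != t0 by rewrite eq_sym.
have n01 : (0 : K) != 1 by rewrite eq_sym oner_eq0.
by case: (h 0) (h 1) (h t0) => h0 [] h1 [] h2;
  first [exact: one lP nP n01 h0 h1 | exact: one lP nP n0 h0 h2 | exact: one lP nP n1 h1 h2
       | exact: one lQ nQ n01 h0 h1 | exact: one lQ nQ n0 h0 h2 | exact: one lQ nQ n1 h1 h2].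
Qed.

(** Since y (tau M) y^T = 0, a relation for y may be changed by multiples of y, so uniqueness needs
    two independent rows ([kap] = 2). The invisible matrices are products psi phi, which cost a
    single new form only when psi already lies in [Psi]. Hence one form zeta is spent in advance and
    the relation holds on its kernel; the condition on d is 1 + d + 2 < k. *)
Lemma glue_alt (hK : exists x : K, x != 0 /\ x != 1) (aT : Type) (S : aT -> Prop) k
    (tau : aT -> 'M[K]_k) (del : aT -> 'M[K]_(k, 1)) (T : {vspace 'M[K]_k}) d :
  (forall g, g \in T -> exists2 M, S M & tau M = g) -> (forall M, S M -> altf (tau M)) ->
  symsp T -> altsp T ->
  (forall y, exists h, Rel S tau del y h) ->
  ('C(k, 2) <= \dim T + d)%N -> (d + 3 < k)%N ->
  exists zeta h, forall y, dot y zeta = 0 -> Rel S tau del y h.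
Proof.
move=> TS aS sT aT' RC dT dk.
(* Keeps the recursion going: some psi in [Psi] still has a product outside [X], unless [X] already
   contains all alternating matrices. *)
pose live (X : {vspace 'M[K]_k}) (Psi : 'M_k) := (altV k <= X)%VS \/
  exists (psi eta : 'rV_k), (psi <= Psi)%MS /\ prodf psi eta \notin X.
pose st c (Psi : 'M_k) := exists X : {vspace 'M[K]_k},
  [/\ (X <= altV k)%VS, Inv S tau X Psi, (\dim (altV k) <= \dim X + c)%N & live X Psi].
have pF (l m : 'rV_k) : prodf l m \in altV k.
  by apply: mem_altV; [exact: prodf_sym | exact: altf_prodf].
have st0 Psi : st 0%N Psi -> Inv S tau (altV k) Psi.
  by case=> X [h1 h2 h3 _]; apply: (@State0 _ _ _ _ _ (altV k)); exists X.
have addR y h a : Rel S tau del y h -> Rel S tau del y (h + a *: y).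
  move=> Ry M SM; rewrite Ry // linearD linearZ /= mulmxDr -scalemxAr.
  by rewrite [_ *m y^T]mulmx_dot aS // raddf0 scaler0 addr0.
suff [zeta sz] : exists zeta : 'rV_k, st d (<<zeta>>%MS).
  exists zeta; suff [h H] : exists h, forall y, y *m (<<zeta>>%MS)^T = 0 -> Rel S tau del y h.
    exists h => y yz; apply: H; apply/mulmx_tr0P.
    have : zeta *m y^T = 0 by apply/mulmx_tr0P/ann_row.
    by apply: sub_mulmx0; rewrite genmxE.
  apply: (@glue k k 2 (Rel S tau del) st _ _ _ _ _ d _ sz).
  - by [].
  - by move=> a y z h; exact: Rel_lin.
  - move=> Psi /st0 IX.
    have pair y z hy hz : y *m Psi^T = 0 -> z *m Psi^T = 0 -> y != 0 -> ~~ (z <= y)%MS ->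
        Rel S tau del y hy -> Rel S tau del z hz -> exists a b, hy + a *: y = hz + b *: z.
      move=> yP zP y0 nzy Ry Rz; have [h Ryz] := RC (y + z).
      have [] := @alt_zero _ y z (h - hy) (h - hz) nzy y0.
        move=> P sP aP; have [M SM eM] := IX P (mem_altV sP aP).
        rewrite !eM // !linearB /= -(Ry M SM) -(Rz M SM).
        by rewrite addrACA -!mulmxDl -(Ryz M SM) -opprD mulmxDl subrr.
      move=> p [q [t [e1 e2]]]; exists (p - q), (t - q); apply/eqP; rewrite -subr_eq0.
      have -> : hy + (p - q) *: y - (hz + (t - q) *: z)
          = (h - hz) - (h - hy) + ((p - q) *: y - (t - q) *: z).
        by rewrite opprB (addrC (h - hz)) (addrA (hy - h)) subrK opprD addrACA.
      rewrite e1 e2; apply/eqP/rowP=> i; rewrite !mxE; ring.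
    have [[y0 [y0P y0n]]|no] := classic (exists y : 'rV_k, y *m Psi^T = 0 /\ y != 0); last first.
      exists 0 => y yP; have [->|y0] := eqVneq y 0; first by move=> M SM; rewrite !mul0mx.
      by case: no; exists y.
    have R0 h : Rel S tau del 0 h by move=> M SM; rewrite !mul0mx.
    have [[z0 [z0P nz0]]|no] := classic (exists z : 'rV_k, z *m Psi^T = 0 /\ ~~ (z <= y0)%MS); last first.
      have [h Rh] := RC y0; exists h => y yP.
      have [/sub_rVP[a ->]|ny] := boolP (y <= y0)%MS; last by case: no; exists y.
      by rewrite -[_ *: _]addr0; apply: Rel_lin.
    have [hy Ry] := RC y0; have [hz Rz] := RC z0.
    have [a [b eab]] := pair y0 z0 hy hz y0P z0P y0n nz0 Ry Rz.
    exists (hy + a *: y0) => y yP; set h := hy + _.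
    have Rhy : Rel S tau del y0 h by exact: addR.
    have Rhz : Rel S tau del z0 h by rewrite /h eab; exact: addR.
    have [/sub_addsmxP[[u w] /= e]|ny] := boolP (y <= y0 + z0)%MS.
      rewrite e [u]mx11_scalar [w]mx11_scalar !mul_scalar_mx.
      by apply: Rel_lin => //; rewrite -[_ *: _]addr0; apply: Rel_lin.
    have [h' Ry'] := RC y.
    have ny0 : ~~ (y <= y0)%MS.
      by apply: contra ny => /submx_trans; apply; exact: addsmxSl.
    have nyz : ~~ (y <= z0)%MS.
      by apply: contra ny => /submx_trans; apply; exact: addsmxSr.
    have z0n : z0 != 0 by apply: contraNneq nz0 => ->; exact: sub0mx.
    have [c1 [c2 e1]] := pair y0 y h h' y0P yP y0n ny0 Rhy Ry'.
    have [c3 [c4 e2]] := pair z0 y h h' z0P yP z0n nyz Rhz Ry'.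
    have e3 : c1 *: y0 - c3 *: z0 = (c2 - c4) *: y.
      have : (h + c1 *: y0) - (h + c3 *: z0) = (h' + c2 *: y) - (h' + c4 *: y) by rewrite e1 e2.
      by rewrite opprD addrACA subrr add0r opprD [h' + _ + _]addrACA subrr add0r scalerBl.
    have c24 : c2 - c4 = 0.
      apply: contraNeq ny => c24; rewrite -[y](scalerK c24) -e3 scalemx_sub //.
      by rewrite addmx_sub ?eqmx_opp ?scalemx_sub ?addsmxSl ?addsmxSr.
    have c3z : c3 = 0.
      apply: contraNeq nz0 => c3n; apply/sub_rVP; exists (c3^-1 * c1).
      have : c1 *: y0 = c3 *: z0 by apply/eqP; rewrite -subr_eq0 e3 c24 scale0r.
      by rewrite -scalerA => ->; rewrite scalerK.
    have -> : h = h' + c4 *: y by rewrite -e2 c3z scale0r addr0.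
    exact: addR.
  - move=> Psi U h h' /st0 IX UP rU HU.
    have [y [z [yU zU y0 nzy]]] := ex_indep rU.
    have on (v : 'rV_k) : (v <= U)%MS -> v != 0 -> exists a, h - h' = a *: v.
      move=> vU v0; have [Rh Rh'] := HU v vU; apply: alt_zero1 v0 _ => P sP aP.
      have [M SM eM] := IX P (mem_altV sP aP).
      rewrite eM; last exact: sub_mulmx0 vU UP.
      by rewrite linearB /= mulmxBr -(Rh M SM) -(Rh' M SM) subrr.
    have z0 : z != 0 by apply: contraNneq nzy => ->; exact: sub0mx.
    have [a ea] := on y yU y0; have [b eb] := on z zU z0.
    apply/eqP; rewrite -subr_eq0 eb.
    suff -> : b = 0 by rewrite scale0r.
    apply: contraNeq nzy => b0; apply/sub_rVP; exists (b^-1 * a).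
    by rewrite -scalerA -ea eb scalerK.
  - move=> c Psi P [X [XF IX dX lX]] rP.
    have [full|nf] := boolP (altV k <= X)%VS.
      have [phi nphi] := ex_nsub rP; exists phi => //; exists X; split=> //; last by left.
        by move=> g /IX[M SM eM]; exists M => // y /ann_adds[yP _]; exact: eM.
      by apply: leq_trans (dimvS full) _; exact: leq_addr.
    case: lX => [h|[psi0 [eta0 [psi0P eta0X]]]]; first by rewrite h in nf.
    have [phi0 nP0 nX0] : exists2 phi0 : 'rV_k, ~~ (phi0 <= P)%MS & prodf psi0 phi0 \notin X.
      have [phi1 n1] := ex_nsub rP.
      have [n2|n2] := boolP (prodf psi0 phi1 \in X); last by exists phi1.
      have [n3|n3] := boolP (eta0 <= P)%MS; last by exists eta0.
      exists (phi1 + eta0).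
        apply: contra n1 => h; rewrite -(addrK eta0 phi1) addmx_sub // ?eqmx_opp //.
      by apply: contra eta0X => h; have := rpredB h n2; rewrite prodfDr addrC addKr.
    (* If no admissible phi keeps the state alive, the enlargement of [X] by [psi0 phi] absorbs all
       products with phi and lies in the one by [psi0 phi0]. By [two_avoid] every form is an
       admissible one minus a multiple of phi0, so this single enlargement would contain all
       alternating matrices. *)
    apply: NNPP => no.
    pose Xp (phi : 'rV_k) := (X + <[prodf psi0 phi]>)%VS.
    have stuck (phi : 'rV_k) : ~~ (phi <= P)%MS -> prodf psi0 phi \notin X ->
        ~~ (altV k <= Xp phi)%VS /\
        forall psi eta : 'rV_k, (psi <= Psi + phi)%MS -> prodf psi eta \in Xp phi.
      move=> nP nX.
      have nlive : ~ live (Xp phi) (Psi + phi)%MS.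
        move=> lv; apply: no; exists phi => //; exists (Xp phi); split=> //.
        - by rewrite subv_add XF -memvE pF.
        - apply: Inv_add IX _ => y /ann_adds[yP /ann_row yphi].
          rewrite mul_prodf yphi scale0r addr0.
          have -> : dot y psi0 = 0; last by rewrite scale0r.
          apply/ann_row/mulmx_tr0P; apply: sub_mulmx0 psi0P _; exact/mulmx_tr0P.
        - by apply: leq_trans dX _; rewrite addnS -addSn leq_add2r; exact: dim_add_line.
      split; first by apply/negP=> h; apply: nlive; left.
      move=> psi eta h; apply: contraT => h'; case: nlive; right.
      by exists psi, eta.
    have [nf0 in0] := stuck _ nP0 nX0.
    have le (phi : 'rV_k) : ~~ (phi <= P)%MS -> prodf psi0 phi \notin X -> (Xp phi <= Xp phi0)%VS.
      move=> nP nX; rewrite subv_add addvSl -memvE in0 //.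
      by apply: submx_trans psi0P _; exact: addsmxSl.
    move/negP: nf0; apply; apply/subvP=> N /altV_mem[sN aN].
    move: N sN aN; apply: alt_span => i xi _; move: (ev K i) => sigma.
    have [t [t1 t2]] := @two_avoid hK _ (fun v : 'rV_k => (v <= P)%MS) (fun v => prodf psi0 v \in X) phi0
      (fun a x y hx hy => addmx_sub (scalemx_sub a hx) hy)
      (fun a x y hx hy => eq_ind_r (fun z => z \in X) (rpredD (rpredZ a hx) hy)
         (etrans (prodfDr _ _ _) (congr1 (fun z => z + _) (prodfZr _ _ _))))
      (negP nP0) (negP nX0) sigma.
    have -> : sigma = (sigma + t *: phi0) - t *: phi0 by rewrite addrK.
    rewrite -scaleNr prodfDl prodfZl rpredD ?rpredZ //; last by apply: in0; exact: addsmxSr.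
    have [_ h] := stuck _ (introN idP t1) (introN idP t2).
    apply: (subvP (le _ (introN idP t1) (introN idP t2))).
    by apply: h; exact: addsmxSr.
  - by rewrite genmxE rank_rV; case: (zeta != 0) => /=; lia.
have TF : (T <= altV k)%VS by apply/subvP=> N NT; apply: mem_altV; [exact: sT | exact: aT'].
have IT Psi : Inv S tau T Psi by move=> g /TS[M SM <-]; exists M.
have dA : (\dim (altV k) <= \dim T + d)%N.
  by apply: leq_trans dT; apply: dim_alt => M /altV_mem[].
have [full|nf] := boolP (altV k <= T)%VS; first by exists 0, T; split=> //; left.
have [i [xi nT]] : exists i, exists xi : 'rV_k, prodf (ev K i) xi \notin T.
  apply: NNPP => no; move/negP: nf; apply; apply/subvP=> N /altV_mem[sN aN].
  move: N sN aN; apply: alt_span => i xi _; apply: contraT => h.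
  by case: no; exists i, xi.
exists (ev K i), T; split=> //; right; exists (ev K i), xi.
by rewrite genmxE.
Qed.
End Char2.

End Gluing.

(** * Spaces of forms vanishing on a hyperplane *)

Section NormalForms.
Variable K : fieldType.

(** For mu dual to [y], ker nu is spanned by [y] and the common kernel [W] of nu and mu. An M with y
    M = 0 that vanishes on [W] thus vanishes on ker nu, and [rank_hyper] lowers the rank of M0 + M
    on [W] by two. *)
Lemma vec_core n (S : {vspace 'M[K]_n}) M0 (y nu : 'rV_n) :
  symsp S -> M0 \in S -> y *m M0 = nu -> nu != 0 -> dot y nu = 0 ->
  exists2 W : 'M[K]_(n.-2, n), forall M, M \in (S :&: lker (vec y))%VS ->
      (\rank (W *m M0 *m W^T + W *m M *m W^T)%R + 2 <= \rank (M0 + M)%R)%N &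
    (\dim S <= \dim (vec y @: S) + \dim (Sl S (kermx nu^T) :&: lker (vec y))
      + \dim (rs W @: (S :&: lker (vec y))))%N.
Proof.
move=> sS M0S yM0 nu0 ynu.
have y0 : y != 0 by apply: contraNneq nu0 => y0; rewrite -yM0 y0 mul0mx.
have [mu muy] := sep0 y0.
have nmu : ~~ (mu <= nu)%MS.
  apply/negP=> /sub_rVP[a e]; move: muy; rewrite e dotZl dotC ynu mulr0 => /eqP.
  by rewrite eq_sym oner_eq0.
have [W [fW Wnu Wmu sW]] := ex_ker2basis nu0 nmu.
set Sy := (S :&: lker (vec y))%VS.
have d1 : (\dim Sy + \dim (vec y @: S) = \dim S)%N by exact: limg_ker_dim.
have d2 := dim_rs Sy W.
have d4 : (\dim (Sl Sy W) <= \dim (Sl S (kermx nu^T) :&: lker (vec y)))%N.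
  apply/dimvS/subvP=> M; rewrite mem_Sl !memv_cap !memv_ker !vecE rsE.
  case/andP=> /andP[MS /eqP yM] /eqP WM.
  rewrite MS yM eqxx /= andbT; apply/eqP/(@zero_sub _ _ _ _ (col_mx y W)).
    apply/row_subP=> i; set u := row i _.
    have unu : dot u nu = 0 by apply/eqP; rewrite -dot_ker row_sub.
    rewrite -(subrK (dot u mu *: y) u) -addsmxE addrC addmx_sub_adds ?scalemx_sub //.
    by apply: sW; rewrite !dotE ?unu ?ynu ?(dotC y) ?muy; ring.
  have My : M *m y^T = 0 by apply/mulmx_tr0P; rewrite (sS _ MS).
  by rewrite mul_col_mx tr_col_mx mul_col_row yM -[W *m M *m y^T]mulmxA My WM !mul0mx mulmx0 block_mx0.
exists W; last by rewrite -d1 -d2 addnAC leq_add2r addnC leq_add2l.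
move=> M; rewrite memv_cap memv_ker vecE => /andP[MS /eqP yM].
rewrite -mulmxDl -mulmxDr.
have MM : M0 + M \in S by rewrite rpredD.
have := @rank_hyper K n (M0 + M) y nu _ W (sS _ MM).
by rewrite (mulmxDr y) yM0 yM addr0 => /(_ erefl nu0 ynu Wnu).
Qed.

Lemma dim_sing_vec (hK : exists x : K, x != 0 /\ x != 1) n (S : {vspace 'M[K]_n}) M0 (y nu : 'rV_n) :
  symsp S -> (forall M, M \in S -> (\rank M < n)%N) -> M0 \in S -> y *m M0 = nu -> nu != 0 ->
  dot y nu = 0 ->
  (\dim S <= \dim (vec y @: S) + \dim (Sl S (kermx nu^T) :&: lker (vec y)) + 'C(n.-2, 2))%N.
Proof.
move=> sS urk M0S yM0 nu0 ynu; have [W rW dS] := vec_core sS M0S yM0 nu0 ynu.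
apply: leq_trans dS _; rewrite leq_add2l.
apply: (dim_sing_sym hK (sym_congr W (sS _ M0S))).
  by apply: symsp_rs; apply: symsp_sub sS; exact: capvSl.
move=> _ /mem_rs[M MS ->].
have MM : M0 + M \in S by rewrite rpredD //; move: MS; rewrite memv_cap => /andP[].
by have := leq_ltn_trans (rW M MS) (urk _ MM); rewrite addn2 !ltn_predRL.
Qed.

Lemma dim_alt_vec (hK : exists x : K, x != 0 /\ x != 1) n (S : {vspace 'M[K]_n}) M0 (y nu : 'rV_n) :
  (2%:R : K) = 0 -> ~~ odd n -> symsp S -> altsp S -> (forall M, M \in S -> (\rank M < n)%N) ->
  M0 \in S -> y *m M0 = nu -> nu != 0 ->
  (\dim S <= \dim (vec y @: S) + \dim (Sl S (kermx nu^T) :&: lker (vec y)) + 'C(n.-2.-1, 2))%N.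
Proof.
move=> c2 on sS aS urk M0S yM0 nu0.
have ynu : dot y nu = 0 by rewrite -yM0 dotC; exact: aS.
have [W rW dS] := vec_core sS M0S yM0 nu0 ynu.
apply: leq_trans dS _; rewrite leq_add2l.
have lt M : M \in (S :&: lker (vec y))%VS -> (\rank (W *m M0 *m W^T + W *m M *m W^T)%R < n.-2)%N.
  move=> MS; have MM : M0 + M \in S by rewrite rpredD //; move: MS; rewrite memv_cap => /andP[].
  by have := leq_ltn_trans (rW M MS) (urk _ MM); rewrite addn2 !ltn_predRL.
have n2 : (0 < n.-2)%N by apply: leq_ltn_trans (lt 0 (mem0v _)).
have on2 : ~~ odd n.-2 by clear -on n2; lia.
apply: (@dim_sing_alt K c2 hK n.-2 (W *m M0 *m W^T)) => //.
- exact: sym_congr (sS _ M0S).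
- exact: altf_congr (aS _ M0S).
- by apply: symsp_rs; apply: symsp_sub sS; exact: capvSl.
- by apply: altsp_rs; apply: altsp_sub aS; exact: capvSl.
- by move=> _ /mem_rs[M MS ->]; exact: lt.
Qed.

(** [l] stays outside the row space of M0 + tQ: otherwise the rows of Q and M0 would lie there too,
    and the rank condition would put [l] in the row space of [M0], which [x] excludes. So no vector
    is sent to a nonzero multiple of [l]. Vectors in ker M0 and ker l then give mu = w M0, and x - t
    w gives a condition linear in t, whose two instances yield isotropy. *)
Lemma normal_form n (M0 Q : 'M[K]_n) (x l : 'rV_n) t1 t2 :
  M0^T = M0 -> Q^T = Q -> x *m M0 = 0 -> dot x l = 1 ->
  kermx l^T *m Q *m (kermx l^T)^T = 0 -> t1 != 0 -> t2 != 0 -> t1 != t2 ->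
  (\rank (M0 + t1 *: Q)%R <= \rank M0)%N -> (\rank (M0 + t2 *: Q)%R <= \rank M0)%N ->
  exists mu w, [/\ Q = prodf l mu, w *m M0 = mu, dot w mu = 0 & dot w l = 0].
Proof.
move=> sM sQ xM xl kQ t10 t20 t12 r1 r2.
have QE := form_hyper sQ xl (submx_refl _) kQ.
set xi := x *m Q in QE.
have notin t : t != 0 -> (\rank (M0 + t *: Q)%R <= \rank M0)%N -> ~~ (l <= (M0 + t *: Q)%R)%MS.
  move=> t0 rt; apply/negP=> lin.
  have xin : (xi <= (M0 + t *: Q)%R)%MS.
    rewrite -[xi](scalerK t0) scalemx_sub //.
    have -> : t *: xi = x *m (M0 + t *: Q) by rewrite mulmxDr xM add0r -scalemxAr.
    exact: submxMl.
  have Qin : (Q <= (M0 + t *: Q)%R)%MS.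
    rewrite [X in (X <= _)%MS]QE /prodf; apply: addmx_sub.
      by apply: addmx_sub; apply: submx_trans (submxMl _ _) _.
    by rewrite scalemx_sub //; apply: submx_trans (submxMl _ _) _.
  have Min : (M0 <= (M0 + t *: Q)%R)%MS.
    by rewrite -{1}(addrK (t *: Q) M0) addmx_sub // eqmx_opp scalemx_sub.
  have : ((M0 + t *: Q)%R <= M0)%MS by rewrite -(geq_leqif (mxrank_leqif_sup Min)).
  move/(submx_trans lin)/submxP=> [D lE]; move: xl.
  rewrite lE dot_mulmxr sM xM dot0l => /eqP; by rewrite eq_sym oner_eq0.
set xi' := xi - dot xi x *: l.
have QE' : Q = prodf l xi' + dot xi x *: (l^T *m l).
  by rewrite {1}QE /xi' prodfDr -scaleNr prodfZr /prodf scalerDr !scaleNr -!addrA addNr addr0.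
have xi'x : dot xi' x = 0 by rewrite !dotE (dotC l) xl mulr1 subrr.
have kill (z : 'rV_n) : z *m M0 = 0 -> dot z l = 0 -> dot z xi = 0.
  move=> zM zl; apply/eqP/contraT => zxi; case/negP: (notin _ t10 r1).
  have e : z *m (M0 + t1 *: Q) = (t1 * dot z xi) *: l.
    by rewrite mulmxDr zM add0r -scalemxAr QE mulmxDr mul_prodf -scalemxAr mul_outer zl !scale0r scaler0 addr0 add0r scalerA.
  have nz : t1 * dot z xi != 0 by rewrite mulf_neq0.
  by rewrite -[l](scalerK nz) scalemx_sub // -e submxMl.
have [w0 w0M] : exists w0, w0 *m M0 = xi'.
  have /submxP[w ->] : (xi' <= M0)%MS; last by exists w.
  apply: contraT => /sep[a aM axi]; rewrite sM in aM.
  have := kill (a - dot a l *: x); rewrite mulmxBl -scalemxAl aM xM scaler0 subr0 !dotE xl mulr1 subrr.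
  move=> /(_ erefl erefl) h; move: axi; rewrite /xi' !dotE mulrC (dotC xi) h => /eqP.
  by rewrite eq_sym oner_eq0.
set w := w0 - dot w0 l *: x.
have wl : dot w l = 0 by rewrite !dotE xl mulr1 subrr.
have wM : w *m M0 = xi' by rewrite mulmxBl -scalemxAl xM scaler0 subr0.
have co t : t != 0 -> (\rank (M0 + t *: Q)%R <= \rank M0)%N -> dot xi x = t * dot w xi'.
  move=> t0 rt; apply: contraNeq (notin t t0 rt) => ne.
  have e : (x - t *: w) *m (M0 + t *: Q) = (t * (dot xi x - t * dot w xi')) *: l.
    rewrite mulmxBl !mulmxDr xM add0r -scalemxAl wM -!scalemxAr -/xi -!scalemxAl.
    have -> : w *m Q = dot w xi' *: l.
      by rewrite {1}QE' mulmxDr mul_prodf -scalemxAr mul_outer wl !scale0r scaler0 addr0 add0r.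
    by rewrite /xi'; apply/rowP=> i; rewrite !mxE; ring.
  have nz : t * (dot xi x - t * dot w xi') != 0 by rewrite mulf_neq0 // subr_eq0.
  by rewrite -[l](scalerK nz) scalemx_sub // -e submxMl.
have e1 := co t1 t10 r1; have e2 := co t2 t20 r2.
have w0' : dot w xi' = 0.
  have : (t1 - t2) * dot w xi' = 0 by rewrite mulrBl -e1 -e2 subrr.
  by move/eqP; rewrite mulf_eq0 subr_eq0 (negPf t12) => /eqP.
exists xi', w; split=> //.
by rewrite QE' e1 w0' mulr0 scale0r addr0.
Qed.

(** For isotropic [w] the transvection 1 + t l^T w produces no quadratic term in t. *)
Lemma prodf_shear n (M : 'M[K]_n) (l mu w : 'rV_n) t : M^T = M -> w *m M = mu -> dot w mu = 0 ->
  (1%:M + t *: (l^T *m w)) *m M *m (1%:M + t *: (l^T *m w))^T = M + t *: prodf l mu.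
Proof.
move=> sM wM wmu.
have -> : (1%:M + t *: (l^T *m w))^T = 1%:M + t *: (w^T *m l).
  by rewrite linearD linearZ /= trmx1 trmx_mul trmxK.
rewrite mulmxDl mul1mx -scalemxAl -mulmxA wM mulmxDr mulmx1 mulmxDl -!scalemxAr -!scalemxAl.
have -> : M *m (w^T *m l) = mu^T *m l.
  by rewrite mulmxA -{1}sM -trmx_mul wM.
have -> : l^T *m mu *m (w^T *m l) = 0.
  by rewrite -mulmxA mul_outer dotC wmu scale0r mulmx0.
by rewrite !scaler0 addr0 /prodf scalerDr -addrA (addrC (t *: (l^T *m mu))).
Qed.

Lemma rank_shear n (M : 'M[K]_n) (l mu w : 'rV_n) t : M^T = M -> w *m M = mu -> dot w mu = 0 ->
  dot w l = 0 -> \rank (M + t *: prodf l mu)%R = \rank M.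
Proof.
move=> sM wM wmu wl; apply/eqP; rewrite eqn_leq -{1}(prodf_shear l t sM wM wmu) rank_congr /=.
set M' := M + _.
have sM' : M'^T = M' by rewrite linearD linearZ /= sM prodf_sym.
have wM' : w *m M' = mu.
  by rewrite mulmxDr wM -scalemxAr mul_prodf wmu wl !scale0r addr0 scaler0 addr0.
have -> : M = M' + (- t) *: prodf l mu by rewrite /M' scaleNr addrK.
by rewrite -(prodf_shear l (- t) sM' wM' wmu) rank_congr.
Qed.

(** M1 = M0 + t [l' mu'] has the rank of M0, and [normal_form] applies to [l mu] over M1. The second
    factor it returns differs from mu by c l, with 2c = 0. Evaluation on ker M1, which contains z -
    t l'(z) w' for z in ker M0, gives the second relation; undoing the shear gives the isotropic
    preimage under M0. *)
Lemma orth_core n (M0 : 'M[K]_n) (l mu w l' mu' w' x : 'rV_n) t t1 t2 :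
  M0^T = M0 -> x *m M0 = 0 -> w *m M0 = mu -> w' *m M0 = mu' -> dot w' mu' = 0 -> dot w' l' = 0 ->
  dot x l - t * dot x l' * dot w' l != 0 -> t1 != 0 -> t2 != 0 -> t1 != t2 ->
  (\rank (M0 + t *: prodf l' mu' + t1 *: prodf l mu)%R <= \rank M0)%N ->
  (\rank (M0 + t *: prodf l' mu' + t2 *: prodf l mu)%R <= \rank M0)%N ->
  exists c : K, [/\ 2%:R * c = 0,
    forall z, z *m M0 = 0 -> - (t * dot z l' * dot w' mu) = c * (dot z l - t * dot z l' * dot w' l) &
    exists v : 'rV_n, v *m M0 = mu - c *: l - (t * dot w' (mu - c *: l)) *: l' /\
      dot v (mu - c *: l - (t * dot w' (mu - c *: l)) *: l') = 0].
Proof.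
move=> sM xM wM wM' wmu' wl' nz t10 t20 t12 r1 r2.
set M1 := M0 + t *: prodf l' mu' in r1 r2.
have sM1 : M1^T = M1 by rewrite linearD linearZ /= sM prodf_sym.
have rM1 : \rank M1 = \rank M0 by exact: (rank_shear t sM wM' wmu' wl').
have kil z : z *m M0 = 0 -> (z - (t * dot z l') *: w') *m M1 = 0.
  move=> zM; rewrite /M1 mulmxDr -scalemxAr mul_prodf !mulmxBl -!scalemxAl zM wM' !dotE wl' wmu'.
  have -> : dot z mu' = 0 by rewrite -wM' dot_mulmxr sM zM dot0l.
  by apply/rowP=> i; rewrite !mxE; ring.
set x' := x - (t * dot x l') *: w'.
have x'l : dot x' l != 0 by rewrite !dotE.
pose x2 := (dot x' l)^-1 *: x'.
have x2M : x2 *m M1 = 0 by rewrite -scalemxAl kil // scaler0.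
have x2l : dot x2 l = 1 by rewrite dotZl mulVf.
have kl : l *m (kermx l^T)^T = 0 by apply: trmx_inj; rewrite trmx_mul trmxK mulmx_ker trmx0.
have kQ : kermx l^T *m prodf l mu *m (kermx l^T)^T = 0.
  by rewrite prodf_congr kl /prodf trmx0 mul0mx mulmx0 addr0.
rewrite -rM1 in r1 r2.
have [mu2 [w2 [e2 w2M w2mu w2l]]] :=
  normal_form sM1 (prodf_sym l mu) x2M x2l kQ t10 t20 t12 r1 r2.
pose c := - dot x2 (mu - mu2).
have mu2E : mu - mu2 = c *: l.
  have : x2 *m prodf l (mu - mu2) = 0 by rewrite -scaleN1r prodfDr prodfZr -e2 scaleN1r subrr mulmx0.
  by rewrite mul_prodf x2l scale1r => /eqP; rewrite addr_eq0 -scaleNr => /eqP.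
have mu2E' : mu2 = mu - c *: l by rewrite -mu2E opprB addrC subrK.
exists c; split.
- have : dot x2 (mu - mu2) = c by rewrite mu2E dotZr x2l mulr1.
  by rewrite mulr_natl mulr2n => {2}<-; rewrite /c addNr.
- move=> z zM; set z' := z - (t * dot z l') *: w'.
  have : dot z' mu2 = 0 by rewrite -w2M dot_mulmxr sM1 kil // dot0l.
  have zmu : dot z mu = 0 by rewrite -wM dot_mulmxr sM zM dot0l.
  rewrite mu2E' /z' !dotE zmu => e.
  by apply/eqP; rewrite -subr_eq0 -e; apply/eqP; ring.
rewrite -mu2E'.
pose A := 1%:M + t *: (l'^T *m w'); pose B := 1%:M - t *: (l'^T *m w').
have BA : B *m A = 1%:M.
  rewrite /A /B mulmxBl mul1mx mulmxDr mulmx1 -!scalemxAr -!scalemxAl -!mulmxA (mulmxA w').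
  by rewrite mulmx_dot wl' raddf0 mul0mx mulmx0 !scaler0 addr0 addrK.
have AB : A *m B = 1%:M by apply: mulmx1C.
have eB : mu2 *m B^T = mu2 - (t * dot w' mu2) *: l'.
  have -> : B^T = 1%:M - t *: (w'^T *m l').
    by rewrite linearB linearZ /= trmx1 trmx_mul trmxK.
  by rewrite mulmxBr mulmx1 -scalemxAr mul_outer scalerA (dotC mu2).
exists (w2 *m A); rewrite -eB.
have vM : w2 *m A *m M0 = mu2 *m B^T.
  rewrite -w2M /M1 -(prodf_shear l' t sM wM' wmu') -/A -!mulmxA -trmx_mul BA trmx1 mulmx1.
  by rewrite mulmxA.
by split=> //; rewrite dot_mulmxr trmxK -mulmxA AB mulmx1.
Qed.

End NormalForms.

(** * Three pairwise orthogonal isotropic spaces *)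

Section Triple.
Variable K : fieldType.

Lemma vs_mx n (V : {vspace 'rV[K]_n}) : exists A : 'M[K]_(\dim V, n),
  row_free A /\ forall w, (w <= A)%MS = (w \in V).
Proof.
pose X := vbasis V; pose A : 'M[K]_(\dim V, n) := \matrix_i X`_i.
have mulA (c : 'rV_(\dim V)) : c *m A = \sum_i c 0 i *: X`_i.
  by rewrite mulmx_sum_row; apply: eq_bigr => i _; rewrite rowK.
exists A; split.
  apply: inj_row_free => v; rewrite mulA => e; apply/rowP=> i; rewrite mxE.
  by have /freeP := basis_free (vbasisP V); apply.
move=> w; apply/idP/idP=> [/submxP[c ->]|wV].
  by rewrite mulA rpred_sum // => i _; rewrite rpredZ // vbasis_mem // mem_nth // size_tuple.
rewrite (coord_vbasis wV); apply/submxP; exists (\row_i coord X i w); rewrite mulA.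
by apply: eq_bigr => i _; rewrite mxE.
Qed.

Section Fixed.
Variables (n : nat) (M0 : 'M[K]_n).
Hypothesis sM : M0^T = M0.

Lemma orthE m1 m2 (A : 'M[K]_(m1, n)) (B : 'M_(m2, n)) :
  A *m M0 *m B^T = 0 <-> forall u v : 'rV_n, (u <= A)%MS -> (v <= B)%MS -> dot (u *m M0) v = 0.
Proof.
split=> [h u v /submxP[c ->] /submxP[d ->]|h].
  by rewrite /dot trmx_mul !mulmxA -(mulmxA c) -(mulmxA c) h mulmx0 mul0mx mxE.
apply/row_matrixP=> i; rewrite row_mul row_mul row0; apply: row_vec0 => w.
rewrite dot_mulmxl trmxK; apply: h; [exact: row_sub | exact: submxMl].
Qed.

Lemma orth_rank m1 m2 (X : 'M[K]_(m1, n)) (Y : 'M_(m2, n)) : (kermx M0 <= X)%MS -> X *m M0 *m Y^T = 0 ->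
  (\rank X + \rank Y <= n + (n - \rank M0))%N.
Proof.
move=> NX XY.
have h1 := mulmx0_rank_max XY; rewrite mxrank_tr in h1.
have h2 := mxrank_mul_ker X M0.
have h3 : \rank (X :&: kermx M0)%MS = (n - \rank M0)%N.
  by rewrite (capmx_idPr NX) mxrank_ker.
lia.
Qed.

(** On [W] the form M0 is alternating with a radical of codimension at most one, hence zero. In
    characteristic 2 isotropy of all vectors would not suffice. *)
Lemma isotropic_orth m1 m2 (W : 'M[K]_(m1, n)) (Z : 'M_(m2, n)) :
  (forall w, (w <= W)%MS -> dot (w *m M0) w = 0) -> (Z <= W)%MS -> Z *m M0 *m W^T = 0 ->
  (\rank W <= \rank Z + 1)%N -> W *m M0 *m W^T = 0.
Proof.
move=> iso ZW /orthE oZ rk; apply/orthE.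
have [WZ|] := boolP (W <= Z)%MS.
  by move=> u v uW vW; apply: oZ => //; apply: submx_trans uW WZ.
case/row_subPn=> i; set x := row i W => xZ.
have xW : (x <= W)%MS by exact: row_sub.
have sub : (Z + x <= W)%MS by rewrite addsmx_sub ZW xW.
have Wsub : (W <= Z + x)%MS.
  rewrite -(geq_leqif (mxrank_leqif_sup sub)); apply: leq_trans rk _.
  have lt : (\rank Z < \rank (Z + x)%MS)%N.
    rewrite ltnNge (geq_leqif (mxrank_leqif_sup (addsmxSl Z x))) addsmx_sub submx_refl.
    exact: xZ.
  by rewrite addn1.
move=> u v /submx_trans/(_ Wsub)/sub_addsmxP[[a b] /= ->] vW.
rewrite mulmxDl dotDl oZ ?submxMl // add0r.
rewrite [b]mx11_scalar mul_scalar_mx -scalemxAl dotZl.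
move: vW => /submx_trans/(_ Wsub)/sub_addsmxP[[c d] /= ->].
rewrite dotDr (dot_sym _ _ sM) oZ ?submxMl // add0r.
by rewrite [d]mx11_scalar mul_scalar_mx dotZr iso ?mulr0.
Qed.

(** W1 + W2 is orthogonal to W3, so it has dimension at most n - s, while each Wi has dimension at
    least n - s - 1. If W1 is not inside W2, their intersection has codimension at most one in each,
    so W1, W2 and their sum are totally isotropic; the sum is then too large. *)
Lemma orth_triple s m1 m2 m3 (W1 : 'M[K]_(m1, n)) (W2 : 'M_(m2, n)) (W3 : 'M_(m3, n)) :
  (\rank M0 <= 2 * s + 1)%N ->
  (kermx M0 <= W1)%MS -> (kermx M0 <= W2)%MS ->
  W1 *m M0 *m W2^T = 0 -> W1 *m M0 *m W3^T = 0 -> W2 *m M0 *m W3^T = 0 ->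
  (forall w, (w <= W1)%MS -> dot (w *m M0) w = 0) -> (forall w, (w <= W2)%MS -> dot (w *m M0) w = 0) ->
  (s + (n - \rank M0) <= \rank W1)%N -> (s + (n - \rank M0) <= \rank W2)%N ->
  (s + (n - \rank M0) <= \rank W3)%N -> (W1 <= W2)%MS.
Proof.
move=> rM N1 N2 o12 o13 o23 i1 i2 r1 r2 r3; apply: contraT => n12.
have rn := rank_leq_row M0.
set X := (W1 + W2)%MS.
have rX2 : (\rank W2 < \rank X)%N.
  by rewrite ltnNge (geq_leqif (mxrank_leqif_sup (addsmxSr W1 W2))) addsmx_sub submx_refl andbT.
have oX3 : X *m M0 *m W3^T = 0.
  apply/orthE=> u v /sub_addsmxP[[a b] /= ->] vW.
  rewrite mulmxDl dotDl; move/orthE: o13 => ->; rewrite ?submxMl //.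
  by move/orthE: o23 => ->; rewrite ?submxMl // addr0.
have NX : (kermx M0 <= X)%MS by apply: submx_trans N1 _; exact: addsmxSl.
have rX3 := orth_rank NX oX3.
have rZ := mxrank_sum_cap W1 W2; rewrite -/X in rZ.
have o21 : W2 *m M0 *m W1^T = 0.
  by apply/orthE=> u v uW vW; rewrite (dot_sym _ _ sM); move/orthE: o12; apply.
have o11 : W1 *m M0 *m W1^T = 0.
  apply: (@isotropic_orth _ _ W1 (W1 :&: W2)%MS i1 (capmxSl _ _)); last by lia.
  apply/orthE=> u v /submx_trans/(_ (capmxSr _ _)) uW vW; by move/orthE: o21; apply.
have o22 : W2 *m M0 *m W2^T = 0.
  apply: (@isotropic_orth _ _ W2 (W1 :&: W2)%MS i2 (capmxSr _ _)); last by lia.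
  apply/orthE=> u v /submx_trans/(_ (capmxSl _ _)) uW vW; by move/orthE: o12; apply.
have oXX : X *m M0 *m X^T = 0.
  apply/orthE=> u v /sub_addsmxP[[a b] /= ->] /sub_addsmxP[[c d] /= ->].
  rewrite mulmxDl !dotE.
  move/orthE: o11 => ->; rewrite ?submxMl // add0r.
  move/orthE: o12 => ->; rewrite ?submxMl //.
  move/orthE: o21 => ->; rewrite ?submxMl //.
  by move/orthE: o22 => ->; rewrite ?submxMl // !addr0.
have := orth_rank NX oXX; lia.
Qed.
End Fixed.
End Triple.

(** * Second factors of the elements of S_l as l varies *)

Section Linking.
Variable K : fieldType.
Variables (n : nat) (S : {vspace 'M[K]_n}) (M0 : 'M[K]_n).
Hypothesis hK : exists x : K, x != 0 /\ x != 1.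
Hypothesis sS : symsp S.
Hypothesis M0S : M0 \in S.
(** This and [prod_le] are all that is used of the choice of M0, so that maximal rank and maximal
    rank among the nonalternating elements are treated together. *)
Hypothesis two_t : forall Q, Q \in S -> exists t1 t2, [/\ t1 != 0, t2 != 0, t1 != t2,
  (\rank (M0 + t1 *: Q)%R <= \rank M0)%N & (\rank (M0 + t2 *: Q)%R <= \rank M0)%N].
Hypothesis prod_le : forall l m l' m', prodf l m \in S -> prodf l' m' \in S ->
  (\rank (M0 + prodf l' m' + prodf l m)%R <= \rank M0)%N.

Let sM : M0^T = M0 := sS M0S.

Definition offker (l : 'rV[K]_n) := exists2 x, x *m M0 = 0 & dot x l = 1.

(** The admissible w form a space W_l that contains ker M0. *)
Definition inW (l w : 'rV[K]_n) := prodf l (w *m M0) \in S.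

Lemma ker_prodf (l mu : 'rV[K]_n) : kermx l^T *m prodf l mu *m (kermx l^T)^T = 0.
Proof.
have kl : l *m (kermx l^T)^T = 0 by apply: trmx_inj; rewrite trmx_mul trmxK mulmx_ker trmx0.
by rewrite prodf_congr kl /prodf trmx0 mul0mx mulmx0 addr0.
Qed.

Lemma ker_dot x (w : 'rV[K]_n) : x *m M0 = 0 -> dot x (w *m M0) = 0.
Proof. by move=> xM; rewrite dot_mulmxr sM xM dot0l. Qed.

Lemma link_nf l Q : offker l -> Q \in S -> kermx l^T *m Q *m (kermx l^T)^T = 0 ->
  exists w, Q = prodf l (w *m M0).
Proof.
move=> [x xM xl] QS kQ; have [t1 [t2 [t10 t20 t12 r1 r2]]] := two_t QS.
have [mu [w [-> <- _ _]]] := normal_form sM (sS QS) xM xl kQ t10 t20 t12 r1 r2.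
by exists w.
Qed.

Lemma link_iso l w : offker l -> inW l w -> dot (w *m M0) w = 0.
Proof.
move=> [x xM xl] wS; have [t1 [t2 [t10 t20 t12 r1 r2]]] := two_t wS.
have [mu [w2 [e wM wmu _]]] := normal_form sM (prodf_sym _ _) xM xl (ker_prodf _ _) t10 t20 t12 r1 r2.
have : x *m prodf l (w *m M0) = x *m prodf l mu by rewrite e.
rewrite !mul_prodf xl !scale1r -wM !ker_dot // !scale0r !addr0 => ee.
by rewrite ee (dot_sym _ _ sM) ee dotC wM.
Qed.

Lemma inW_ker l x : x *m M0 = 0 -> inW l x.
Proof. by move=> xM; rewrite /inW xM /prodf trmx0 mul0mx mulmx0 addr0 rpred0. Qed.

Lemma inW_eq l w w' : w *m M0 = w' *m M0 -> inW l w -> inW l w'.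
Proof. by rewrite /inW => ->. Qed.

Lemma rank_prodf2 l w l' w' t t' : inW l w -> inW l' w' ->
  (\rank (M0 + t *: prodf l' (w' *m M0) + t' *: prodf l (w *m M0))%R <= \rank M0)%N.
Proof.
by move=> h h'; rewrite -!prodfZr; apply: prod_le; rewrite prodfZr rpredZ.
Qed.

Lemma link_norm l w : offker l -> exists w', w' *m M0 = w *m M0 /\ dot w' l = 0.
Proof.
case=> x xM xl; exists (w - dot w l *: x).
by rewrite mulmxBl -scalemxAl xM scaler0 subr0 !dotE xl mulr1 subrr.
Qed.

(** In [orth_core], a vector of ker M0 with l(z) = 1 and l'(z) = 0 kills c; the dual vector z' then
    reads off the pairing of w and w'. *)
Lemma orth_indep l l' w w' z z' :
  z *m M0 = 0 -> z' *m M0 = 0 -> dot z l = 1 -> dot z l' = 0 -> dot z' l = 0 -> dot z' l' = 1 ->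
  inW l w -> inW l' w' -> dot (w *m M0) w' = 0.
Proof.
move=> zM zM' zl zl' z'l z'l' iw iw'.
have [t0 [t00 t01]] := hK.
have ol : offker l' by exists z'.
have [w2 [e2 w2l]] := link_norm w' ol.
have iw2 : inW l' w2 by apply: inW_eq iw'.
have iso : dot w2 (w2 *m M0) = 0 by rewrite dotC (link_iso ol iw2).
have nz : dot z l - 1 * dot z l' * dot w2 l != 0 by rewrite zl zl' mulr0 mul0r subr0 oner_neq0.
have t10 : (1 : K) != t0 by rewrite eq_sym.
have [c [_ hc _]] := orth_core sM zM erefl erefl iso w2l nz (oner_neq0 _) t00 t10
  (rank_prodf2 1 1 iw iw2) (rank_prodf2 1 t0 iw iw2).
have c0 : c = 0.
  by have := hc z zM; rewrite zl zl' !(mulr0, mul0r) oppr0 addr0 mulr1 => <-.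
have := hc z' zM'; rewrite z'l' c0 mul0r !mulr1 mul1r => /eqP; rewrite oppr_eq0 => /eqP.
by move=> h; rewrite (dot_sym _ _ sM) -e2 (dot_sym _ _ sM) dotC.
Qed.

(** Here 2c = 0 gives c = 0. The parameter is 1 or -1: the two values of the expression that must
    not vanish add up to 2. *)
Lemma orth_odd l l' w w' : (2%:R : K) != 0 -> offker l -> offker l' ->
  inW l w -> inW l' w' -> dot (w *m M0) w' = 0.
Proof.
move=> c2 ol ol' iw iw'.
have [t0 [t00 t01]] := hK; have t10 : (1 : K) != t0 by rewrite eq_sym.
have [w2 [e2 w2l]] := link_norm w' ol'.
have iw2 : inW l' w2 by apply: inW_eq iw'.
have iso : dot w2 (w2 *m M0) = 0 by rewrite dotC (link_iso ol' iw2).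
have [x xM xl] := ol; have [z zM zl'] := ol'.
have [t t_n0 nz] : exists2 t : K, t != 0 & dot x l - t * dot x l' * dot w2 l != 0.
  have [e|ne] := eqVneq (dot x l - 1 * dot x l' * dot w2 l) 0; last by exists 1; rewrite ?oner_neq0.
  exists (-1); first by rewrite oppr_eq0 oner_neq0.
  rewrite xl mul1r in e; move/eqP: e; rewrite subr_eq0 => /eqP e.
  by rewrite xl !mulNr mul1r -e opprK -[1 + 1]/2%:R.
have [c [hc1 hc _]] := orth_core sM xM erefl erefl iso w2l nz (oner_neq0 _) t00 t10
  (rank_prodf2 t 1 iw iw2) (rank_prodf2 t t0 iw iw2).
have c0 : c = 0 by move/eqP: hc1; rewrite mulf_eq0 (negPf c2) => /eqP.
have := hc z zM; rewrite zl' c0 mul0r mulr1 => /eqP.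
rewrite oppr_eq0 mulf_eq0 (negPf t_n0) /= => /eqP h.
by rewrite (dot_sym _ _ sM) -e2 (dot_sym _ _ sM) dotC.
Qed.

(** [l] and [l'] agree on ker M0, and [orth_core] yields an isotropic vector congruent to w + c d
    modulo ker M0. By additivity of the quadratic form, c^2 times its value at d is zero. *)
Lemma orth_char2 l l' d w w' : (2%:R : K) = 0 -> offker l -> l' = l + d *m M0 -> dot (d *m M0) d != 0 ->
  inW l w -> inW l' w' -> dot (w *m M0) w' = 0.
Proof.
move=> c2 ol l'E dd iw iw'.
have [t0 [t00 t01]] := hK; have t10 : (1 : K) != t0 by rewrite eq_sym.
have [x xM xl] := ol.
have xl' : dot x l' = 1 by rewrite l'E dotDr xl ker_dot // addr0.
have ol' : offker l' by exists x.
have [w2 [e2 w2l]] := link_norm w' ol'.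
have iw2 : inW l' w2 by apply: inW_eq iw'.
have iso : dot w2 (w2 *m M0) = 0 by rewrite dotC (link_iso ol' iw2).
have [t t_n0 nz] : exists2 t : K, t != 0 & dot x l - t * dot x l' * dot w2 l != 0.
  have [e|ne] := eqVneq (dot x l - 1 * dot x l' * dot w2 l) 0; last by exists 1; rewrite ?oner_neq0.
  exists t0 => //; move: e; rewrite xl xl' !mulr1 mul1r => /eqP; rewrite subr_eq0 => /eqP <-.
  by rewrite mulr1 subr_eq0.
have [c [_ hc [v [vM vv]]]] := orth_core sM xM erefl erefl iso w2l nz (oner_neq0 _) t00 t10
  (rank_prodf2 t 1 iw iw2) (rank_prodf2 t t0 iw iw2).
set sg := t * dot w2 (w *m M0 - c *: l) in vM vv.
have sE : sg = - c.
  have := ker_dot v xM; rewrite vM !dotE (ker_dot w xM) xl xl' !mulr1 sub0r => /eqP.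
  by rewrite subr_eq0 => /eqP <-.
have e : v *m M0 = (w + c *: d) *m M0.
  rewrite vM sE l'E mulmxDl -scalemxAl; apply/rowP=> i; rewrite !mxE; ring.
have c0 : c = 0.
  have : dot ((w + c *: d) *m M0) (w + c *: d) = 0 by rewrite -[_ *m M0]e (dot_sym _ _ sM) -e dotC vM.
  rewrite mulmxDl -scalemxAl !dotE (link_iso ol iw) (dot_sym d w sM) => h.
  have : c * c * dot (d *m M0) d = 0.
    transitivity (0 + c * dot (w *m M0) d + (c * dot (w *m M0) d + c * (c * dot (d *m M0) d))
      - 2%:R * (c * dot (w *m M0) d)); first by ring.
    by rewrite c2 mul0r subr0 -[RHS]h; ring.
  by move/eqP; rewrite !mulf_eq0 (negPf dd) orbF orbb => /eqP.
have := hc x xM; rewrite xl' c0 mul0r mulr1 => /eqP.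
rewrite oppr_eq0 mulf_eq0 (negPf t_n0) /= => /eqP h.
by rewrite (dot_sym _ _ sM) -e2 (dot_sym _ _ sM) dotC.
Qed.

Lemma rank_le_dim m (V : {vspace 'rV[K]_m}) m1 (A : 'M[K]_(m1, m)) :
  (forall u : 'rV_m, (u <= A)%MS -> u \in V) -> (\rank A <= \dim V)%N.
Proof.
move=> AV; have [B [fB eB]] := vs_mx V.
have : (A <= B)%MS by apply/row_subP=> i; rewrite eB AV // row_sub.
by move/mxrankS; rewrite (eqP fB).
Qed.

(** By the normal form the image of W_l under w -> [l (w M0)] covers S_l, and the kernel contains
    ker M0. *)
Lemma W_mx l : offker l -> exists k (A : 'M[K]_(k, n)), (forall w, (w <= A)%MS <-> inW l w) /\
  (\dim (Sl S (kermx l^T)) + (n - \rank M0) <= \rank A)%N.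
Proof.
move=> ol.
pose f : 'Hom('rV[K]_n, 'M[K]_n) := ((linfun (@mulmx K n 1 n l^T) + (linfun (@mulmxr K n 1 n l) \o linfun (@trmx K 1 n)))
   \o linfun (mulmxr M0))%VF.
have fE w : f w = prodf l (w *m M0) by rewrite comp_lfunE add_lfunE comp_lfunE !lfunE.
pose W := (f @^-1: S)%VS.
have WE w : w \in W <-> inW l w by rewrite -memv_preim fE.
have [A [fA eA]] := vs_mx W.
exists (\dim W), A; split=> [w|]; first by rewrite eA.
rewrite (eqP fA) -(limg_ker_dim f W) addnC leq_add //.
  rewrite -mxrank_ker; apply: rank_le_dim => u /sub_kermxP uM.
  by rewrite memv_cap memv_ker fE uM /prodf trmx0 mul0mx mulmx0 addr0 eqxx andbT; apply/WE/inW_ker.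
apply/dimvS/subvP=> Q; rewrite mem_Sl => /andP[QS /eqP kQ].
have [w QE] := link_nf ol QS kQ.
by rewrite QE -fE memv_img //; apply/WE; rewrite /inW -QE.
Qed.

Definition orthW l l' := forall w w', inW l w -> inW l' w' -> dot (w *m M0) w' = 0.
Definition sameW l l' := forall w, inW l w <-> inW l' w.

Lemma orthWC l l' : orthW l l' -> orthW l' l.
Proof. by move=> h w w' iw iw'; rewrite (dot_sym _ _ sM); apply: h. Qed.

Lemma sameWC l l' : sameW l l' -> sameW l' l.
Proof. by move=> h w; split=> /h. Qed.

Lemma sameW_trans l l' l2 : sameW l l' -> sameW l' l2 -> sameW l l2.
Proof. by move=> h h' w; split=> [/h/h'|/h'/h]. Qed.

Section Big.
Variable s : nat.
Hypothesis rM : (\rank M0 <= 2 * s + 1)%N.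
Hypothesis big : forall l, offker l -> (s <= \dim (Sl S (kermx l^T)))%N.

Lemma tri_sub l1 l2 l3 : offker l1 -> offker l2 -> offker l3 -> orthW l1 l2 -> orthW l1 l3 -> orthW l2 l3 ->
  forall w, inW l1 w -> inW l2 w.
Proof.
move=> o1 o2 o3 h12 h13 h23.
have [k1 [A1 [e1 r1]]] := W_mx o1; have [k2 [A2 [e2 r2]]] := W_mx o2; have [k3 [A3 [e3 r3]]] := W_mx o3.
have b1 := big o1; have b2 := big o2; have b3 := big o3.
have NA l k (A : 'M_(k, n)) : (forall w, (w <= A)%MS <-> inW l w) -> (kermx M0 <= A)%MS.
  move=> e; apply/row_subP=> i; apply/e/inW_ker.
  by apply/sub_kermxP; exact: row_sub.
have sub : (A1 <= A2)%MS.
  apply: (orth_triple sM rM (NA _ _ _ e1) (NA _ _ _ e2) (W3 := A3)); try lia.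
  - by apply/orthE=> u v /e1 iu /e2 iv; exact: h12.
  - by apply/orthE=> u v /e1 iu /e3 iv; exact: h13.
  - by apply/orthE=> u v /e2 iu /e3 iv; exact: h23.
  - by move=> w /e1; exact: link_iso.
  - by move=> w /e2; exact: link_iso.
by move=> w /e1 wA; apply/e2; apply: submx_trans wA sub.
Qed.

Lemma tri_same l1 l2 l3 : offker l1 -> offker l2 -> offker l3 -> orthW l1 l2 -> orthW l1 l3 -> orthW l2 l3 ->
  sameW l1 l2.
Proof.
move=> o1 o2 o3 h12 h13 h23 w; split; first exact: (tri_sub o1 o2 o3).
by apply: (tri_sub o2 o1 o3) => //; exact: orthWC.
Qed.

Definition ind l l' := exists z z', [/\ z *m M0 = 0, z' *m M0 = 0 & [/\ dot z l = 1, dot z l' = 0,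
  dot z' l = 0 & dot z' l' = 1]].

Lemma ind_orth l l' : ind l l' -> orthW l l'.
Proof. by case=> z [z' [zM zM' [h1 h2 h3 h4]]] w w'; exact: (orth_indep zM zM'). Qed.

Lemma ind_offker l l' : ind l l' -> offker l /\ offker l'.
Proof. by case=> z [z' [zM zM' [h1 h2 h3 h4]]]; split; [exists z|exists z']. Qed.

(** Supplies the third form required by [tri_same]. *)
Lemma ind_add l l' : ind l l' -> ind l (l + l') /\ ind l' (l + l').
Proof.
case=> z [z' [zM zM' [h1 h2 h3 h4]]]; split.
  exists (z - z'), z'; rewrite mulmxBl zM zM' subr0 !dotE h1 h2 h3 h4; split=> //.
  by split; ring.
exists (z' - z), z; rewrite mulmxBl zM zM' subr0 !dotE h1 h2 h3 h4; split=> //.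
by split; ring.
Qed.

Lemma ind_same l l' : ind l l' -> sameW l l'.
Proof.
move=> h; have [o1 o2] := ind_offker h; have [h1 h2] := ind_add h.
have [_ o3] := ind_offker h1.
by apply: (tri_same o1 o2 o3); exact: ind_orth.
Qed.

Lemma ind_partner l z1 z2 : z1 *m M0 = 0 -> z2 *m M0 = 0 -> dot z1 l = 1 -> dot z2 l = 0 -> z2 != 0 ->
  exists2 l2, ind l l2 & dot z1 l2 = 0 /\ dot z2 l2 = 1.
Proof.
move=> zM1 zM2 z1l z2l z20.
have n12 : ~~ (z2 <= z1)%MS.
  apply/negP=> /sub_rVP[a e]; move: z2l; rewrite e dotZl z1l mulr1 => a0.
  by move: z20; rewrite e a0 scale0r eqxx.
have [l2 h1 h2] := sep2 n12; rewrite dotC in h1; rewrite dotC in h2.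
by exists l2 => //; exists z1, z2.
Qed.

(** With dim ker M0 at least two, forms that are proportional on ker M0 are compared through a
    partner independent of both there. *)
Lemma link_all_indep (z1 z2 : 'rV[K]_n) : z1 *m M0 = 0 -> z2 *m M0 = 0 -> z1 != 0 -> ~~ (z2 <= z1)%MS ->
  forall l l', offker l -> offker l' -> sameW l l' /\ orthW l l'.
Proof.
move=> zM1 zM2 z10 n12.
have two l : offker l -> exists x y, [/\ x *m M0 = 0, y *m M0 = 0, dot x l = 1, dot y l = 0 & y != 0].
  case=> x xM xl.
  have [y yM nyx] : exists2 y : 'rV_n, y *m M0 = 0 & ~~ (y <= x)%MS.
    have [h1|] := boolP (z1 <= x)%MS; last by exists z1.
    have [h2|] := boolP (z2 <= x)%MS; last by exists z2.
    case/negP: n12; case/sub_rVP: h1 z10 => a ->; case/sub_rVP: h2 => b -> ax.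
    have a0 : a != 0 by apply: contraNneq ax => ->; rewrite scale0r.
    by apply/sub_rVP; exists (b / a); rewrite scalerA divfK.
  exists x, (y - dot y l *: x); split=> //.
  - by rewrite mulmxBl -scalemxAl xM yM scaler0 subr0.
  - by rewrite !dotE xl mulr1 subrr.
  apply: contraNneq nyx => /eqP; rewrite subr_eq0 => /eqP ->.
  by rewrite scalemx_sub.
have same l l' : offker l -> offker l' -> exists2 l2, ind l2 l' & sameW l l2.
  move=> ol ol'; have [x [y [xM yM xl yl y0]]] := two _ ol.
  have [[z zM [zl zl']]|no] := classic (exists2 z : 'rV_n, z *m M0 = 0 & dot z l = 0 /\ dot z l' != 0).
    have h : ind l l'.
      exists (x - (dot x l' / dot z l') *: z), ((dot z l')^-1 *: z).
      rewrite mulmxBl -!scalemxAl xM zM !scaler0 subr0 !dotE zl xl divfK // mulVf // subrr.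
      by split=> //; split=> //; ring.
    by exists l => // w.
  have [l2 h [xl2 yl2]] := ind_partner xM yM xl yl y0.
  have kill z : z *m M0 = 0 -> dot z l = 0 -> dot z l' = 0.
    by move=> zM zl; apply/eqP; apply: contraT => h'; case: no; exists z.
  have yl' := kill _ yM yl.
  have xl' : dot x l' != 0.
    case: ol' => z zM zl'; have := kill (z - dot z l *: x).
    rewrite mulmxBl -scalemxAl xM zM scaler0 subr0 !dotE xl mulr1 subrr => /(_ erefl erefl) e.
    apply: contraTneq (oner_neq0 K) => x0; rewrite negbK -zl'.
    by move/eqP: e; rewrite x0 mulr0 subr0.
  exists l2; last exact: ind_same.
  exists y, ((dot x l')^-1 *: x); rewrite -scalemxAl xM scaler0 !dotE xl2 yl2 yl' mulr0 mulVf //.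
move=> l l' ol ol'; have [l2 h1 h2] := same l l' ol ol'.
split; first exact: sameW_trans h2 (ind_same h1).
by move=> w w' /h2 iw iw'; apply: ind_orth iw iw'.
Qed.

Lemma sameW_scale l a : a != 0 -> sameW l (a *: l).
Proof.
move=> a0 w; rewrite /inW prodfZl; split=> h; first exact: rpredZ.
by rewrite -[prodf _ _](scalerK a0) rpredZ.
Qed.

(** With ker M0 a line, normalised forms differ by some e M0. For anisotropic e the three forms are
    l, l + e M0 and l + t0 e M0; for isotropic e one passes through l + d M0, since e - d is then
    anisotropic by additivity. *)
Lemma link_all_char2 (d x : 'rV[K]_n) : (2%:R : K) = 0 -> dot (d *m M0) d != 0 -> x *m M0 = 0 ->
  (forall z : 'rV_n, z *m M0 = 0 -> (z <= x)%MS) ->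
  forall l l', offker l -> offker l' -> sameW l l' /\ orthW l l'.
Proof.
move=> c2 dd xM Nx; have [t0 [t00 t01]] := hK.
have ofx l e : dot x l = 1 -> dot x (l + e *m M0) = 1 by rewrite dotDr ker_dot // addr0.
have one l e : dot x l = 1 -> dot (e *m M0) e != 0 -> sameW l (l + e *m M0).
  move=> xl ee.
  have xl1 := ofx l e xl; have xl2 := ofx l (t0 *: e) xl.
  apply: (@tri_same l (l + e *m M0) (l + (t0 *: e) *m M0)); [by exists x|by exists x|by exists x| | |].
  - by move=> w w'; apply: (orth_char2 c2) ee => //; exists x.
  - move=> w w'; apply: (orth_char2 c2 (d := t0 *: e)) => //; first by exists x.
    by rewrite -scalemxAl !dotE !mulf_neq0.
  - move=> w w'; apply: (orth_char2 c2 (d := (t0 - 1) *: e)) => //; first by exists x.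
      by rewrite scalerBl scale1r mulmxBl -addrA [e *m M0 + _]addrC subrK.
    by rewrite -scalemxAl !dotE !mulf_neq0 // subr_eq0.
have same1 l l' : dot x l = 1 -> dot x l' = 1 -> sameW l l'.
  move=> xl xl'.
  have [e eE] : exists e, l' = l + e *m M0.
    have /submxP[e eE] : ((l' - l)%R <= M0)%MS.
      apply: contraT => /sep[a]; rewrite sM => aM; case/Nx/sub_rVP: (aM) => b ->.
      by rewrite dotZl dotBr xl xl' subrr mulr0 => /eqP; rewrite eq_sym oner_eq0.
    by exists e; rewrite -eE addrC subrK.
  have [e0|ne] := eqVneq (dot (e *m M0) e) 0; last by rewrite eE; exact: one.
  have -> : l' = (l + d *m M0) + (e - d) *m M0 by rewrite eE mulmxBl -addrA [d *m M0 + _]addrC subrK.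
  apply: sameW_trans (one l d xl dd) (one _ _ (ofx _ _ xl) _).
  have -> : dot ((e - d) *m M0) (e - d) =
      dot (e *m M0) e + dot (d *m M0) d - 2%:R * dot (e *m M0) d.
    by rewrite mulmxBl !dotE (dot_sym d e sM); ring.
  by rewrite e0 add0r c2 mul0r subr0.
have nrm l : offker l -> dot x l != 0.
  case=> z zM; case/Nx/sub_rVP: (zM) => a ->; rewrite dotZl => h.
  by apply: contra_eq_neq h => ->; rewrite mulr0 eq_sym oner_eq0.
have same l l' : offker l -> offker l' -> sameW l l'.
  move=> /nrm xl /nrm xl'.
  have i0 : (dot x l)^-1 != 0 by rewrite invr_eq0.
  have i1 : (dot x l')^-1 != 0 by rewrite invr_eq0.
  apply: sameW_trans (sameW_scale l i0) (sameW_trans (same1 _ _ _ _) (sameWC (sameW_scale l' i1))).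
  - by rewrite dotZr mulVf.
  - by rewrite dotZr mulVf.
move=> l l' ol ol'; split; first exact: same.
have xl := nrm _ ol; set l1 := (dot x l)^-1 *: l.
have xl1 : dot x l1 = 1 by rewrite dotZr mulVf.
have o1 : offker l1 by exists x.
have o2 : offker (l1 + d *m M0) by exists x => //; exact: ofx.
move=> w w' /(same _ _ ol o1) iw /(same _ _ ol' o2) iw'.
by apply: (orth_char2 c2 o1 erefl dd iw iw').
Qed.

Lemma link_all l0 : offker l0 ->
  [\/ (2%:R : K) != 0, ((\rank M0).+2 <= n)%N | exists d, dot (d *m M0) d != 0] ->
  forall l l', offker l -> offker l' -> sameW l l' /\ orthW l l'.
Proof.
move=> [x xM xl0] cases.
have [c2|c2] := eqVneq (2%:R : K) 0; last first.
  have o l l' : offker l -> offker l' -> orthW l l' by move=> ol ol' w w'; exact: orth_odd.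
  move=> l l' ol ol'; split; last exact: o.
  by apply: (tri_same ol ol' ol); exact: o.
have x0 : x != 0 by apply: contra_eq_neq xl0 => ->; rewrite dot0l eq_sym oner_eq0.
have rk := mxrank_ker M0.
have [r2|r2] := leqP (\rank M0).+2 n.
  have [z1 [z2 [/sub_kermxP z1M /sub_kermxP z2M z10 n12]]] := @ex_indep K n (kermx M0) ltac:(lia).
  exact: link_all_indep z1M z2M z10 n12.
have xN : (x <= kermx M0)%MS by apply/sub_kermxP.
have Nx (z : 'rV_n) : z *m M0 = 0 -> (z <= x)%MS.
  move=> /sub_kermxP/submx_trans; apply.
  by rewrite -(geq_leqif (mxrank_leqif_sup xN)) rk rank_rV x0; lia.
case: cases => [h|h|[d dd]]; [by rewrite c2 eqxx in h | by lia | exact: link_all_char2 c2 dd xM Nx].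
Qed.

(** The common space W is totally isotropic, which makes the dimension of W M0 exactly s. A form nu
    vanishing on ker M0 is written (nu + l0) - l0. *)
Lemma link_common l0 : offker l0 ->
  [\/ (2%:R : K) != 0, ((\rank M0).+2 <= n)%N | exists d, dot (d *m M0) d != 0] ->
  exists2 U : 'M[K]_(s, n), row_free U & forall nu u, (u <= U)%MS -> prodf nu u \in S.
Proof.
move=> ol0 cases; have all := link_all ol0 cases.
have [k [A [eA rA]]] := W_mx ol0; have b0 := big ol0.
have NA : (kermx M0 <= A)%MS.
  by apply/row_subP=> i; apply/eA/inW_ker; apply/sub_kermxP; exact: row_sub.
have oAA : A *m M0 *m A^T = 0.
  by apply/orthE=> u v /eA iu /eA iv; have [_ h] := all _ _ ol0 ol0; apply: h.
have h1 := orth_rank NA oAA; have h2 := mxrank_mul_ker A M0.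
have h3 : \rank (A :&: kermx M0)%MS = (n - \rank M0)%N.
  by rewrite (capmx_idPr NA) mxrank_ker.
have rn := rank_leq_row M0.
have [U fU eU] := @ex_basis K _ _ (A *m M0) s ltac:(lia).
exists U => // nu u; rewrite eU => /submxP[c ->]; rewrite mulmxA.
have ic l : offker l -> inW l (c *m A).
  move=> ol; have [h _] := all _ _ ol0 ol; apply/h/eA; exact: submxMl.
have [/ic //|no] := classic (offker nu).
case: (ol0) => x xM xl.
have -> : nu = (nu + l0) - l0 by rewrite addrK.
rewrite prodfDl -scaleN1r prodfZl; apply: rpredD; last by apply: rpredZ; exact: ic.
apply: ic; exists x => //; rewrite dotDr xl.
suff -> : dot x nu = 0 by rewrite add0r.
apply: NNPP => /eqP h; apply: no; exists ((dot x nu)^-1 *: x).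
  by rewrite -scalemxAl xM scaler0.
by rewrite dotZl mulVf.
Qed.
End Big.

End Linking.

(** * Forms with a common totally isotropic subspace *)

Section CommonFactor.
Variable K : fieldType.

Lemma prodf_rank n (l m : 'rV[K]_n) : (\rank (prodf l m) <= 2)%N.
Proof.
apply: leq_trans (mxrank_add _ _) _.
by apply: (@leq_add _ _ 1 1); apply: leq_trans (mxrankM_maxr _ _) _; rewrite rank_rV leq_b1.
Qed.

(** Compression by the projection 1 - v^T y removes a hyperbolic plane. *)
Lemma alt_split n (M : 'M[K]_n) : M^T = M -> altf M -> M != 0 ->
  exists M' : 'M[K]_n, [/\ M'^T = M', altf M' & \rank M = (\rank M' + 2)%N].
Proof.
move=> sM aM M0.
have [x v0] : exists x : 'rV_n, x *m M != 0.
  apply: NNPP => no; case/eqP: M0; apply/row_matrixP=> i; rewrite row0 rowE.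
  by apply/eqP; apply: contraT => h; case: no; exists (delta_mx 0 i).
set v := x *m M in v0.
have [y yv] := sep0 v0.
pose P : 'M_n := 1%:M - v^T *m y.
have Pv : P *m v^T = 0 by rewrite mulmxBl mul1mx -mulmxA mulmx_dot yv mulmx1 subrr.
have PE : P *m M *m P^T = M - prodf v (y *m M).
  have -> : P^T = 1%:M - y^T *m v by rewrite linearB /= trmx1 trmx_mul trmxK.
  have e1 : M *m (y^T *m v) = (y *m M)^T *m v by rewrite mulmxA trmx_mul sM.
  have e2 : v^T *m (y *m M) *m (y^T *m v) = 0 by rewrite -mulmxA mul_outer aM scale0r mulmx0.
  by rewrite mulmxBl mul1mx -mulmxA mulmxBr mulmx1 mulmxBl e1 e2 subr0 /prodf opprD addrA.
exists (P *m M *m P^T); split; [exact: sym_congr | exact: altf_congr |].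
apply/eqP; rewrite eqn_leq; apply/andP; split.
  rewrite {1}(_ : M = P *m M *m P^T + prodf v (y *m M)); last by rewrite PE subrK.
  by apply: leq_trans (mxrank_add _ _) _; rewrite leq_add2l prodf_rank.
by apply: (rank_hyper sM erefl v0 _ Pv); rewrite dotC aM.
Qed.

Lemma alt_even n (M : 'M[K]_n) : M^T = M -> altf M -> ~~ odd (\rank M).
Proof.
move e: (\rank M) => k; elim/ltn_ind: k M e => k IH M rk sM aM.
have [M0|M0] := eqVneq M 0; first by rewrite -rk M0 mxrank0.
have [M' [sM' aM' e]] := alt_split sM aM M0.
have := IH (\rank M') ltac:(lia) M' erefl sM' aM'.
by rewrite -rk e oddD addbF.
Qed.

Lemma ker_rows_scal n m (B : 'M[K]_(m, n)) (u v : 'rV_n) : (B :=: kermx u^T)%MS -> v *m B^T = 0 ->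
  exists a, v = a *: u.
Proof.
move=> eB vB; apply/sub_rVP; apply: contraT => /sep[a au av].
have : (a <= B)%MS by rewrite eB; apply/sub_kermxP.
case/submxP=> c e; move: av; rewrite e dot_mulmxl vB dot0r => /eqP.
by rewrite eq_sym oner_eq0.
Qed.

Lemma ker_decomp n m (B : 'M[K]_(m, n)) (u p : 'rV_n) : (B :=: kermx u^T)%MS -> dot p u = 1 ->
  forall z : 'rV_n, exists c, z = c *m B + dot z u *: p.
Proof.
move=> eB pu z.
have : (z - dot z u *: p <= B)%MS by rewrite eB dot_ker !dotE pu mulr1 subrr.
by case/submxP=> c e; exists c; rewrite -e subrK.
Qed.

Lemma ex_extend n m (B : 'M[K]_(m, n)) (u p : 'rV_n) : row_free B -> B *m u^T = 0 -> dot p u = 1 ->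
  forall e, exists nu : 'rV_n, nu *m B^T = e /\ dot nu p = 0.
Proof.
move=> /row_freeP[R BR] Bu pu e.
have uB : u *m B^T = 0 by apply/mulmx_tr0P.
exists (e *m R^T - dot (e *m R^T) p *: u); split.
  by rewrite mulmxBl -scalemxAl uB scaler0 subr0 -mulmxA -trmx_mul BR trmx1 mulmx1.
by rewrite !dotE (dotC u) pu mulr1 subrr.
Qed.

(** If the restriction [A] to ker mu kills some k, then k B M is a multiple of mu, and nu can be
    chosen so that kB is sent to mu itself; [rank_hyper] concludes. If [A] is nonsingular, M +
    [nu mu] is still singular, and a suitable nu forces its kernel to contain c B + p for a
    prescribed c. So the quadratic form takes at p its value at every c; c = 0 shows that this value
    is zero, [A] is alternating, and being nonsingular it forces characteristic 2. *)
Lemma rank_factor n (M : 'M[K]_n) (mu : 'rV_n) r (B : 'M_(n.-1, n)) :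
  M^T = M -> mu != 0 -> row_free B -> (B :=: kermx mu^T)%MS -> (0 < r < n)%N ->
  (forall nu, (\rank (M + prodf nu mu)%R <= r)%N) ->
  (\rank (B *m M *m B^T) + 2 <= r)%N \/
  [/\ n = r.+1, (2%:R : K) = 0, altf M & \rank (B *m M *m B^T) = n.-1].
Proof.
move=> sM mu0 fB eB /andP[r0 rn] rk.
have Bmu : B *m mu^T = 0 by apply/sub_kermxP; rewrite eB.
have muB : mu *m B^T = 0 by apply/mulmx_tr0P.
have [p pmu] := sep0 mu0.
set A := B *m M *m B^T.
have sA : A^T = A by exact: sym_congr.
have BNB nu : B *m (M + prodf nu mu) *m B^T = A.
  rewrite mulmxDr mulmxDl prodf_congr muB /prodf.
  by rewrite trmx0 mul0mx mulmx0 !addr0.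
have sN nu : (M + prodf nu mu)^T = M + prodf nu mu by rewrite linearD /= sM prodf_sym.
have [rA|rA] := ltnP (\rank A) n.-1.
  left; have [k /sub_kermxP kA k0] := @ex_nz K n.-1 (kermx A) ltac:(rewrite mxrank_ker; lia).
  have [a ha] : exists a, k *m B *m M = a *: mu.
    by apply: (ker_rows_scal eB); rewrite -!mulmxA (mulmxA B) -/A.
  have kB0 : k *m B != 0.
    by apply: contraNneq k0 => e; apply/eqP/(row_free_inj fB); rewrite e mul0mx.
  have [nu nuk] := sep0 kB0.
  have kBmu : dot (k *m B) mu = 0 by exact: (mulmx_tr0 Bmu).
  set N := M + prodf ((1 - a) *: nu) mu.
  have kN : k *m B *m N = mu.
    rewrite /N mulmxDr ha mul_prodf kBmu scale0r addr0 dotZr dotC nuk mulr1 -scalerDl.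
    by rewrite addrC subrK scale1r.
  have := @rank_hyper K n N (k *m B) mu _ B (sN _) kN mu0 kBmu Bmu.
  rewrite BNB => h; exact: leq_trans h (rk _).
right.
have rAn : \rank A = n.-1 by apply/eqP; rewrite eqn_leq rank_leq_row rA.
have nr : n = r.+1.
  have := rk 0; have := rank_congr B (M + prodf 0 mu); rewrite BNB rAn; lia.
have fA : row_free A by rewrite /row_free rAn.
have qA c : dot (p *m M) p = dot (c *m A) c.
  have [nu [nuB nup]] := ex_extend fB Bmu pmu (- (p *m M *m B^T + c *m A)).
  set N := M + prodf nu mu.
  have [z /sub_kermxP zN z0] := @ex_nz K n (kermx N) ltac:(rewrite mxrank_ker subn_gt0; exact: leq_ltn_trans (rk nu) rn).
  have [c1 zE] := ker_decomp eB pmu z.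
  have zNB : z *m M *m B^T + dot z mu *: (nu *m B^T) = 0.
    have : z *m N *m B^T = 0 by rewrite zN mul0mx.
    by rewrite /N mulmxDr mul_prodf mulmxDl mulmxDl -!scalemxAl muB scaler0 add0r.
  have e1 : c1 *m A = (dot z mu *: c) *m A.
    move: zNB; rewrite {1}zE nuB mulmxDl mulmxDl -!scalemxAl -(mulmxA c1 B M) -(mulmxA c1) -/A.
    rewrite -addrA -scalerDr opprD addNKr scalerN => /eqP; rewrite subr_eq0 => /eqP ->.
    by rewrite scalemxAl.
  have {e1} c1E : c1 = dot z mu *: c by apply: (row_free_inj fA).
  have t0 : dot z mu != 0.
    by apply: contraNneq z0 => t0; rewrite zE c1E t0 !scale0r mul0mx addr0.
  have {zE} zE : z = dot z mu *: (c *m B + p) by rewrite {1}zE c1E -scalemxAl scalerDr.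
  have : dot (z *m N) p = 0 by rewrite zN dot0l.
  have -> : dot (z *m N) p = dot z mu * (dot ((c *m B + p) *m N) p).
    by rewrite {1}zE -scalemxAl dotZl.
  move/eqP; rewrite mulf_eq0 (negPf t0) /= => /eqP.
  have cBnu : dot (c *m B) nu = - (dot c (p *m M *m B^T) + dot c (c *m A)).
    by rewrite dot_mulmxl nuB dotNr dotDr.
  have cBM : dot (c *m B *m M) p = dot c (p *m M *m B^T).
    by rewrite (dot_sym _ _ sM) dot_mulmxr dotC.
  rewrite /N mulmxDr mul_prodf !mulmxDl !dotE nup mulr0 addr0 (dotC mu) pmu mulr1 (dotC p nu) nup.
  rewrite addr0 cBnu cBM => e.
  have -> : dot (p *m M) p = (dot c (p *m M *m B^T) + dot (p *m M) p
      + - (dot c (p *m M *m B^T) + dot c (c *m A))) + dot c (c *m A) by ring.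
  by rewrite e add0r dotC.
have p0 : dot (p *m M) p = 0 by rewrite (qA 0) mul0mx dot0l.
have aA : altf A by move=> c; rewrite -qA.
have c2 : (2%:R : K) = 0.
  apply/eqP; apply: contraT => c2.
  have : A = 0.
    apply/row_matrixP=> i; rewrite rowE row0; apply: row_vec0 => w.
    have := aA (delta_mx 0 i + w); rewrite mulmxDl !dotE !aA add0r addr0.
    rewrite (dot_sym w _ sA) -mulr2n -mulr_natl => /eqP.
    by rewrite mulf_eq0 (negPf c2) => /eqP.
  move=> A0; move: rAn; rewrite A0 mxrank0; lia.
split=> // v; have [c ->] := ker_decomp eB pmu v.
have e1 : dot (c *m B *m M) (c *m B) = 0.
  by rewrite dot_mulmxr -!mulmxA (mulmxA B) -/A aA.
rewrite mulmxDl -scalemxAl !dotE p0 (dot_sym p _ sM) e1 !mulr0 addr0 add0r.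
by rewrite -mulr2n -mulr_natl c2 mul0r.
Qed.

Lemma sym_sum_mem n s (U X : 'M[K]_(s, n)) (S : {vspace 'M[K]_n}) :
  (forall nu u, (u <= U)%MS -> prodf nu u \in S) -> X^T *m U + U^T *m X \in S.
Proof.
move=> h; have -> : X^T *m U + U^T *m X = \sum_i prodf (row i X) (row i U).
  have e (Y Z : 'M[K]_(s, n)) : Y^T *m Z = \sum_i (row i Y)^T *m row i Z.
    apply/matrixP=> a b; rewrite summxE !mxE; apply: eq_bigr => i _.
    by rewrite !mxE big_ord1 !mxE.
  by rewrite !e -big_split.
by apply: rpred_sum => i _; apply: h; exact: row_sub.
Qed.

Lemma altf_sum n s (U X : 'M[K]_(s, n)) : (2%:R : K) = 0 -> altf (X^T *m U + U^T *m X).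
Proof.
move=> c2 v; rewrite mulmxDr dotDl !mulmxA (dot_mulmxl (v *m X^T)) (dot_mulmxl (v *m U^T)).
by rewrite (dotC (v *m U^T)) addrr2.
Qed.

(* Peeling off one common factor [u] at a time: restricting to [ker u] costs two in rank. *)
Lemma rank_common n s e (M : 'M[K]_n) (U : 'M[K]_(s, n)) : row_free U -> M^T = M ->
  (forall X, (\rank (M + (X^T *m U + U^T *m X))%R <= 2 * s + e)%N) -> (2 * s + e < n)%N ->
  (forall m (F : 'M_(m, n)), F *m U^T = 0 -> (\rank (F *m M *m F^T) <= e)%N) \/
  [/\ n = (2 * s + e).+1, (2%:R : K) = 0, altf M & ~~ odd e].
Proof.
elim: s n M U => [|s IH] n M U fU sM rk ns.
  left=> m F FU; apply: leq_trans (rank_congr _ _) _.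
  by have := rk 0; rewrite trmx0 mul0mx mulmx0 !addr0.
move: U fU rk; rewrite -[s.+1]/(1 + s)%N => U fU rk.
rewrite -(vsubmxK U) in fU rk *; move: (usubmx U) (dsubmx U) fU rk => u U2 {U} fU rk.
have u0 : u != 0.
  apply: contraTneq fU => ->; rewrite /row_free neq_ltn; apply/orP; left.
  by rewrite rank_col_0mx; have := rank_leq_row U2; lia.
have [B fB eB] := ex_kerbasis u0.
have Bu : B *m u^T = 0 by apply/sub_kermxP; rewrite eB.
have [R BR] := row_freeP fB.
pose M1 X := M + (X^T *m U2 + U2^T *m X).
have sM1 X : (M1 X)^T = M1 X.
  by rewrite /M1 2!linearD /= sM !trmx_mul !trmxK (addrC (U2^T *m X)).
have rk1 X nu : (\rank (M1 X + prodf nu u)%R <= 2 * (1 + s) + e)%N.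
  have := rk (col_mx nu X); rewrite !tr_col_mx !mul_row_col.
  suff -> : M + (nu^T *m u + X^T *m U2 + (u^T *m nu + U2^T *m X)) = M1 X + prodf nu u by [].
  by rewrite /M1 /prodf -[RHS]addrA; congr (_ + _); rewrite addrACA addrC.
(* The exceptional alternative of [rank_factor] for a single [X] already settles the claim: the
   terms added to [M] are alternating in characteristic 2. *)
have [[X ex]|no] := classic (exists X, ~ (\rank (B *m M1 X *m B^T) + 2 <= 2 * (1 + s) + e)%N).
  right; have [|[nE c2 aM1 rB]] := rank_factor (sM1 X) u0 fB eB (r := 2 * (1 + s) + e) ltac:(lia) (rk1 X).
    by [].
  split=> //.
    rewrite (_ : M = M1 X - (X^T *m U2 + U2^T *m X)); last by rewrite /M1 addrK.
    by apply: altfB => //; exact: altf_sum.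
  have := alt_even (sym_congr B (sM1 X)) (altf_congr B aM1); rewrite rB; lia.
have rB X : (\rank (B *m M1 X *m B^T) + 2 <= 2 * (1 + s) + e)%N.
  by apply: NNPP => h; apply: no; exists X.
have fU2 : row_free (U2 *m B^T).
  apply: inj_row_free => v; rewrite mulmxA => /(ker_rows_scal eB)[a ha].
  have := row_free_inj fU; move=> /(_ _ (row_mx (- a%:M) v) 0).
  rewrite mul_row_col mul0mx mulNmx mul_scalar_mx ha addNr => /(_ erefl).
  by rewrite -row_mx0 => /eq_row_mx[].
left=> m F FU.
move: FU; rewrite tr_col_mx mul_mx_row -row_mx0 => /eq_row_mx[Fu FU2].
have /submxP[F' FE] : (F <= B)%MS by rewrite eB; apply/sub_kermxP.
have [||h|[h _ _ _]] := IH n.-1 (B *m M *m B^T) (U2 *m B^T) fU2 (sym_congr B sM).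
- move=> X; have := rB (X *m R^T).
  suff -> : B *m M1 (X *m R^T) *m B^T = B *m M *m B^T + (X^T *m (U2 *m B^T) + (U2 *m B^T)^T *m X).
    by move: (\rank _) => k; lia.
  have XB : X *m R^T *m B^T = X by rewrite -mulmxA -trmx_mul BR trmx1 mulmx1.
  have BX : B *m (X *m R^T)^T = X^T by rewrite trmx_mul trmxK mulmxA BR mul1mx.
  rewrite /M1 !mulmxDr !mulmxDl; congr (_ + (_ + _)).
    by rewrite !mulmxA BX.
  by rewrite trmx_mul trmxK -!mulmxA (mulmxA X) XB.
- lia.
- have hF : F' *m (U2 *m B^T)^T = 0 by rewrite trmx_mul trmxK mulmxA -FE.
  by have := h m F' hF; rewrite FE [(F' *m B)^T]trmx_mul !mulmxA.
- lia.
Qed.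

End CommonFactor.

(** * Either a large nearly isotropic subspace or a form with small S_l *)

Section Dichotomy.
Variable K : fieldType.

Definition has_rad n k (S : {vspace 'M[K]_n}) :=
  exists2 R : 'M[K]_n, (k <= \rank R)%N & forall M, M \in S -> R *m M = 0.

Definition near_iso n k e (S : {vspace 'M[K]_n}) :=
  exists2 F : 'M[K]_n, (k <= \rank F)%N & forall M, M \in S -> (\rank (F *m M *m F^T) <= e)%N.

Lemma ex_max_rank n (P : 'M[K]_n -> Prop) : (exists M, P M) ->
  exists2 M, P M & forall M', P M' -> (\rank M' <= \rank M)%N.
Proof.
case=> M PM; move e: (n - \rank M)%N => k.
elim/ltn_ind: k M PM e => k IH M PM e.
have [[M' [PM' lt]]|no] := classic (exists M', P M' /\ (\rank M < \rank M')%N).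
  by apply: (IH (n - \rank M')%N _ M' PM') => //; have := rank_leq_row M'; lia.
by exists M => // M' PM'; rewrite leqNgt; apply/negP=> lt; apply: no; exists M'.
Qed.

(** [N] stands for ker M0, the only trace of M0 that the induction keeps. *)
Definition linked n (S : {vspace 'M[K]_n}) (N : 'M[K]_n) := forall l : 'rV_n, N *m l^T != 0 ->
  forall Q, Q \in Sl S (kermx l^T) -> exists2 mu : 'rV_n, N *m mu^T = 0 & Q = prodf l mu.

Lemma ker_offker n (M0 : 'M[K]_n) l : offker M0 l <-> kermx M0 *m l^T != 0.
Proof.
split=> [[x /sub_kermxP/submxP[c ->] cl]|h].
  apply: contra_eq_neq cl => h; rewrite /dot -mulmxA h mulmx0 mxE eq_sym; exact: oner_neq0.
have [i hi] : exists i, dot (row i (kermx M0)) l != 0.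
  apply: NNPP => no; case/eqP: h; apply/row_matrixP=> i; rewrite row_mul row0 mulmx_dot.
  case: (eqVneq (dot (row i (kermx M0)) l) 0) => [->|hi]; first by rewrite raddf0.
  by case: no; exists i.
exists ((dot (row i (kermx M0)) l)^-1 *: row i (kermx M0)); last by rewrite dotZl mulVf.
by rewrite -scalemxAl -row_mul mulmx_ker row0 scaler0.
Qed.

Lemma link_core (hK : exists x : K, x != 0 /\ x != 1) n r s e (S : {vspace 'M[K]_n}) M0 :
  symsp S -> urk_le S r -> r = (2 * s + e)%N -> (e <= 1)%N -> (r < n)%N ->
  M0 \in S ->
  (forall Q, Q \in S -> exists t1 t2 : K, [/\ t1 != 0, t2 != 0, t1 != t2,
     (\rank (M0 + t1 *: Q)%R <= \rank M0)%N & (\rank (M0 + t2 *: Q)%R <= \rank M0)%N]) ->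
  (forall l m l' m', prodf l m \in S -> prodf l' m' \in S ->
     (\rank (M0 + prodf l' m' + prodf l m)%R <= \rank M0)%N) ->
  [\/ (2%:R : K) != 0, ((\rank M0).+2 <= n)%N | exists d, dot (d *m M0) d != 0] ->
  (n = r.+1 -> (2%:R : K) = 0 -> ~~ odd e -> exists2 M, M \in S & ~ altf M) ->
  near_iso (n - s) e S \/
  exists N, [/\ (n - r <= \rank N)%N, linked S N &
    exists2 l : 'rV_n, N *m l^T != 0 & (\dim (Sl S (kermx l^T)) < s)%N].
Proof.
move=> sS urk rE e1 rn M0S two prods cases nalt.
have rM0 := urk _ M0S.
have [[l ol cl]|no] := classic (exists2 l : 'rV_n, offker M0 l & (\dim (Sl S (kermx l^T)) < s)%N).
  right; exists (kermx M0); split.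
  - by rewrite mxrank_ker leq_sub2l.
  - move=> l' /ker_offker ol' Q; rewrite mem_Sl => /andP[QS /eqP kQ].
    have [w ->] := link_nf sS M0S two ol' QS kQ; exists (w *m M0) => //.
    by rewrite trmx_mul (sS _ M0S) mulmxA mulmx_ker mul0mx.
  - by exists l => //; apply/ker_offker.
left.
have [x /sub_kermxP xM x0] := @ex_nz K n (kermx M0) ltac:(rewrite mxrank_ker; lia).
have [l0 xl0] := sep0 x0; rewrite dotC in xl0.
have ol0 : offker M0 l0 by exists x.
have big l : offker M0 l -> (s <= \dim (Sl S (kermx l^T)))%N.
  by move=> ol; rewrite leqNgt; apply/negP=> h; apply: no; exists l.
have [U fU US] := @link_common K n S M0 hK sS M0S two prods s ltac:(lia) big l0 ol0 cases.
exists (kermx U^T); first by rewrite mxrank_ker mxrank_tr (eqP fU).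
have rc M : M \in S -> (\rank (kermx U^T *m M *m (kermx U^T)^T) <= e)%N \/
    [/\ n = (2 * s + e).+1, (2%:R : K) = 0, altf M & ~~ odd e].
  move=> MS; have [||h|] := @rank_common K n s e M U fU (sS _ MS); last by right.
  - by move=> X; rewrite -rE; apply/urk/rpredD => //; exact: sym_sum_mem.
  - by rewrite -rE.
  - by left; apply: h; rewrite mulmx_ker.
move=> M MS; have [//|[nE c2 aM oe]] := rc M MS.
(* An alternating M is a difference of the nonalternating M + M2 and M2. Here e = 0, so both vanish
   on the annihilator of [U]. *)
rewrite -rE in nE; have [M2 M2S nM2] := nalt nE c2 oe.
have [h2|[_ _ /nM2 //]] := rc M2 M2S.
have [h3|[_ _ a3 _]] := rc (M + M2) (rpredD MS M2S); last first.
  by case: nM2; rewrite -(addKr M M2) addrC; apply: altfB.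
have e0 : e = 0%N by lia.
move: h2 h3; rewrite e0 !leqn0 !mxrank_eq0 mulmxDr mulmxDl => /eqP ->.
by rewrite addr0.
Qed.

Lemma link_dichotomy (hK : exists x : K, x != 0 /\ x != 1) n r s e (S : {vspace 'M[K]_n}) :
  symsp S -> urk_le S r -> r = (2 * s + e)%N -> (e <= 1)%N -> (r < n)%N ->
  (n = r.+1 -> (2%:R : K) = 0 -> ~~ odd e -> exists2 M, M \in S & ~ altf M) ->
  near_iso (n - s) e S \/
  exists N, [/\ (n - r <= \rank N)%N, linked S N &
    exists2 l : 'rV_n, N *m l^T != 0 & (\dim (Sl S (kermx l^T)) < s)%N].
Proof.
move=> sS urk rE e1 rn nalt; have [t0 [t00 t01]] := hK.
have t10 : (1 : K) != t0 by rewrite eq_sym.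
have [[nE [c2 [M1 M1S nM1]]]|cs] :=
    classic (n = r.+1 /\ ((2%:R : K) = 0 /\ exists2 M, M \in S & ~ altf M)).
  have [M0 [M0S nM0] mx] := @ex_max_rank n (fun M => M \in S /\ ~ altf M)
    (ex_intro _ M1 (conj M1S nM1)).
  apply: (link_core hK sS urk rE e1 rn M0S) (nalt).
  - move=> Q QS.
    have one t t' : t != t' -> altf (M0 + t *: Q) -> altf (M0 + t' *: Q) -> False.
      move=> tt a1 a2; apply: nM0.
      have aQ : altf Q.
        have : altf ((M0 + t *: Q) - (M0 + t' *: Q)) by apply: altfB.
        rewrite opprD addrACA subrr add0r -scalerBl => h.
        have nz : t - t' != 0 by rewrite subr_eq0.
        by rewrite -[Q](scalerK nz); apply: altfZ.
      by rewrite -(addrK (t *: Q) M0); apply: altfB => //; apply: altfZ.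
    have ok t : ~ altf (M0 + t *: Q) -> (\rank (M0 + t *: Q)%R <= \rank M0)%N.
      by move=> na; apply: mx; split=> //; rewrite rpredD ?rpredZ.
    (* As M0 is not alternating, M0 + tQ is alternating for at most one t; two of the distinct
       nonzero parameters 1, t0, 1 + t0 remain. *)
    have t2 : 1 + t0 != 0 by rewrite addr_eq0 (oppr2 c2).
    have t2' : (1 : K) != 1 + t0 by rewrite -subr_eq0 opprD addrA subrr add0r oppr_eq0.
    have t2'' : t0 != 1 + t0 by rewrite -subr_eq0 opprD addrC -addrA addNr addr0 oppr_eq0 oner_eq0.
    have [a1|n1] := classic (altf (M0 + 1 *: Q)).
      exists t0, (1 + t0); split=> //; apply: ok; exact: one a1.
    have [a2|n2] := classic (altf (M0 + t0 *: Q)).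
      exists 1, (1 + t0); rewrite oner_neq0; split=> //; apply: ok => //; exact: one a2.
    by exists 1, t0; rewrite oner_neq0; split=> //; apply: ok.
  - move=> l m l' m' h h'; apply: mx; split; first exact: rpredD (rpredD M0S h') h.
    move=> a; apply: nM0.
    have -> : M0 = M0 + prodf l' m' + prodf l m - (prodf l' m' + prodf l m) by rewrite -[M0 + _ + _]addrA addrK.
    by apply: altfB => //; apply: altfD; exact: altf_prodf.
  - constructor 3; apply: NNPP => no; apply: nM0 => v; apply: NNPP => /eqP hv.
    by apply: no; exists v.
have [M0 M0S mx] := @ex_max_rank n (fun M => M \in S) (ex_intro _ 0 (mem0v S)).
apply: (link_core hK sS urk rE e1 rn M0S) (nalt).
- by move=> Q QS; exists 1, t0; rewrite oner_neq0; split=> //; apply: mx; rewrite rpredD ?rpredZ.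
- by move=> l m l' m' h h'; apply: mx; exact: rpredD (rpredD M0S h') h.
have [c2|c2] := eqVneq (2%:R : K) 0; last by constructor 1.
constructor 2; have rM0 := urk _ M0S.
have [nE|ne] := eqVneq n r.+1; last by lia.
have [aM|na] := classic (altf M0); last by case: cs; split=> //; split=> //; exists M0.
(* An alternating M0 has even rank, so for odd r its kernel has dimension at least two; for even r a
   nonalternating element was supplied. *)
have := alt_even (sS _ M0S) aM.
have [oe|oe] := boolP (odd e); first by lia.
by have [M MS nM] := nalt nE c2 oe; case: cs; split=> //; split=> //; exists M.
Qed.

End Dichotomy.

(** * Block ranks and dimensions of structured spaces of forms *)

Section Helpers.
Variable K : fieldType.

Lemma rank_block_ut m1 m2 n1 n2 (U : 'M[K]_(m1, n1)) W (V : 'M_(m2, n2)) :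
  (\rank U + \rank V <= \rank (block_mx U W 0 V))%N.
Proof.
have [L1 e1] : exists L1, row_base U = L1 *m U by apply/submxP; rewrite eq_row_base.
have [L2 e2] : exists L2, row_base V = L2 *m V by apply/submxP; rewrite eq_row_base.
apply: (@rank_ge K _ _ _ (block_mx L1 0 0 L2)) => c.
rewrite -(hsubmxK c) -mulmxA mulmx_block !(mul0mx, mulmx0, addr0, add0r) -e1 -e2 mul_row_block.
rewrite mulmx0 addr0 -row_mx0 => /eq_row_mx[h1 h2].
have c1 : lsubmx c = 0 by apply: (row_free_inj (row_base_free U)); rewrite h1 mul0mx.
have c2 : rsubmx c = 0.
  by apply: (row_free_inj (row_base_free V)); rewrite mul0mx; move: h2; rewrite c1 mul0mx add0r.
by rewrite c1 c2 row_mx0.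
Qed.

(** With rows ordered Y, Z, X and columns ordered X, Z, Y the Gram matrix is block triangular, and
    the pairing of X with Y occurs twice on its diagonal. *)
Lemma rank_anti n m1 m2 m3 (M : 'M[K]_n) (X : 'M_(m1, n)) (Z : 'M_(m2, n)) (Y : 'M_(m3, n)) :
  M^T = M -> X *m M *m X^T = 0 -> X *m M *m Z^T = 0 ->
  (2 * \rank (X *m M *m Y^T) + \rank (Z *m M *m Z^T) <= \rank M)%N.
Proof.
move=> sM XX XZ.
have ZX : Z *m M *m X^T = 0.
  by apply: trmx_inj; rewrite !trmx_mul trmxK sM mulmxA XZ trmx0.
have YX : \rank (Y *m M *m X^T) = \rank (X *m M *m Y^T).
  by rewrite -mxrank_tr !trmx_mul trmxK sM mulmxA.
have : (\rank (col_mx Y (col_mx Z X) *m M *m (col_mx X (col_mx Z Y))^T) <= \rank M)%N.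
  exact: leq_trans (mxrankM_maxl _ _) (mxrankM_maxr _ _).
have -> : col_mx Y (col_mx Z X) *m M = col_mx (Y *m M) (col_mx (Z *m M) (X *m M)).
  by rewrite !mul_col_mx.
rewrite !tr_col_mx mul_col_row mul_col_row mul_col_mx ZX XX XZ col_mx0 => h.
have h1 := rank_block_ut (Y *m M *m X^T) (Y *m M *m row_mx Z^T Y^T)
  (block_mx (Z *m M *m Z^T) (Z *m M *m Y^T) 0 (X *m M *m Y^T)).
have h2 := rank_block_ut (Z *m M *m Z^T) (Z *m M *m Y^T) (X *m M *m Y^T).
apply: leq_trans (leq_trans h1 h); rewrite YX mul2n -addnn -addnA leq_add2l addnC; exact: h2.
Qed.

Lemma ex_compl k r m (R : 'M[K]_(m, k)) : (k - r <= \rank R)%N ->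
  exists W : 'M[K]_(r, k), row_full (col_mx R W).
Proof.
move=> rR; set C := (R^C)%MS.
have rC : (\rank C <= r)%N by rewrite mxrank_compl; lia.
exists ((pid_mx (\rank C) : 'M_(r, \rank C)) *m row_base C).
rewrite /row_full -addsmxE.
have fp : row_full (pid_mx (\rank C) : 'M[K]_(r, \rank C)).
  by rewrite /row_full rank_pid_mx.
have e : ((pid_mx (\rank C) : 'M[K]_(r, \rank C)) *m row_base C :=: C)%MS.
  by apply: eqmx_trans (eqmxMfull _ fp) _; exact: eq_row_base.
by rewrite (adds_eqmx (eqmx_refl _) e); exact: addsmx_compl_full.
Qed.

Lemma zero_compl k r m (R : 'M[K]_(m, k)) (W : 'M[K]_(r, k)) M : M^T = M -> row_full (col_mx R W) -> R *m M = 0 ->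
  W *m M *m W^T = 0 -> M = 0.
Proof.
move=> sM full RM WM; apply: (zero_full full).
have WR : W *m M *m R^T = 0.
  by apply: trmx_inj; rewrite !trmx_mul trmxK sM mulmxA RM mul0mx trmx0.
by rewrite mul_col_mx tr_col_mx mul_col_row RM !mul0mx WR WM block_mx0.
Qed.

Lemma dim_rad_le k r m (R : 'M[K]_(m, k)) (T : {vspace 'M[K]_k}) : symsp T -> (k - r <= \rank R)%N ->
  (forall M, M \in T -> R *m M = 0) -> (\dim T <= 'C(r.+1, 2))%N.
Proof.
move=> sT rR RT; have [W full] := ex_compl rR.
have -> : \dim T = \dim (rs W @: T).
  rewrite -(dim_rs T W) (_ : Sl T W = 0)%VS ?dimv0 //.
  apply/eqP; rewrite -subv0; apply/subvP=> M; rewrite mem_Sl memv0 => /andP[MT /eqP WM].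
  by apply/eqP; apply: zero_compl full (RT _ MT) WM; exact: sT.
by apply: dim_sym; exact: symsp_rs.
Qed.

(** A symmetric matrix of rank one is a multiple of a square, and nonzero multiples of squares of
    independent forms add up to rank two. *)
Lemma rank1_space n (T : {vspace 'M[K]_n}) : symsp T -> (forall M, M \in T -> (\rank M <= 1)%N) ->
  exists v : 'rV_n, forall M, M \in T -> exists a, M = a *: (v^T *m v).
Proof.
move=> sT rk.
have single M : M \in T -> M != 0 -> exists a (v : 'rV_n), [/\ a != 0, v != 0 & M = a *: (v^T *m v)].
  move=> MT M0.
  have [x v0] : exists x : 'rV_n, x *m M != 0.
    apply: NNPP => no; case/eqP: M0; apply/row_matrixP=> i; rewrite row0 rowE.
    by apply/eqP; apply: contraT => h; case: no; exists (delta_mx 0 i).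
  set v := x *m M in v0.
  have sub : (M <= v)%MS.
    have vM : (v <= M)%MS by exact: submxMl.
    rewrite -(geq_leqif (mxrank_leqif_sup vM)); apply: leq_trans (rk _ MT) _.
    by rewrite rank_rV v0.
  have /submxP[c cE] := sub.
  have [p pv] := sep0 v0.
  have e : c^T = dot p c^T *: v.
    have : p *m M^T = p *m M by rewrite sT.
    rewrite cE trmx_mul mul_outer pv scale1r => h.
    by rewrite [LHS]h -{1}[c]trmxK mul_outer.
  have ME : M = dot p c^T *: (v^T *m v).
    by rewrite {1}cE -{1}[c]trmxK {1}e linearZ /= -scalemxAl.
  exists (dot p c^T), v; split=> //.
  by apply: contraNneq M0 => z; rewrite ME z scale0r.
have [[M1 [M1T M10]]|no] := classic (exists M, M \in T /\ M != 0); last first.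
  exists 0 => M MT; exists 0; rewrite scale0r; apply/eqP; apply: contraT => h.
  by case: no; exists M.
have [a [v [a0 v0 e1]]] := single _ M1T M10; exists v => M MT.
have [->|M0] := eqVneq M 0; first by exists 0; rewrite scale0r.
have [b [w [b0 w0 e2]]] := single _ MT M0.
have [/sub_rVP[t wt]|nwv] := boolP (w <= v)%MS.
  by exists (b * (t * t)); rewrite e2 wt [(t *: v)^T]linearZ /= -scalemxAl -scalemxAr !scalerA mulrA.
have [z zv zw] := sep2 nwv; have [x xw xv] := sep2 (nsubC v0 nwv).
have r1 := rk _ (rpredD M1T MT).
have zM : z *m (M1 + M) = b *: w.
  by rewrite mulmxDr e1 e2 -!scalemxAr !mul_outer zv zw scale0r scaler0 add0r scale1r.
have xM : x *m (M1 + M) = a *: v.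
  by rewrite mulmxDr e1 e2 -!scalemxAr !mul_outer xv xw scale0r scaler0 addr0 scale1r.
have wS : (w <= (M1 + M)%R)%MS by rewrite -[w](scalerK b0) scalemx_sub // -zM submxMl.
have vS : (v <= (M1 + M)%R)%MS by rewrite -[v](scalerK a0) scalemx_sub // -xM submxMl.
have rv : \rank v = 1%N by rewrite rank_rV v0.
case/negP: nwv; apply: submx_trans wS _.
by rewrite -(geq_leqif (mxrank_leqif_sup vS)) rv.
Qed.

(** Each vector added to [F] costs its pairings with [F] and with itself, 1 + f numbers. *)
Lemma dim_zero_on k f g (F : 'M[K]_(f, k)) (T : {vspace 'M[K]_k}) : symsp T -> row_free F -> (f + g = k)%N ->
  (forall M, M \in T -> F *m M *m F^T = 0) -> (\dim T <= 'C(g.+1, 2) + g * f)%N.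
Proof.
elim: g f F T => [|g IH] f F T sT fF fg FT.
  rewrite leqn0 dimv_eq0 -subv0; apply/subvP=> M MT; rewrite memv0; apply/eqP.
  by apply: (@zero_full _ _ _ F); [rewrite /row_full (eqP fF) -fg addn0 | exact: FT].
have [x nx] := @ex_nsub K k f F ltac:(rewrite (eqP fF); lia).
pose F2 := col_mx x F : 'M_(1 + f, k).
have fF2 : row_free F2.
  apply: inj_row_free => v; rewrite -(hsubmxK v) mul_row_col [lsubmx v]mx11_scalar mul_scalar_mx.
  move: (lsubmx v 0 0) (rsubmx v) => a w e.
  have a0 : a = 0.
    apply: contraNeq nx => a0; rewrite -[x](scalerK a0) scalemx_sub //.
    by move/eqP: e; rewrite addr_eq0 => /eqP ->; rewrite eqmx_opp submxMl.
  move: e; rewrite a0 scale0r add0r => e.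
  by rewrite (row_free_inj fF (_ : w *m F = 0 *m F)) ?mul0mx // raddf0 row_mx0.
pose h : 'Hom('M[K]_k, 'rV[K]_(1 + f)) := linfun (mulmxr F2^T \o mulmx x).
have hE M : h M = x *m M *m F2^T by rewrite lfunE.
have d := dim_ker_full h T.
have d1 : (\dim (T :&: lker h) <= 'C(g.+1, 2) + g * (1 + f))%N.
  apply: (IH _ F2) => //; last 2 first.
  - lia.
  - move=> M; rewrite memv_cap memv_ker hE => /andP[MT /eqP xM].
    rewrite mul_col_mx mul_col_mx xM.
    have -> : F *m M *m F2^T = 0.
      rewrite tr_col_mx mul_mx_row FT // (_ : F *m M *m x^T = 0) ?row_mx0 //.
      apply: trmx_inj; rewrite !trmx_mul trmxK (sT _ MT) trmx0 mulmxA.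
      by move: xM; rewrite tr_col_mx mul_mx_row -row_mx0 => /eq_row_mx[].
    by rewrite col_mx0.
  - by apply: symsp_sub sT; exact: capvSl.
have dR : dim 'rV[K]_(1 + f) = (1 + f)%N by rewrite dim_matrix; exact: mul1n.
rewrite mulnDr muln1 in d1; rewrite dR in d; rewrite bin2S mulSn; apply: leq_trans d _; apply: leq_trans (leq_add d1 (leqnn _)) _; lia.
Qed.

End Helpers.

(** * Back to congruence *)

Section Conversions.
Variable K : fieldType.

Lemma near_iso_intro n k e (S : {vspace 'M[K]_n}) m (F : 'M[K]_(m, n)) : (k <= \rank F)%N ->
  (forall M, M \in S -> (\rank (F *m M *m F^T) <= e)%N) -> near_iso k e S.
Proof.
move=> rF FS; exists (<<F>>)%MS; first by rewrite genmxE.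
have /submxP[D ->] : (<<F>> <= F)%MS by rewrite genmxE.
move=> M MS; apply: leq_trans (FS _ MS).
by rewrite trmx_mul !mulmxA -(mulmxA D F) -(mulmxA D (F *m M)) rank_congr.
Qed.

Lemma has_rad_intro n k (S : {vspace 'M[K]_n}) m (R : 'M[K]_(m, n)) : (k <= \rank R)%N ->
  (forall M, M \in S -> R *m M = 0) -> has_rad k S.
Proof.
move=> rR RS; exists (<<R>>)%MS; first by rewrite genmxE.
have /submxP[D ->] : (<<R>> <= R)%MS by rewrite genmxE.
by move=> M MS; rewrite -mulmxA RS ?mulmx0.
Qed.

(** For e = 1 the traces on [F] are multiples of one square v^T v, by [rank1_space], and [D] is the
    kernel of v. *)
Lemma near_iso_rad n e (S : {vspace 'M[K]_n}) m (F : 'M[K]_(m, n)) : symsp S -> (e <= 1)%N ->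
  (forall M, M \in S -> (\rank (F *m M *m F^T) <= e)%N) ->
  exists2 D : 'M[K]_m, (m - e <= \rank D)%N & forall M, M \in S -> D *m (F *m M *m F^T) = 0.
Proof.
move=> sS e1 FS.
have [e0|] := posnP e.
  exists 1%:M; first by rewrite mxrank1 leq_subr.
  by move=> M /FS; rewrite e0 leqn0 mxrank_eq0 => /eqP ->; rewrite mulmx0.
move=> epos; have eE : e = 1%N by lia.
have [|v vS] := @rank1_space K m (rs F @: S) (symsp_rs sS).
  by move=> _ /mem_rs[M MS ->]; rewrite -eE FS.
exists (kermx v^T); first by rewrite mxrank_ker eE leq_sub2l // mxrank_tr rank_rV leq_b1.
move=> M MS; have [a ->] := vS _ (rs_mem F MS).
by rewrite -scalemxAr mulmxA mulmx_ker mul0mx scaler0.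
Qed.

(** Rows are chosen from the last to the first: after j rows, the next index is i = n - j - 1 and
    [A i] has rank at least j + 1, so it leaves their span. *)
Lemma ex_flag n (A : nat -> 'M[K]_n) : (forall i, (i < n)%N -> (n - i <= \rank (A i))%N) ->
  exists2 P : 'M[K]_n, P \in unitmx & forall i : 'I_n, (row i P <= A i)%MS.
Proof.
move=> rA.
have step j : (j <= n)%N -> exists2 Q : 'M[K]_(j, n), row_free Q &
    forall t : 'I_j, (row t Q <= A (n - j + t)%N)%MS.
  elim: j => [|j IH] jn.
    by exists 0; [rewrite /row_free mxrank0 | case].
  have [Q fQ QA] := IH (ltnW jn).
  have /row_subPn[i nu] : ~~ (A (n - j.+1)%N <= Q)%MS.
    apply/negP=> /mxrankS; rewrite (eqP fQ) => h.
    have := rA (n - j.+1)%N ltac:(lia); lia.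
  set u := row i _ in nu.
  exists (col_mx u Q : 'M_(1 + j, n)).
    have e : \rank (col_mx u Q : 'M_(1 + j, n)) = \rank (u + Q)%MS by rewrite addsmxE.
    rewrite /row_free eqn_leq rank_leq_row /= e.
    suff : (\rank Q < \rank (u + Q)%MS)%N by rewrite (eqP fQ).
    by rewrite ltnNge (geq_leqif (mxrank_leqif_sup (addsmxSr u Q))) addsmx_sub submx_refl andbT.
  rewrite -[j.+1]/(1 + j)%N => t; case: (@splitP 1 j t) => t' tE.
    have -> : t = lshift j t' by apply: val_inj.
    by rewrite rowKu row_id [lshift _ _ : nat]/= ord1 addn0 row_sub.
  have -> : t = rshift 1 t' by apply: val_inj.
  rewrite rowKd; have := QA t'; congr (_ <= A _)%MS; rewrite /=; lia.
have [Q fQ QA] := step n (leqnn n).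
by exists Q; [rewrite -row_free_unit | move=> i; have := QA i; rewrite subnn add0n].
Qed.

Lemma congr_entry n (P M : 'M[K]_n) i j : (P *m M *m P^T) i j = dot (row i P *m M) (row j P).
Proof. by rewrite /dot -row_mul !mxE; apply: eq_bigr => k _; rewrite !mxE. Qed.

Lemma has_rad_congr n r (S : {vspace 'M[K]_n}) : symsp S -> has_rad (n - r) S -> congr_into S (inWS 0 r).
Proof.
move=> sS [R rR RS].
have [|P uP PA] := @ex_flag n (fun i => if (i < r)%N then 1%:M else R).
  by move=> i lt; case: ifP => ir; [rewrite mxrank1; lia | lia].
exists P => // M MS; split; first exact: sym_congr (sS _ MS).
move=> i j _ _; rewrite add0n congr_entry => h.
have z (k : 'I_n) u : (r <= k)%N -> dot (row k P *m M) u = 0.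
  move=> rk; have := PA k; rewrite ltnNge rk => /submxP[c ->].
  by rewrite -mulmxA RS // mulmx0 dot0l.
by move: h; rewrite leq_max => /orP[/z -> //|/z h]; rewrite (dot_sym _ _ (sS _ MS)).
Qed.

Lemma near_iso_congr n s e (S : {vspace 'M[K]_n}) : symsp S -> (e <= 1)%N ->
  near_iso (n - s) e S -> congr_into S (inWS s e).
Proof.
move=> sS e1 [F rF FS]; have [D rD DS] := near_iso_rad sS e1 FS.
have rDF : (n - s - e <= \rank (D *m F))%N.
  have := mxrank_mul_min D F; lia.
have [|P uP PA] := @ex_flag n (fun i => if (i < s)%N then 1%:M else if (i < s + e)%N then F else D *m F).
  by move=> i lt; case: ifP => i1; [rewrite mxrank1; lia | case: ifP => i2; lia].
exists P => // M MS; split; first exact: sym_congr (sS _ MS).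
have inF (k : 'I_n) : (s <= k)%N -> (row k P <= F)%MS.
  move=> sk; have := PA k; rewrite ltnNge sk /=; case: ifP => // _ h.
  by apply: submx_trans h _; exact: submxMl.
have z (k k' : 'I_n) : (s + e <= k)%N -> (s <= k')%N -> dot (row k P *m M) (row k' P) = 0.
  move=> k1 k2; have := PA k; rewrite !ltnNge k1 /= (_ : s <= k)%N /=; last by lia.
  case/submxP=> c ->; have /submxP[d ->] := inF k' k2.
  have e0 : D *m F *m M *m F^T = 0 by rewrite -!mulmxA (mulmxA F) DS.
  by rewrite dot_mulmxr -(mulmxA c) -(mulmxA c) e0 mulmx0 dot0l.
move=> i j si sj; rewrite congr_entry leq_max => /orP[h|h]; first exact: z.
by rewrite (dot_sym _ _ (sS _ MS)); exact: z.
Qed.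

Lemma alt_rad_congr n r (S : {vspace 'M[K]_n}) : symsp S -> altsp S -> (2%:R : K) = 0 ->
  has_rad (n - r) S -> congr_into S (inWA 0 r).
Proof.
move=> sS aS c2 /(has_rad_congr sS)[P uP h]; exists P => // M MS.
have [sM zM] := h M MS; split=> //; split; last by move=> i; apply/altf_diag/altf_congr/aS.
rewrite sM; apply/matrixP=> i j; by rewrite [RHS]mxE (oppr2 c2).
Qed.

End Conversions.

(** * Corank one *)

Section CorankOne.
Variable K : fieldType.
Hypothesis hK : exists x : K, x != 0 /\ x != 1.

Definition reduced n (S : {vspace 'M[K]_n}) :=
  forall x : 'rV_n, x != 0 -> exists2 M, M \in S & x *m M != 0.

Lemma ex_annul n (S : {vspace 'M[K]_n}) (y l : 'rV_n) : l \notin (vec y @: S)%VS ->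
  exists a, dot a l = 1 /\ forall M, M \in S -> dot (y *m M) a = 0.
Proof.
have [A [fA AE]] := vs_mx (vec y @: S); rewrite -AE => /sep[a aA al].
exists a; split=> // M MS.
have : (y *m M <= A)%MS by rewrite AE -vecE memv_img.
by case/submxP=> c ->; rewrite dot_mulmxl aA dot0r.
Qed.

(* If [l] is not of the form [y M], some [a] with [dot a l = 1] satisfies [y M a^T = 0] for all [M] in [S]. *)
Lemma ex_link n (S : {vspace 'M[K]_n}) m (B : 'M[K]_(m, n)) (l p : 'rV_n) (y : 'rV_n) :
  symsp S -> (B :=: kermx l^T)%MS -> dot p l = 1 -> l \notin (vec y @: S)%VS ->
  exists h : 'rV_m, forall M, M \in S -> y *m M *m p^T = y *m M *m B^T *m h^T.
Proof.
move=> sS eB pl /ex_annul[a [al aS]].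
have [c aE] := ker_decomp eB pl a.
exists (- c) => M MS; have := aS M MS; rewrite aE al scale1r dotDr => /eqP.
rewrite addrC addr_eq0 => /eqP e; rewrite mulmx_dot e [(- c)^T]linearN /= mulmxN.
by rewrite -[y *m M *m B^T *m c^T]mulmxA -trmx_mul mulmx_dot raddfN.
Qed.

Lemma Sl_basis n (S : {vspace 'M[K]_n}) m (B : 'M[K]_(m, n)) m' (B' : 'M[K]_(m', n)) : (B :=: B')%MS -> Sl S B = Sl S B'.
Proof.
move=> e; apply/vspaceP=> M; rewrite !mem_Sl.
by apply/andP/andP=> -[-> /eqP h]; split=> //; apply/eqP; apply: zero_sub h; rewrite e.
Qed.

Lemma vec_drop n (S : {vspace 'M[K]_n}) (x : 'rV_n) :
  (\dim (S :&: lker (vec x)) + \dim (vec x @: S) = \dim S)%N.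
Proof. exact: limg_ker_dim. Qed.

Lemma vec_line n (S : {vspace 'M[K]_n}) (x l : 'rV_n) :
  (forall M, M \in S -> (x *m M <= l)%MS) -> (\dim (vec x @: S) <= 1)%N.
Proof.
move=> h; have : (vec x @: S <= <[l]>)%VS.
  apply/subvP=> _ /memv_imgP[M MS ->]; rewrite vecE.
  by apply/vlineP; apply/sub_rVP; apply: h.
by move/dimvS => /leq_trans; apply; rewrite dim_vline leq_b1.
Qed.

(** By [dim_sing_vec] no y M with y in ker l equals l, so every y has a relation and [glue_sym]
    makes them one: a vector q with l(q) = 1 and q S inside <l>. Fix M1 with q M1 nonzero. By
    [rank_aniso] the traces on ker l of M1 + M with q M = 0 are singular, whence dim S is at most 1
    + C(n-1, 2). *)
Lemma corank1_base n (S : {vspace 'M[K]_n}) (l : 'rV_n) : symsp S ->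
  (forall M, M \in S -> (\rank M < n)%N) -> reduced S -> (2 < n)%N -> l != 0 ->
  \dim (Sl S (kermx l^T)) = 0%N -> ('C(n.-2, 2) + n < \dim S)%N -> False.
Proof.
move=> sS urk red n3 l0 c0 dS.
have [B fB eB] := ex_kerbasis l0; have [p pl] := sep0 l0.
have Bl : B *m l^T = 0 by apply/sub_kermxP; rewrite eB.
rewrite -(Sl_basis S eB) in c0.
have dT : \dim (rs B @: S) = \dim S by rewrite -(dim_rs S B) c0.
have nl (y : 'rV_n.-1) : l \notin (vec (y *m B) @: S)%VS.
  apply/negP=> /memv_imgP[M0 M0S]; rewrite vecE => e.
  have ynu : dot (y *m B) l = 0 by exact: mulmx_tr0.
  have d1 := dim_sing_vec hK sS urk M0S (esym e) l0 ynu.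
  have d2 : (\dim (vec (y *m B) @: S) <= n)%N.
    by rewrite -[leqRHS](dim_rV K); apply: dimvS; exact: subvf.
  have d3 : (\dim (Sl S (kermx l^T) :&: lker (vec (y *m B))) <= 0)%N.
    by rewrite -[leqRHS]c0 (Sl_basis S eB) dimvS // capvSl.
  have := leq_trans dS (leq_trans d1 (leq_add (leq_add d2 d3) (leqnn _))); lia.
have bn : 'C(n, 2) = ('C(n.-2, 2) + n.-2 + n.-1)%N.
  by have [k ->] : exists k, n = k.+2 by [exists n.-2; lia]; rewrite !bin2S.
have b1 : 'C(n.-1, 2) = ('C(n.-2, 2) + n.-2)%N.
  by have [k ->] : exists k, n = k.+2 by [exists n.-2; lia]; rewrite !bin2S.
pose del (M : 'M[K]_n) := B *m M *m p^T.
have [|||||h hS] := @glue_sym K hK _ (fun M => M \in S) n.-1 (fun M => B *m M *m B^T) del (rs B @: S)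
   ('C(n.-1.+1, 2) - \dim S)%N.
- by move=> g /mem_rs[M MS ->]; exists M.
- exact: symsp_rs.
- move=> y; have [h hh] := ex_link sS eB pl (nl y); exists h => M MS.
  by have := hh M MS; rewrite /del !mulmxA.
- by rewrite dT -leq_subLR.
- rewrite (_ : n.-1.+1 = n); last by lia.
  by rewrite bn; lia.
pose q := p - h *m B.
have ql : dot q l = 1 by rewrite /q !dotE pl (mulmx_tr0 Bl) subr0.
have qB M : M \in S -> B *m (q *m M)^T = 0.
  move=> MS; rewrite trmx_mul (sS _ MS) mulmxA; apply/row_matrixP=> i.
  rewrite row0 rowE !mulmxA /q linearB /= mulmxBr trmx_mul -!mulmxA.
  have := hS (delta_mx 0 i) M MS; rewrite /del -!mulmxA => ->.
  by rewrite subrr.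
have qM M : M \in S -> exists a, q *m M = a *: l.
  by move=> MS; apply: (ker_rows_scal eB); apply/mulmx_tr0P/qB.
have q0 : q != 0 by apply: contra_eq_neq ql => ->; rewrite dot0l eq_sym oner_eq0.
have [M1 M1S qM1] := red q q0.
have [a ea] := qM _ M1S.
have a0 : a != 0 by apply: contraNneq qM1 => a0; rewrite ea a0 scale0r.
set Sq := (S :&: lker (vec q))%VS.
have d1 := vec_drop S q; rewrite -/Sq in d1.
have d2 : (\dim (vec q @: S) <= 1)%N.
  by apply: (@vec_line _ _ _ l) => M /qM[b ->]; exact: scalemx_sub.
have d3 := dim_rs Sq B.
have sub : (Sl Sq B <= Sl S B)%VS.
  by apply/subvP=> M; rewrite mem_Sl memv_cap mem_Sl => /andP[/andP[-> _] ->].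
have d4 := dimvS sub; rewrite c0 in d4.
have d5 : (\dim (rs B @: Sq) <= 'C(n.-1, 2))%N.
  apply: (dim_sing_sym hK (sym_congr B (sS _ M1S))).
    by apply: symsp_rs; apply: symsp_sub sS; exact: capvSl.
  move=> _ /mem_rs[M + ->]; rewrite memv_cap memv_ker vecE => /andP[MS /eqP qM0].
  rewrite -mulmxDl -mulmxDr.
  have MM : M1 + M \in S by rewrite rpredD.
  have e : q *m (M1 + M) = a *: l by rewrite mulmxDr ea qM0 addr0.
  have al : dot q (a *: l) != 0 by rewrite dotZr ql mulr1.
  have Bal : B *m (a *: l)^T = 0 by rewrite linearZ /= -scalemxAr Bl scaler0.
  have h1 := rank_aniso (sS _ MM) e al Bal.
  have := leq_ltn_trans h1 (urk _ MM); by rewrite addn1 ltn_predRL.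
lia.
Qed.

End CorankOne.

(** * Restriction to the common kernel of two forms *)

Section CorankOneStep.
Variable K : fieldType.
Hypothesis hK : exists x : K, x != 0 /\ x != 1.

Lemma sub_free n m k (F : 'M[K]_(m, n)) : (k <= \rank F)%N ->
  exists2 F1 : 'M[K]_(k, n), row_free F1 & (F1 <= F)%MS.
Proof.
move=> rF; exists ((pid_mx k : 'M_(k, \rank F)) *m row_base F).
  by rewrite /row_free mxrankMfree ?row_base_free // rank_pid_mx.
by apply: submx_trans (submxMl _ _) _; rewrite eq_row_base.
Qed.

Lemma dim_rank_le e n (T : {vspace 'M[K]_n}) : symsp T -> (e <= 1)%N -> (forall M, M \in T -> (\rank M <= e)%N) ->
  (\dim T <= e)%N.
Proof.
move=> sT e1 rk; have [e0|epos] := posnP e.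
  rewrite e0 leqn0 dimv_eq0 -subv0; apply/subvP=> M /rk.
  by rewrite e0 leqn0 mxrank_eq0 memv0.
have [|v vT] := @rank1_space K n T sT; first by move=> M /rk h; exact: leq_trans h e1.
have sub : (T <= <[(v^T *m v : 'M_n)]>)%VS.
  by apply/subvP=> M /vT[a ->]; apply/vlineP; exists a.
by apply: leq_trans (dimvS sub) _; rewrite dim_vline; case: (_ != 0).
Qed.

Lemma near_iso_dim k s e (T : {vspace 'M[K]_k}) m (F : 'M_(m, k)) : symsp T -> (e <= 1)%N -> (s <= k)%N ->
  (k - s <= \rank F)%N -> (forall M, M \in T -> (\rank (F *m M *m F^T) <= e)%N) ->
  (\dim T <= e + 'C(s.+1, 2) + s * (k - s))%N.
Proof.
move=> sT e1 sk rF FT; have [F1 fF1 /submxP[D DE]] := sub_free rF.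
have d1 : (\dim (rs F1 @: T) <= e)%N.
  apply: dim_rank_le e1 _; first exact: symsp_rs.
  move=> _ /mem_rs[M MT ->]; apply: leq_trans (FT _ MT).
  by rewrite DE trmx_mul !mulmxA -(mulmxA D F) -(mulmxA D (F *m M)) rank_congr.
have d2 : (\dim (Sl T F1) <= 'C(s.+1, 2) + s * (k - s))%N.
  apply: dim_zero_on fF1 _ _; first by apply: symsp_sub sT; exact: Sl_subv.
    by rewrite subnK.
  by move=> M; rewrite mem_Sl => /andP[_ /eqP].
have d3 := dim_rs T F1.
by rewrite -d3 addnC -addnA; exact: leq_add d1 d2.
Qed.

Section TwoForms.
Variables (n : nat) (S : {vspace 'M[K]_n}) (l mu : 'rV[K]_n).
Hypothesis sS : symsp S.
Hypothesis l0 : l != 0.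
Hypothesis nml : ~~ (mu <= l)%MS.
Variable C : 'M[K]_(n.-2, n).
Hypothesis fC : row_free C.
Hypothesis Cl : C *m l^T = 0.
Hypothesis Cmu : C *m mu^T = 0.
Hypothesis sC : forall u, dot u l = 0 -> dot u mu = 0 -> (u <= C)%MS.

(** On ker l the form mu cuts out a hyperplane, so [dim_Sl_le] is used again in size n - 1. *)
Lemma dim_loss2 : (\dim (Sl S C) <= \dim (Sl S (kermx l^T)) + n.-1)%N.
Proof.
have [B fB eB] := ex_kerbasis l0.
have Bl : B *m l^T = 0 by apply/sub_kermxP; rewrite eB.
have /submxP[D CD] : (C <= B)%MS by rewrite eB; apply/sub_kermxP.
set om := mu *m B^T.
have om0 : om != 0.
  by apply: contraNneq nml => /(ker_rows_scal eB)[a ->]; exact: scalemx_sub.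
have kD : (kermx om^T <= D)%MS.
  apply/row_subP=> j; set u := row j _.
  have uo : dot u om = 0 by apply/eqP; rewrite -dot_ker row_sub.
  have : (u *m B <= C)%MS by apply: sC; [rewrite (mulmx_tr0 Bl) | rewrite dot_mulmxl -/om].
  by rewrite CD; case/submxP=> E; rewrite mulmxA => /(row_free_inj fB) ->; exact: submxMl.
set T := (rs B @: Sl S C)%VS.
have TD : (T <= Sl T D)%VS.
  apply/subvP=> N NT; rewrite mem_Sl NT; case/mem_rs: NT => M + ->.
  by rewrite mem_Sl CD trmx_mul !mulmxA => /andP[_].
have sT : symsp T by apply: symsp_rs; apply: symsp_sub sS; exact: Sl_subv.
have d1 := dim_rs (Sl S C) B.
have d2 : (\dim (Sl (Sl S C) B) <= \dim (Sl S (kermx l^T)))%N.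
  rewrite -(Sl_basis S eB); apply: dimvS; apply/subvP=> M.
  by rewrite mem_Sl mem_Sl mem_Sl => /andP[/andP[-> _] ->].
have d3 : (\dim T <= n.-1)%N := leq_trans (dimvS TD) (dim_Sl_le sT om0 kD).
by rewrite -d1; exact: leq_add d2 d3.
Qed.

Lemma ker2_decomp : exists x z : 'rV_n, [/\ dot x l = 1, dot x mu = 0, dot z l = 0, dot z mu = 1 &
  forall u, exists c, u = c *m C + dot u l *: x + dot u mu *: z].
Proof.
have [z zl zm] := sep2 nml; have [x xm xl] := sep2 (nsubC l0 nml).
exists x, z; split=> // u.
have /submxP[c e] : (u - dot u l *: x - dot u mu *: z <= C)%MS.
  by apply: sC; rewrite !dotE ?xl ?xm ?zl ?zm; ring.
by exists c; rewrite -e addrAC subrK subrK.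
Qed.

Lemma ker2_span (v : 'rV_n) : v *m C^T = 0 -> exists a b, v = a *: l + b *: mu.
Proof.
move=> vC; have [x [z [xl xm zl zm dec]]] := ker2_decomp.
exists (dot v x), (dot v z); apply: dot_inj => u; have [c e] := dec u.
rewrite {1}e !dotE dot_mulmxl vC dot0r (dotC x) (dotC z); ring.
Qed.

Lemma dim_Sl_perp (nu y : 'rV_n) : nu != 0 -> y != 0 ->
  (\dim (Sl S (kermx nu^T) :&: lker (vec y)) <= n.-1)%N.
Proof.
move=> nu0 y0; have [x xnu] := sep0 nu0; rewrite -(dim_perp y0).
apply: (@dim_le_inj _ _ _ (vec x)) => M; rewrite memv_cap memv_ker mem_Sl !vecE => /andP[/andP[MS /eqP kM] /eqP yM].
  move=> xM; rewrite (form_hyper (sS MS) xnu (submx_refl _) kM) xM.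
  by rewrite /prodf dot0l oppr0 scale0r trmx0 mulmx0 mul0mx !addr0.
by rewrite mem_perp (dot_sym _ _ (sS MS)) yM dot0l.
Qed.

(** y S lies in the span of l and mu. If l occurs as some y M0, [dim_sing_vec] is used with nu = l;
    otherwise y S is at most a line and nu is any nonzero y M0. *)
Lemma rad2_dim (y : 'rV_n) : (forall M, M \in S -> (\rank M < n)%N) -> reduced S -> y != 0 ->
  dot y l = 0 -> dot y mu = 0 -> (forall M, M \in S -> y *m M *m C^T = 0) ->
  (\dim (Sl S (kermx l^T)) + 2 <= n)%N -> (\dim S <= 'C(n.-2, 2) + n)%N.
Proof.
move=> urk red y0 yl ymu yC cn.
have sub : (vec y @: S <= <[mu]> + <[l]>)%VS.
  apply/subvP=> _ /memv_imgP[M MS ->]; rewrite vecE.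
  have [a [b ->]] := ker2_span (yC M MS); rewrite addrC.
  by apply: memv_add; apply/vlineP; [exists b | exists a].
have d2 : (\dim (<[mu]> + <[l]> : {vspace 'rV[K]_n}) <= 2)%N.
  by apply: leq_trans (dimv_add_leqif _ _) _; rewrite !dim_vline; do 2 case: (_ != 0).
have [/memv_imgP[M0 M0S]|nl] := boolP (l \in (vec y @: S)%VS).
  rewrite vecE => e.
  have d1 := dim_sing_vec hK sS urk M0S (esym e) l0 yl.
  have d3 : (\dim (Sl S (kermx l^T) :&: lker (vec y)) <= \dim (Sl S (kermx l^T)))%N.
    by apply: dimvS; exact: capvSl.
  have := leq_trans d1 (leq_add (leq_add (leq_trans (dimvS sub) d2) d3) (leqnn _)); lia.
have [M0 M0S nu0] := red y y0.
have ynu : dot y (y *m M0) = 0.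
  have [a [b ->]] := ker2_span (yC M0 M0S); by rewrite !dotE yl ymu !mulr0 addr0.
have d1 := dim_sing_vec hK sS urk M0S erefl nu0 ynu.
have d3 := dim_Sl_perp nu0 y0.
have d4 := dim_add_line nl.
have d5 : (\dim (vec y @: S + <[l]>)%VS <= 2)%N.
  by apply: leq_trans (dimvS _) d2; rewrite subv_add sub addvSr.
have d6 : (\dim (vec y @: S) <= 1)%N by have := leq_trans d4 d5.
have n0 : (0 < n)%N by lia.
have := leq_trans d1 (leq_add (leq_add d6 d3) (leqnn _)); lia.
Qed.
End TwoForms.
End CorankOneStep.

(** * Induction on the size *)

(* The two dimension thresholds of the theorem. *)
Definition tau1 r n := ('C(r.-1, 2) + n)%N.
Definition tau2 s e n := ('C(s, 2) + 'C(3 + e, 2) + s.-1 * (n - s.-1))%N.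

Lemma tau1_drop r n : (2 < r)%N -> (1 < n)%N -> tau1 r n = (tau1 (r - 2) n.-2 + (2 * r - 3))%N.
Proof.
move=> r2 n2; have [k ->] : exists k, r = k.+3 by exists (r - 3)%N; lia.
have [m ->] : exists m, n = m.+2 by exists (n - 2)%N; lia.
rewrite /tau1 (_ : (k.+3 - 2).-1 = k) /=; last by lia.
by rewrite !bin2S; lia.
Qed.

Lemma tau2_drop2 s e n : (1 < s)%N -> (s <= n)%N -> tau2 s e n = (tau2 s.-1 e n.-2 + (n + s - 2))%N.
Proof.
move=> s2 sn; have [k sE] : exists k, s = k.+2 by exists (s - 2)%N; lia. subst s.
have [m ->] : exists m, n = (m + k.+2)%N by exists (n - k.+2)%N; lia.
rewrite /tau2 /= (_ : m + k.+2 - k.+1 = m.+1)%N; last by lia.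
rewrite (_ : (m + k.+2).-2 - k = m)%N; last by lia.
by rewrite (bin2S k.+1); lia.
Qed.

Lemma tau2_drop1 s e n : (0 < s)%N -> (s <= n)%N -> tau2 s e n = (tau2 s e n.-1 + s.-1)%N.
Proof.
move=> s0 sn; rewrite /tau2 (_ : n - s.-1 = (n.-1 - s.-1).+1)%N; last by lia.
by rewrite mulnS; lia.
Qed.

Lemma drop_dims a b c d t k : (a + b = d)%N -> (a <= c)%N -> (t + k < d)%N -> (c <= k)%N -> (t < b)%N.
Proof. lia. Qed.

Section Main.
Variable K : fieldType.
Hypothesis hK : exists x : K, x != 0 /\ x != 1.

(* The conclusions (i), (ii), (iii), without reference to a basis. *)
Definition shapes n r s e (S : {vspace 'M[K]_n}) :=
  [\/ has_rad (n - r) S, near_iso (n - s) e S |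
   [/\ (2%:R : K) = 0, ~~ odd e, altsp S & has_rad (n - r.+1) S]].

(** Quantified over s and e because restriction to two kernels replaces s by s - 1. *)
Definition claim n := forall s e (S : {vspace 'M[K]_n}), (0 < s)%N -> (e <= 1)%N -> (2 * s + e < n)%N ->
  symsp S -> urk_le S (2 * s + e) ->
  (tau1 (2 * s + e) n < \dim S)%N -> (tau2 s e n < \dim S)%N -> shapes (2 * s + e) s e S.

Section Two.
Variables (n s e : nat) (S : {vspace 'M[K]_n}) (l mu : 'rV[K]_n).
Hypothesis e1 : (e <= 1)%N.
Hypothesis sS : symsp S.
Hypothesis urk : urk_le S (2 * s + e).
Hypothesis l0 : l != 0.
Hypothesis nml : ~~ (mu <= l)%MS.
Variable C : 'M[K]_(n.-2, n).
Hypothesis fC : row_free C.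
Hypothesis Cl : C *m l^T = 0.
Hypothesis Cmu : C *m mu^T = 0.
Hypothesis sC : forall u, dot u l = 0 -> dot u mu = 0 -> (u <= C)%MS.
Hypothesis QS : prodf l mu \in S.

Lemma urk_ker2 : (0 < s)%N -> forall M, M \in (rs C @: S)%VS -> (\rank M <= 2 * s.-1 + e)%N.
Proof.
move=> s0 _ /mem_rs[M MS ->].
have [t] := @rank_prod K n M l mu 0 _ C hK (sS MS) l0 nml Cl Cmu.
rewrite scale0r addr0 => ht.
rewrite -(leq_add2r 2); apply: leq_trans (leq_trans ht (urk (rpredD MS (rpredZ t QS)))) _; lia.
Qed.

(** The two conditions on dim S_l say that the loss dim S_l + n - 1 does not exceed the drops 2r - 3
    and n + s - 2 of the thresholds. *)
Lemma shapes_ker2 : claim n.-2 -> (1 < s)%N -> (2 * s + e < n)%N ->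
  (\dim (Sl S (kermx l^T)) + n <= 4 * s + 2 * e - 2)%N -> (\dim (Sl S (kermx l^T)) < s)%N ->
  (tau1 (2 * s + e) n < \dim S)%N -> (tau2 s e n < \dim S)%N ->
  shapes (2 * s.-1 + e) s.-1 e (rs C @: S)%VS.
Proof.
move=> cl s1 sn cn cs t1 t2.
have dl := dim_loss2 sS l0 nml Cl sC.
have dC := dim_rs S C.
have h1 := @tau1_drop (2 * s + e) n ltac:(lia) ltac:(lia).
have h2 := @tau2_drop2 s e n s1 ltac:(lia).
have rE : (2 * s + e - 2 = 2 * s.-1 + e)%N by lia.
rewrite rE in h1.
apply: cl => //; [lia | lia | exact: symsp_rs | by apply: urk_ker2; lia | |].
  rewrite h1 in t1; exact: drop_dims dC dl t1 ltac:(lia).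
rewrite h2 in t2; exact: drop_dims dC dl t2 ltac:(lia).
Qed.
End Two.

End Main.

Lemma two_bin n : (2 * 'C(n.+1, 2) = n.+1 * n)%N.
Proof. by elim: n => [|n IH] //; rewrite bin2S mulnDr IH; lia. Qed.

(** For n = r + 1, a trace on ker l of type (ii) together with S_l stays within the first
    threshold. *)
Lemma corank1_num n s e c d : (e <= 1)%N -> n = (2 * s + e).+1 -> (1 < s)%N -> (c < s)%N ->
  (d <= e + 'C(s.+1, 2) + s * (n.-1 - s))%N -> (c + d <= 'C(n.-2, 2) + n)%N.
Proof.
move=> e1 nE s1 cs dle.
have [a aE] : exists a, s = a.+2 by exists (s - 2)%N; lia.
have h0 : (a <= a * a)%N by clear; case: a => // a; rewrite leq_pmulr.
have h1 := two_bin s.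
have e2 : (n.-1 - s = s + e)%N by lia.
rewrite e2 in dle.
have [e0|e0] : e = 0%N \/ e = 1%N by case: (e) e1 => [|[|]] //; auto.
  have h2 := two_bin (2 * a + 2); rewrite (_ : (2 * a + 2).+1 = n.-2) in h2; last by lia.
  rewrite e0 aE in dle h1 nE cs *; move: ('C(_, 2)) ('C(_, 2)) h1 h2 dle => A B h1 h2 dle.
  rewrite (_ : n.-2 = 2 * a + 3)%N in h2; last by lia.
  nia.
have h2 := two_bin (2 * a + 3); rewrite (_ : (2 * a + 3).+1 = n.-2) in h2; last by lia.
rewrite e0 aE in dle h1 nE cs *; move: ('C(_, 2)) ('C(_, 2)) h1 h2 dle => A B h1 h2 dle.
rewrite (_ : n.-2 = 2 * a + 4)%N in h2; last by lia.
nia.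
Qed.

(** * Characteristic 2: forms alternating on a hyperplane only *)

Section AltExt.
Variable K : fieldType.
Hypothesis hK : exists x : K, x != 0 /\ x != 1.

(** The additive map v -> v M v^T vanishes on [W], so at a p + w W in the kernel it equals a^2 times
    its nonzero value at p. Hence a = 0, and w = 0 by nonsingularity on [W]. *)
Lemma alt_ext_rank n k (M : 'M[K]_n) (W : 'M_(k, n)) (p : 'rV_n) : (2%:R : K) = 0 -> M^T = M ->
  altf (W *m M *m W^T) -> dot (p *m M) p != 0 -> \rank (W *m M *m W^T) = k -> (k < \rank M)%N.
Proof.
move=> c2 sM aW qp rW; rewrite -add1n.
apply: (@rank_ge K (1 + k) n n (col_mx p W)) => c.
rewrite -(hsubmxK c) mul_row_col [lsubmx c]mx11_scalar mul_scalar_mx.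
move: (lsubmx c 0 0) (rsubmx c) => a w e.
have a0 : a = 0.
  have : dot ((a *: p + w *m W) *m M) (a *: p + w *m W) = 0 by rewrite e dot0l.
  have q0 : dot (w *m W *m M) (w *m W) = 0.
    by rewrite dot_mulmxr -!mulmxA (mulmxA W) aW.
  rewrite mulmxDl -scalemxAl !dotE q0 (dot_sym (w *m W) p sM) addr0 => h.
  have : a * a * dot (p *m M) p = 0.
    transitivity (a * (a * dot (p *m M) p) + a * dot (p *m M) (w *m W)
      + a * dot (p *m M) (w *m W) - 2%:R * (a * dot (p *m M) (w *m W))); first by ring.
    by rewrite c2 mul0r subr0 -[RHS]h; ring.
  by move/eqP; rewrite !mulf_eq0 (negPf qp) orbF orbb => /eqP.
have w0 : w = 0.
  move: e; rewrite a0 scale0r add0r => e.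
  have f : row_free (W *m M *m W^T) by rewrite /row_free rW.
  by apply: (row_free_inj f); rewrite mul0mx !mulmxA e mul0mx.
by rewrite a0 w0 raddf0 row_mx0.
Qed.

Lemma alt_ext n (M : 'M[K]_n) (l p : 'rV_n) : (2%:R : K) = 0 -> M^T = M -> dot p l = 1 ->
  (forall v, dot v l = 0 -> dot (v *m M) v = 0) -> dot (p *m M) p = 0 -> altf M.
Proof.
move=> c2 sM pl aH qp v.
have -> : v = (v - dot v l *: p) + dot v l *: p by rewrite subrK.
set w := v - _; have wl : dot w l = 0 by rewrite !dotE pl mulr1 subrr.
move: (dot v l) w wl => t w wl; rewrite mulmxDl -scalemxAl !dotE qp (aH _ wl) (dot_sym p _ sM).
by rewrite add0r !mulr0 addr0 -mulr2n -mulr_natl c2 mul0r.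
Qed.

Definition qf n (p : 'rV[K]_n) : 'Hom('M[K]_n, 'M[K]_1) := linfun (mulmxr p^T \o mulmx p).

Lemma qfE n (p : 'rV[K]_n) M : (qf p M == 0) = (dot (p *m M) p == 0).
Proof.
rewrite lfunE /= mulmx_dot; apply/eqP/eqP=> [/(congr1 (fun A : 'M_1 => A 0 0))|->]; last by rewrite raddf0.
by rewrite !mxE mulr1n.
Qed.

Lemma dim_qf n (S : {vspace 'M[K]_n}) (p : 'rV_n) : (\dim S <= \dim (S :&: lker (qf p)) + 1)%N.
Proof.
have := dim_ker_full (qf p) S; by rewrite (_ : dim 'M[K]_1 = 1%N) // dim_matrix.
Qed.

Lemma mem_qf n (S : {vspace 'M[K]_n}) (p : 'rV_n) M :
  (M \in (S :&: lker (qf p))%VS) = (M \in S) && (dot (p *m M) p == 0).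
Proof. by rewrite memv_cap memv_ker qfE. Qed.

(* If [S] is alternating on [ker l] but not everywhere, then fixing the value at [p] makes
   every restriction to an even-dimensional subspace of [ker l] singular. *)
Lemma dim_alt_ext n k (S : {vspace 'M[K]_n}) (W : 'M[K]_(k, n)) (p : 'rV_n) r M1 : (2%:R : K) = 0 ->
  symsp S -> urk_le S r -> (r <= k)%N -> ~~ odd k ->
  altsp (rs W @: S)%VS -> M1 \in S -> dot (p *m M1) p != 0 ->
  (\dim (rs W @: (S :&: lker (qf p)))%VS <= 'C(k.-1, 2))%N.
Proof.
move=> c2 sS urk rk ok aS M1S qp.
have aW M : M \in S -> altf (W *m M *m W^T) by move=> MS; apply/aS/rs_mem.
apply: (@dim_sing_alt K c2 hK k (W *m M1 *m W^T)) => //; first exact: sym_congr (sS _ M1S).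
- exact: aW.
- by apply: symsp_rs; apply: symsp_sub sS; exact: capvSl.
- by move=> _ /mem_rs[M + ->]; rewrite mem_qf => /andP[MS _]; exact: aW.
move=> _ /mem_rs[M + ->]; rewrite mem_qf => /andP[MS /eqP qM].
rewrite -mulmxDl -mulmxDr.
have MM : M1 + M \in S by rewrite rpredD.
rewrite ltn_neqAle rank_leq_row andbT; apply/eqP=> e.
have := @alt_ext_rank n k (M1 + M) W p c2 (sS _ MM) (aW _ MM) _ e.
rewrite mulmxDr dotDl qM addr0 => /(_ qp).
by rewrite ltnNge (leq_trans (urk _ MM) rk).
Qed.
End AltExt.

(** * Corank one with nonzero S_l *)

Section CorankOneLink.
Variable K : fieldType.
Hypothesis hK : exists x : K, x != 0 /\ x != 1.

Lemma rad_vec n k (S : {vspace 'M[K]_n}) : (0 < k)%N -> has_rad k S ->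
  exists2 y : 'rV_n, y != 0 & forall M, M \in S -> y *m M = 0.
Proof.
move=> k0 [R rR RS]; have [y /submxP[c ->] y0] := @ex_nz K n R (leq_trans k0 rR).
by exists (c *m R) => // M MS; rewrite -mulmxA RS // mulmx0.
Qed.

Lemma ex_Sl n (S : {vspace 'M[K]_n}) (V : {vspace 'M[K]_n}) : (\dim V < \dim S)%N ->
  exists2 Q, Q \in S & Q \notin V.
Proof.
move=> lt; apply: NNPP => no; move: lt; rewrite ltnNge => /negP; apply; apply/dimvS/subvP=> Q QS.
by apply: contraT => h; case: no; exists Q.
Qed.

Lemma linked_indep n (N : 'M[K]_n) (l mu : 'rV_n) : N *m l^T != 0 -> N *m mu^T = 0 -> mu != 0 -> ~~ (mu <= l)%MS.
Proof.
move=> Nl Nm m0; apply/negP=> /sub_rVP[a e]; move: Nm; rewrite e linearZ /= -scalemxAr => /eqP.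
by rewrite scaler_eq0 (negPf Nl) orbF => /eqP a0; move: m0; rewrite e a0 scale0r eqxx.
Qed.

Lemma prodf0 n (l : 'rV[K]_n) : prodf l 0 = 0.
Proof. by rewrite /prodf trmx0 mul0mx mulmx0 addr0. Qed.

(** On the common kernel of l and mu the induction hypothesis leaves only case (iii): (i) is
    excluded by [rad2_dim], (ii) by [corank1_num]. Two independent products show by additivity that
    [S] is alternating on all of ker l, and a nonalternating element then bounds dim S through
    [dim_alt_ext]. *)
Lemma corank1_step n s e (S : {vspace 'M[K]_n}) (N : 'M[K]_n) (l : 'rV_n) : (e <= 1)%N -> n = (2 * s + e).+1 ->
  symsp S -> urk_le S (2 * s + e) -> reduced S ->
  (tau1 (2 * s + e) n < \dim S)%N -> (tau2 s e n < \dim S)%N ->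
  ((2%:R : K) = 0 -> ~~ odd e -> exists2 M, M \in S & ~ altf M) ->
  linked S N -> N *m l^T != 0 -> (0 < \dim (Sl S (kermx l^T)))%N -> (\dim (Sl S (kermx l^T)) < s)%N ->
  claim K n.-2 -> False.
Proof.
move=> e1 nE sS urk red t1 t2 nalt lk Nl c0 cs cl.
have s1 : (1 < s)%N := leq_ltn_trans c0 cs.
have l0 : l != 0 by apply: contraNneq Nl => ->; rewrite trmx0 mulmx0.
have urk' M : M \in S -> (\rank M < n)%N by move=> MS; rewrite [ltnRHS]nE ltnS; exact: urk.
have n2 : n.-2 = (2 * s + e).-1 by clear -nE s1; lia.
have t1' : ('C(n.-2, 2) + n < \dim S)%N by move: t1; rewrite /tau1 -n2.
have nc : (\dim (Sl S (kermx l^T)) + n <= 4 * s + 2 * e - 2)%N.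
  by move: (\dim _) cs => c cs; clear -nE cs s1; lia.
have [B fB eB] := ex_kerbasis l0.
have dB := dim_rs S B; rewrite (Sl_basis S eB) in dB.
have per mu (C : 'M_(n.-2, n)) : prodf l mu \in S -> ~~ (mu <= l)%MS -> row_free C -> C *m l^T = 0 -> C *m mu^T = 0 ->
    (forall u, dot u l = 0 -> dot u mu = 0 -> (u <= C)%MS) ->
    [/\ (2%:R : K) = 0, ~~ odd e & altsp (rs C @: S)%VS].
  move=> QS nml fC Cl Cmu sC.
  have /submxP[D CD] : (C <= B)%MS by rewrite eB; apply/sub_kermxP.
  have fD : row_free D by apply: (@row_free_mull _ _ _ _ D B); rewrite -CD.
  case: (shapes_ker2 hK e1 sS urk l0 nml fC Cl Cmu sC QS cl s1 _ nc cs t1 t2); first by rewrite [ltnRHS]nE.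
  - case/rad_vec; first by clear -nE s1; lia.
    move=> y' y'0 y'S; have y0 : y' *m C != 0.
      by apply: contraNneq y'0 => e0; apply/eqP/(row_free_inj fC); rewrite e0 mul0mx.
    have h := @rad2_dim K hK n S l mu sS l0 nml C fC sC (y' *m C) urk' red y0 (mulmx_tr0 Cl _) (mulmx_tr0 Cmu _).
    have yC M : M \in S -> y' *m C *m M *m C^T = 0.
      by move=> MS; rewrite -!mulmxA (mulmxA C) y'S // rs_mem.
    have cn : (\dim (Sl S (kermx l^T)) + 2 <= n)%N by move: (\dim _) cs => c cs; clear -nE cs; lia.
    by have := leq_trans t1' (h yC cn); rewrite ltnn.
  - case=> F rF FS.
    have sT : symsp (rs B @: S)%VS by exact: symsp_rs.
    have rFD : (n.-1 - s <= \rank (F *m D))%N.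
      by rewrite mxrankMfree //; apply: leq_trans rF; clear -s1; lia.
    have d := @near_iso_dim K n.-1 s e (rs B @: S)%VS n.-2 (F *m D) sT e1 ltac:(clear -nE s1; lia) rFD.
    have FD M : M \in (rs B @: S)%VS -> (\rank (F *m D *m M *m (F *m D)^T) <= e)%N.
      move=> /mem_rs[M0 M0S ->]; have := FS _ (rs_mem C M0S).
      by rewrite CD !trmx_mul !mulmxA.
    have := corank1_num e1 nE s1 cs (d FD); rewrite dB => h.
    by have := leq_trans t1' h; rewrite ltnn.
  - by case.
have [Q QS Q0] : exists2 Q, Q \in Sl S (kermx l^T) & Q \notin (0%VS : {vspace 'M[K]_n}).
  by apply: ex_Sl; rewrite dimv0.
rewrite memv0 in Q0.
have getmu P : P \in Sl S (kermx l^T) -> P != 0 ->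
    exists mu : 'rV_n, [/\ N *m mu^T = 0, P = prodf l mu & ~~ (mu <= l)%MS].
  move=> PS P0; have [mu Nm e0] := lk l Nl P PS; exists mu; split=> //.
  by apply: linked_indep Nl Nm _; apply: contraNneq P0 => m0; rewrite e0 m0 prodf0.
have memS P : P \in Sl S (kermx l^T) -> P \in S by rewrite mem_Sl => /andP[].
have [mu [Nm QE nml]] := getmu Q QS Q0.
have [C [fC Cl Cmu sC]] := ex_ker2basis l0 nml.
have pS : prodf l mu \in S by rewrite -QE memS.
have [c2 oe aC] := per mu C pS nml fC Cl Cmu sC.
have loss := dim_loss2 sS l0 nml Cl sC.
have dC := dim_rs S C.
have dA := dim_alt (symsp_rs sS) aC.
(* With dim S_l = 1 the losses 1 + (n - 1) and C(n-2, 2) add up exactly to the threshold. *)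
have [c1|c1] := eqVneq (\dim (Sl S (kermx l^T))) 1%N.
  have := leq_trans t1' (leq_trans (eq_leq (esym dC)) (leq_add loss dA)); rewrite c1.
  clear -nE; lia.
have [Q2 Q2S nQ2] : exists2 Q2, Q2 \in Sl S (kermx l^T) & Q2 \notin <[Q]>%VS.
  by apply: ex_Sl; rewrite dim_vline Q0 ltn_neqAle eq_sym c1.
have Q20 : Q2 != 0 by apply: contraNneq nQ2 => ->; exact: mem0v.
have [mu2 [Nm2 Q2E nml2]] := getmu Q2 Q2S Q20.
have [C2 [fC2 Cl2 Cmu2 sC2]] := ex_ker2basis l0 nml2.
have pS2 : prodf l mu2 \in S by rewrite -Q2E memS.
have [_ _ aC2] := per mu2 C2 pS2 nml2 fC2 Cl2 Cmu2 sC2.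
have nin : ~~ (mu2 <= l + mu)%MS.
  apply: contra nQ2 => /sub_addsmxP[[a b] /= e0].
  move: e0; rewrite [a]mx11_scalar [b]mx11_scalar !mul_scalar_mx; move: (a 0 0) (b 0 0) => {}a {}b e0.
  have a0 : a = 0.
    move: Nm2; rewrite e0 linearD !linearZ /= mulmxDr -!scalemxAr Nm scaler0 addr0 => /eqP.
    by rewrite scaler_eq0 (negPf Nl) orbF => /eqP.
  by rewrite Q2E e0 a0 scale0r add0r prodfZr -QE; apply/vlineP; exists b.
(* [y] is killed by l and mu but not by mu2, so ker l is the common kernel of l and mu2 plus the
   line of [y]. *)
have [y /ann_adds[/ann_row yl /ann_row ymu] ymu2] := sep nin.
have qC m (C' : 'M_(m, n)) M v : altsp (rs C' @: S)%VS -> M \in S -> (v <= C')%MS -> dot (v *m M) v = 0.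
  move=> aC' MS /submxP[c ->]; rewrite dot_mulmxr -!mulmxA (mulmxA C').
  exact: aC' (rs_mem C' MS) c.
have aH M v : M \in S -> dot v l = 0 -> dot (v *m M) v = 0.
  move=> MS vl; pose t := dot v mu2.
  have -> : v = (v - t *: y) + t *: y by rewrite subrK.
  have q1 : dot ((v - t *: y) *m M) (v - t *: y) = 0.
    by apply: (qC _ C2) => //; apply: sC2; rewrite !dotE ?vl ?yl ?ymu2 ?mulr0 ?subr0 // /t mulr1 subrr.
  have q2 : dot (y *m M) y = 0 by apply: (qC _ C) => //; apply: sC.
  move: (v - t *: y) q1 => w q1.
  rewrite mulmxDl -scalemxAl !dotE q1 q2 (dot_sym y _ (sS _ MS)).
  by rewrite !mulr0 addr0 add0r -mulr2n -mulr_natl c2 mul0r.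
have aT : altsp (rs B @: S)%VS.
  move=> _ /mem_rs[M MS ->] v; rewrite !mulmxA dot_mulmxl trmxK; apply: aH => //.
  by apply: mulmx_tr0; apply/sub_kermxP; rewrite eB.
have [p pl] := sep0 l0.
have [M2 M2S nM2] := nalt c2 oe.
have [[M1 M1S qp]|no] := classic (exists2 M, M \in S & dot (p *m M) p != 0); last first.
  apply: nM2; apply: (alt_ext c2 (sS _ M2S) pl); first by move=> v; exact: aH.
  by apply/eqP; apply: contraT => h; case: no; exists M2.
have n1 : n.-1 = (2 * s + e)%N by rewrite [in LHS]nE.
have rk1 : (2 * s + e <= n.-1)%N by rewrite n1.
have on1 : ~~ odd n.-1 by rewrite n1 oddD mul2n odd_double.
have d1 := dim_alt_ext hK c2 sS urk rk1 on1 aT M1S qp.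
have d2 := dim_qf S p.
have d3 := dim_rs (S :&: lker (qf p))%VS B.
have d4 : (\dim (Sl (S :&: lker (qf p))%VS B) <= \dim (Sl S (kermx l^T)))%N.
  rewrite -(Sl_basis S eB); apply: dimvS; apply/subvP=> M.
  by rewrite mem_Sl mem_qf mem_Sl => /andP[/andP[-> _] ->].
have d5 := leq_trans (eq_leq (esym d3)) (leq_add d4 d1).
have d6 := leq_trans t1' (leq_trans d2 (leq_add d5 (leqnn 1))).
by move: d6 cs; move: (\dim _) => c d6 cs; clear -cs nE d6; lia.
Qed.
End CorankOneLink.

(** * Consequences of a radical for a minimal S_l *)

Section Radicals.
Variable K : fieldType.
Hypothesis hK : exists x : K, x != 0 /\ x != 1.

Lemma ex_common n (x z : 'rV[K]_n) : x != 0 -> z != 0 -> exists l, dot x l != 0 /\ dot z l != 0.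
Proof.
move=> /sep0[a ax] /sep0[b bz]; rewrite dotC in ax; rewrite dotC in bz.
have n1 := oner_neq0 K.
have [az|az] := eqVneq (dot z a) 0; last by exists a; rewrite ax.
have [bx|bx] := eqVneq (dot x b) 0; last by exists b; rewrite bz.
by exists (a + b); rewrite !dotE ax az bx bz addr0 add0r.
Qed.

Lemma nz_row n (N : 'M[K]_n) (l : 'rV_n) : N *m l^T != 0 -> exists2 z : 'rV_n, (z <= N)%MS & dot z l != 0.
Proof.
move=> h; apply: NNPP => no; case/eqP: h; apply/row_matrixP=> i; rewrite row_mul row0 mulmx_dot.
case: (eqVneq (dot (row i N) l) 0) => [->|hi]; first by rewrite raddf0.
by case: no; exists (row i N); rewrite ?row_sub.
Qed.

Lemma row_nz n (N : 'M[K]_n) (l z : 'rV_n) : (z <= N)%MS -> dot z l != 0 -> N *m l^T != 0.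
Proof.
move=> /submxP[c ->]; apply: contraNneq => h.
by rewrite /dot -mulmxA h mulmx0 mxE.
Qed.

Lemma row_z n (N : 'M[K]_n) (l z : 'rV_n) : (z <= N)%MS -> N *m l^T = 0 -> dot z l = 0.
Proof. by move=> /submxP[c ->] h; rewrite /dot -mulmxA h mulmx0 mxE. Qed.

Lemma dim_line_le n (S : {vspace 'M[K]_n}) Q : (forall P, P \in S -> exists a, P = a *: Q) -> (\dim S <= 1)%N.
Proof.
move=> h; have : (S <= <[Q]>)%VS by apply/subvP=> P /h[a ->]; apply/vlineP; exists a.
by move/dimvS=> /leq_trans; apply; rewrite dim_vline leq_b1.
Qed.

Section Min.
Variables (n : nat) (S : {vspace 'M[K]_n}) (N : 'M[K]_n) (l : 'rV[K]_n).
Hypothesis lk : linked S N.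
Hypothesis Nl : N *m l^T != 0.
Hypothesis lmin : forall l' : 'rV_n, N *m l'^T != 0 -> (\dim (Sl S (kermx l^T)) <= \dim (Sl S (kermx l'^T)))%N.

(** Take l' nonzero at x and at a vector z of [N]. If [l' mu] lies in S_l', the condition at x puts
    mu in the span of l and l', and mu(z) = 0 fixes its direction. So S_l' is at most a line, and
    minimality of l applies. *)
Lemma min_rad1 (x : 'rV_n) : x != 0 -> (forall M, M \in S -> exists a, x *m M = a *: l) ->
  (\dim (Sl S (kermx l^T)) <= 1)%N.
Proof.
move=> x0 xS; have [z zN zl] := nz_row Nl.
have z0 : z != 0 by apply: contraNneq zl => ->; rewrite dot0l.
have [l' [xl' zl']] := ex_common x0 z0.
have Nl' := row_nz zN zl'.
apply: leq_trans (lmin Nl') _.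
apply: (@dim_line_le _ _ (prodf l' (l - (dot z l / dot z l') *: l'))) => P PS.
have [mu Nmu e] := lk Nl' PS.
have [PS' _] : P \in S /\ true by move: PS; rewrite mem_Sl => /andP[].
have [a xP] := xS _ PS'.
have muE : mu = (a / dot x l') *: l - (dot x mu / dot x l') *: l'.
  move: xP; rewrite e mul_prodf => xP.
  transitivity ((dot x l')^-1 *: (dot x l' *: mu + dot x mu *: l' - dot x mu *: l')).
    by rewrite addrK scalerK.
  by rewrite xP scalerBr !scalerA !(mulrC (dot x l')^-1).
move: muE; set al := a / _; set be := _ / dot x l' => muE.
have zmu := row_z zN Nmu.
have beE : be = al * (dot z l / dot z l').
  move: zmu; rewrite muE !dotE => /eqP; rewrite subr_eq0 => /eqP h.
  by rewrite mulrA h mulfK.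
exists al; rewrite e -prodfZr; congr prodf.
by rewrite muE beE scalerBr scalerA.
Qed.

(** As for [min_rad1]: all second factors and mu vanish on [N], so evaluation at z2 with l(z2) = 0
    removes l', evaluation at z1 with l(z1) nonzero removes l, and only multiples of [l' mu]
    remain. *)
Lemma min_rad2 (x mu : 'rV_n) : x != 0 -> (1 < \rank N)%N -> N *m mu^T = 0 ->
  (forall M, M \in S -> exists a b, x *m M = a *: l + b *: mu) ->
  (\dim (Sl S (kermx l^T)) <= 1)%N.
Proof.
move=> x0 rN Nmu xS; have [z1 z1N z1l] := nz_row Nl.
have [z2 [z2N z2l z20]] : exists z2 : 'rV_n, [/\ (z2 <= N)%MS, dot z2 l = 0 & z2 != 0].
  have [y [z [yN zN y0 nzy]]] := ex_indep rN.
  have [yl|yl] := eqVneq (dot y l) 0; first by exists y.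
  exists (z - (dot z l / dot y l) *: y); split.
  - by rewrite addmx_sub // eqmx_opp scalemx_sub.
  - by rewrite !dotE divfK // subrr.
  apply: contraNneq nzy => /eqP; rewrite subr_eq0 => /eqP ->; exact: scalemx_sub.
have [l' [xl' zl']] := ex_common x0 z20.
have Nl' := row_nz z2N zl'.
apply: leq_trans (lmin Nl') _.
apply: (@dim_line_le _ _ (prodf l' mu)) => P PS.
have [nu Nnu e] := lk Nl' PS.
have [PS' _] : P \in S /\ true by move: PS; rewrite mem_Sl => /andP[].
have [a [b xP]] := xS _ PS'.
have nuE : nu = (a / dot x l') *: l + (b / dot x l') *: mu - (dot x nu / dot x l') *: l'.
  move: xP; rewrite e mul_prodf => xP.
  transitivity ((dot x l')^-1 *: (dot x l' *: nu + dot x nu *: l' - dot x nu *: l')).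
    by rewrite addrK scalerK.
  by rewrite xP scalerBr scalerDr !scalerA !(mulrC (dot x l')^-1).
move: nuE; set al := a / _; set be := b / _; set ga := _ / dot x l' => nuE.
have ga0 : ga = 0.
  have := row_z z2N Nnu; rewrite nuE !dotE z2l (row_z z2N Nmu) !mulr0 addr0 sub0r => /eqP.
  by rewrite oppr_eq0 mulf_eq0 (negPf zl') orbF => /eqP.
have al0 : al = 0.
  have := row_z z1N Nnu; rewrite nuE ga0 scale0r !dotE (row_z z1N Nmu) mulr0 addr0 subr0 => /eqP.
  by rewrite mulf_eq0 (negPf z1l) orbF => /eqP.
by exists be; rewrite e -prodfZr nuE al0 ga0 !scale0r add0r subr0.
Qed.
End Min.

(** A radical vector x of the trace on ker l satisfies x S inside <l>. By [rank_hyper] the traces on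
    a complement of the radical, of size r, then form a singular affine family once x M is fixed and
    nonzero. *)
Lemma rad_dim n r (S : {vspace 'M[K]_n}) (l : 'rV_n) (B : 'M[K]_(n.-1, n)) : symsp S ->
  urk_le S r -> reduced S -> l != 0 -> row_free B -> (B :=: kermx l^T)%MS ->
  (0 < r)%N -> (r.+1 < n)%N -> has_rad (n.-1 - r) (rs B @: S)%VS ->
  (\dim S <= \dim (Sl S (kermx l^T)) + 'C(r, 2) + 1)%N.
Proof.
move=> sS urk red l0 fB eB r0 rn [R rR RS].
have Bl : B *m l^T = 0 by apply/sub_kermxP; rewrite eB.
have k0 : (0 < n.-1 - r)%N by clear -rn; lia.
have [x' /submxP[c0 x'E] x'0] := @ex_nz K n.-1 R (leq_trans k0 rR).
have x'S M : M \in (rs B @: S)%VS -> x' *m M = 0 by move=> MS; rewrite x'E -mulmxA RS // mulmx0.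
set x := x' *m B.
have x0 : x != 0 by apply: contraNneq x'0 => e0; apply/eqP/(row_free_inj fB); rewrite -/x e0 mul0mx.
have xl : dot x l = 0 by exact: mulmx_tr0.
have xM M : M \in S -> exists a, x *m M = a *: l.
  by move=> MS; apply: (ker_rows_scal eB); rewrite /x -!mulmxA (mulmxA B) x'S // rs_mem.
have [M1 M1S xM1] := red x x0; have [a ea] := xM _ M1S.
have v0 : a *: l != 0 by rewrite -ea.
have [W full] := ex_compl rR.
have WBl : W *m B *m (a *: l)^T = 0 by rewrite linearZ /= -scalemxAr -mulmxA Bl mulmx0 scaler0.
set Sx := (S :&: lker (vec x))%VS.
have sSx : symsp Sx by apply: symsp_sub sS; exact: capvSl.
have d1 := vec_drop S x; rewrite -/Sx in d1.
have d2 : (\dim (vec x @: S) <= 1)%N.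
  by apply: (@vec_line _ _ _ _ l) => M /xM[b ->]; exact: scalemx_sub.
have d3 := dim_rs Sx (W *m B).
have sub : (Sl Sx (W *m B) <= Sl S (kermx l^T))%VS.
  rewrite -(Sl_basis S eB); apply/subvP=> M; rewrite mem_Sl memv_cap mem_Sl => /andP[/andP[MS _] /eqP h].
  rewrite MS /=; apply/eqP; apply: (zero_compl (sym_congr B (sS _ MS)) full); first by apply/RS/rs_mem.
  by move: h; rewrite trmx_mul !mulmxA.
have d5 : (\dim (rs (W *m B) @: Sx) <= 'C(r, 2))%N.
  apply: (dim_sing_sym hK (sym_congr (W *m B) (sS _ M1S))); first exact: symsp_rs.
  move=> _ /mem_rs[M + ->]; rewrite memv_cap memv_ker vecE => /andP[MS /eqP xM0].
  rewrite -mulmxDl -mulmxDr.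
  have MM : M1 + M \in S by rewrite rpredD.
  have e : x *m (M1 + M) = a *: l by rewrite mulmxDr ea xM0 addr0.
  have xv : dot x (a *: l) = 0 by rewrite dotZr xl mulr0.
  have := leq_trans (rank_hyper (sS _ MM) e v0 xv WBl) (urk _ MM).
  by move: (\rank _) => k; clear -r0; lia.
have := leq_add (leq_add (dimvS sub) d5) d2; rewrite d3 d1; exact.
Qed.

(** The complement of the radical has odd size r + 1; one coordinate is dropped to reach the even
    size r of [dim_sing_alt], at a cost of at most r dimensions. *)
Lemma alt_rad_dim n r (S : {vspace 'M[K]_n}) (l : 'rV_n) (B : 'M[K]_(n.-1, n)) : (2%:R : K) = 0 -> ~~ odd r ->
  symsp S ->
  urk_le S r -> reduced S -> l != 0 -> row_free B -> (B :=: kermx l^T)%MS ->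
  (0 < r)%N -> (r.+2 < n)%N -> altsp (rs B @: S)%VS -> has_rad (n.-1 - r.+1) (rs B @: S)%VS ->
  (\dim S <= \dim (Sl S (kermx l^T)) + (r + 'C(r.-1, 2)) + 1)%N.
Proof.
move=> c2 or_ sS urk red l0 fB eB r0 rn aT [R rR RS].
have Bl : B *m l^T = 0 by apply/sub_kermxP; rewrite eB.
have k0 : (0 < n.-1 - r.+1)%N by clear -rn; lia.
have [x' /submxP[c0 x'E] x'0] := @ex_nz K n.-1 R (leq_trans k0 rR).
have x'S M : M \in (rs B @: S)%VS -> x' *m M = 0 by move=> MS; rewrite x'E -mulmxA RS // mulmx0.
set x := x' *m B.
have x0 : x != 0 by apply: contraNneq x'0 => e0; apply/eqP/(row_free_inj fB); rewrite -/x e0 mul0mx.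
have xl : dot x l = 0 by exact: mulmx_tr0.
have xM M : M \in S -> exists a, x *m M = a *: l.
  by move=> MS; apply: (ker_rows_scal eB); rewrite /x -!mulmxA (mulmxA B) x'S // rs_mem.
have [M1 M1S xM1] := red x x0; have [a ea] := xM _ M1S.
have v0 : a *: l != 0 by rewrite -ea.
have [W full] := ex_compl rR.
set Sx := (S :&: lker (vec x))%VS.
have sSx : symsp Sx by apply: symsp_sub sS; exact: capvSl.
have d1 := vec_drop S x; rewrite -/Sx in d1.
have d2 : (\dim (vec x @: S) <= 1)%N.
  by apply: (@vec_line _ _ _ _ l) => M /xM[b ->]; exact: scalemx_sub.
have d3 := dim_rs Sx (W *m B).
have sub : (Sl Sx (W *m B) <= Sl S (kermx l^T))%VS.
  rewrite -(Sl_basis S eB); apply/subvP=> M; rewrite mem_Sl memv_cap mem_Sl => /andP[/andP[MS _] /eqP h].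
  rewrite MS /=; apply/eqP; apply: (zero_compl (sym_congr B (sS _ MS)) full); first by apply/RS/rs_mem.
  by move: h; rewrite trmx_mul !mulmxA.
have l2 := delta_neq0 K (ord0 : 'I_r.+1).
have [W2 fW2 eW2] := ex_kerbasis l2.
have aWB M : M \in S -> altf (W *m B *m M *m (W *m B)^T).
  move=> MS; have := altf_congr W (aT _ (rs_mem B MS)).
  by rewrite trmx_mul !mulmxA.
have d5 := dim_rs (rs (W *m B) @: Sx) W2.
have d6 : (\dim (Sl (rs (W *m B) @: Sx) W2) <= r)%N.
  apply: (dim_Sl_alt_le _ _ l2); last by rewrite eW2.
    exact: symsp_rs.
  by move=> _ /mem_rs[M + ->]; rewrite memv_cap => /andP[MS _]; exact: aWB.
set P := W2 *m (W *m B).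
have Pl : P *m (a *: l)^T = 0.
  by rewrite linearZ /= -scalemxAr /P -!mulmxA Bl !mulmx0 scaler0.
have aP M : M \in S -> altf (P *m M *m P^T).
  by move=> MS; have := altf_congr W2 (aWB _ MS); rewrite /P (trmx_mul W2) !mulmxA.
have d7 : (\dim (rs W2 @: (rs (W *m B) @: Sx)) <= 'C(r.-1, 2))%N.
  have PE M : W2 *m (W *m B *m M *m (W *m B)^T) *m W2^T = P *m M *m P^T.
    by rewrite /P (trmx_mul W2) !mulmxA.
  apply: (@dim_sing_alt K c2 hK r (P *m M1 *m P^T)) => //.
  - exact: sym_congr (sS _ M1S).
  - exact: aP.
  - by apply: symsp_rs; exact: symsp_rs.
  - move=> _ /mem_rs[_ /mem_rs[M + ->] ->]; rewrite memv_cap => /andP[MS _].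
    by rewrite PE; exact: aP.
  move=> _ /mem_rs[_ /mem_rs[M + ->] ->]; rewrite memv_cap memv_ker vecE => /andP[MS /eqP xM0].
  rewrite PE -mulmxDl -mulmxDr.
  have MM : M1 + M \in S by rewrite rpredD.
  have e : x *m (M1 + M) = a *: l by rewrite mulmxDr ea xM0 addr0.
  have xv : dot x (a *: l) = 0 by rewrite dotZr xl mulr0.
  have := leq_trans (rank_hyper (sS _ MM) e v0 xv Pl) (urk _ MM).
  by move: (\rank _) => k; clear -r0; lia.
have := leq_add (leq_add (dimvS sub) (leq_add d6 d7)) d2; rewrite d5 d3 d1; exact.
Qed.
End Radicals.

(** * Corank two in characteristic 2 *)

Section CorankTwoAlt.
Variable K : fieldType.
Hypothesis hK : exists x : K, x != 0 /\ x != 1.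

Lemma rs_mulmx m1 m2 n (A : 'M[K]_(m1, m2)) (B : 'M_(m2, n)) (S : {vspace 'M[K]_n}) :
  (rs (A *m B) @: S = rs A @: (rs B @: S))%VS.
Proof.
rewrite -limg_comp; apply: eq_in_limg => M _.
by rewrite comp_lfunE !rsE trmx_mul !mulmxA.
Qed.

Lemma alt_corank2_num r n d : n = r.+2 -> ~~ odd r -> (0 < r)%N -> (d <= 'C(n.-1, 2))%N ->
  ('C(r.-1, 2) + n < d)%N -> ('C(n.-1, 2) - d + 3 < n.-1)%N.
Proof.
move=> -> or_ r0; have [k ->] : exists k, r = k.+2 by exists (r - 2)%N; clear -or_ r0; lia.
rewrite /= !bin2S; lia.
Qed.

(** A nonalternating element would impose the bound of [dim_alt_ext] on an r-dimensional subspace of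
    ker l, too small for the trace on ker l. *)
Lemma alt_on_ker n r (S : {vspace 'M[K]_n}) (l : 'rV_n) (B : 'M[K]_(n.-1, n)) :
  (2%:R : K) = 0 -> n = r.+2 -> ~~ odd r -> (0 < r)%N -> symsp S ->
  urk_le S r -> l != 0 -> row_free B -> (B :=: kermx l^T)%MS ->
  altsp (rs B @: S)%VS -> ('C(r.-1, 2) + n.-1 < \dim (rs B @: S))%N -> altsp S.
Proof.
move=> c2 nE or_ r0 sS urk l0 fB eB aT dT.
have [p pl] := sep0 l0.
have n1 : (0 < n.-1)%N by clear -nE; lia.
have [W [fW _]] : exists W : 'M[K]_(n.-2, n.-1), row_free W /\ True.
  have [F fF _] := @sub_free K n.-1 n.-1 n.-2 1%:M ltac:(rewrite mxrank1; clear; lia).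
  by exists F.
have nr : n.-2 = r by rewrite nE.
have [[M1 M1S qp]|no] := classic (exists2 M, M \in S & dot (p *m M) p != 0); last first.
  move=> M MS; apply: (alt_ext c2 (sS _ MS) pl); last first.
    by apply/eqP; apply: contraT => h; case: no; exists M.
  move=> v vl; have /submxP[c ->] : (v <= B)%MS by rewrite eB dot_ker vl.
  rewrite dot_mulmxr -!mulmxA (mulmxA B); exact: aT (rs_mem B MS) c.
exfalso.
have aW : altsp (rs (W *m B) @: S)%VS by rewrite rs_mulmx; exact: altsp_rs.
have on2 : ~~ odd n.-2 by rewrite nr.
have rn2 : (r <= n.-2)%N by rewrite nr.
have d1 := dim_alt_ext hK c2 sS urk rn2 on2 aW M1S qp.
set S0 := (S :&: lker (qf p))%VS in d1.
have d2 := dim_qf S p; rewrite -/S0 in d2.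
have d3 := dim_rs S0 B; have d4 := dim_rs S B.
have d5 : (\dim (Sl S0 B) <= \dim (Sl S B))%N.
  by apply: dimvS; apply/subvP=> M; rewrite mem_Sl mem_qf mem_Sl => /andP[/andP[-> _] ->].
rewrite rs_mulmx in d1.
have d6 := dim_rs (rs B @: S0) W.
have l2 : (exists om : 'rV[K]_n.-1, om != 0 /\ (kermx om^T <= W)%MS).
  have [om nom] := @ex_nz K n.-1 (kermx W^T) ltac:(rewrite mxrank_ker mxrank_tr (eqP fW); clear -n1; lia).
  move/sub_kermxP: nom => omW om0; exists om; split=> //.
  have rW : \rank W = n.-1.-1 := eqP fW.
  by rewrite -(ker_sub om0 _ rW) //; apply/mulmx_tr0P.
have [om [om0 kom]] := l2.
have aT0 : altsp (rs B @: S0)%VS.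
  by move=> _ /mem_rs[M + ->]; rewrite mem_qf => /andP[MS _]; apply/aT/rs_mem.
have sT0 : symsp (rs B @: S0)%VS by apply: symsp_rs; apply: symsp_sub sS; exact: capvSl.
have d7 := dim_Sl_alt_le sT0 aT0 om0 kom.
have r1 : n.-1.-1 = r by rewrite nE.
have r2 : n.-2.-1 = r.-1 by rewrite nE.
rewrite [leqRHS]r1 in d7; rewrite [leqRHS](congr1 (fun k => 'C(k, 2)) r2) in d1.
have n3 : n.-1 = r.+1 by rewrite nE.
have dT' : ('C(r.-1, 2) + r.+1 < \dim (rs B @: S))%N by rewrite -[r.+1]n3.
have d8 := leq_trans (eq_leq (esym d6)) (leq_add d7 d1).
have d9 := leq_trans (eq_leq d4) (leq_trans d2 (leq_add (leq_trans (eq_leq (esym d3)) (leq_add d5 d8)) (leqnn 1))).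
move: d9 dT'; move: (\dim (Sl _ _)) (\dim (rs B @: S)) => a b; clear; lia.
Qed.

Lemma ker2_factor n (l mu : 'rV[K]_n) m (B : 'M[K]_(m, n)) k (C : 'M[K]_(k, n)) : ~~ (mu <= l)%MS ->
  row_free B -> (B :=: kermx l^T)%MS -> C *m l^T = 0 ->
  (forall u, dot u l = 0 -> dot u mu = 0 -> (u <= C)%MS) ->
  exists D, [/\ C = D *m B, mu *m B^T != 0 & (kermx (mu *m B^T)^T <= D)%MS].
Proof.
move=> nml fB eB Cl sC.
have Bl : B *m l^T = 0 by apply/sub_kermxP; rewrite eB.
have /submxP[D CD] : (C <= B)%MS by rewrite eB; apply/sub_kermxP.
exists D; split=> //.
  by apply: contraNneq nml => /(ker_rows_scal eB)[a ->]; exact: scalemx_sub.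
apply/row_subP=> j; set u := row j _.
have uo : dot u (mu *m B^T) = 0 by apply/eqP; rewrite -dot_ker row_sub.
have : (u *m B <= C)%MS by apply: sC; [rewrite (mulmx_tr0 Bl) | rewrite dot_mulmxl uo].
by rewrite CD; case/submxP=> E; rewrite mulmxA => /(row_free_inj fB) ->; exact: submxMl.
Qed.

(** A product [l mu] in [S] makes the restriction to both kernels, of even size r, singular. A
    larger trace on ker l therefore forces S_l = 0. *)
Lemma alt_Sl0 n r (S : {vspace 'M[K]_n}) (l mu : 'rV_n) (B : 'M[K]_(n.-1, n)) :
  (2%:R : K) = 0 -> n = r.+2 -> ~~ odd r -> (0 < r)%N -> symsp S -> altsp S ->
  urk_le S r -> l != 0 -> row_free B -> (B :=: kermx l^T)%MS ->
  ~~ (mu <= l)%MS -> prodf l mu \in S -> (\dim (rs B @: S) <= r + 'C(r.-1, 2))%N.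
Proof.
move=> c2 nE or_ r0 sS aS urk l0 fB eB nml QS.
have [C [fC Cl Cmu sC]] := ex_ker2basis l0 nml.
have [D [CD om0 kom]] := ker2_factor nml fB eB Cl sC.
have d1 := dim_Sl_alt_le (symsp_rs (B := B) sS) (altsp_rs (B := B) aS) om0 kom.
have d2 := dim_rs (rs B @: S) D.
have d3 : (\dim (rs C @: S) <= 'C(n.-2.-1, 2))%N.
  have on2 : ~~ odd n.-2 by rewrite nE.
  apply: (@dim_sing_alt K c2 hK n.-2 0) => //.
  - exact: trmx0.
  - by move=> v; rewrite mulmx0 dot0l.
  - exact: symsp_rs.
  - exact: altsp_rs.
  move=> _ /mem_rs[M MS ->]; rewrite add0r.
  have [t] := @rank_prod K n M l mu 0 _ C hK (sS _ MS) l0 nml Cl Cmu.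
  rewrite scale0r addr0 => ht; have := leq_trans ht (urk _ (rpredD MS (rpredZ t QS))).
  by rewrite [leqRHS](_ : r = n.-2); [rewrite addn2; exact: ltnW | rewrite nE].
rewrite CD rs_mulmx in d3; have := leq_add d1 d3; rewrite d2 => h.
by apply: leq_trans h _; rewrite nE.
Qed.

(** The counterpart of [corank1_base]: [S] is alternating by [alt_on_ker], and S_l = 0 by [alt_Sl0].
    [glue_alt] gives a relation on ker zeta only, so q S restricted to ker l lies in <zeta>. As q M
    q^T = 0, q S lies in a line, and [dim_alt_vec] at q contradicts the threshold. *)
Lemma corank2_alt n r (S : {vspace 'M[K]_n}) (l : 'rV_n) (B : 'M[K]_(n.-1, n)) :
  (2%:R : K) = 0 -> n = r.+2 -> ~~ odd r -> (0 < r)%N -> symsp S ->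
  urk_le S r -> reduced S -> l != 0 -> row_free B -> (B :=: kermx l^T)%MS ->
  (forall Q, Q \in Sl S (kermx l^T) -> Q != 0 -> exists2 mu, Q = prodf l mu & ~~ (mu <= l)%MS) ->
  altsp (rs B @: S)%VS -> ('C(r.-1, 2) + n.-1 < \dim (rs B @: S))%N -> ('C(r.-1, 2) + n < \dim S)%N -> False.
Proof.
move=> c2 nE or_ r0 sS urk red l0 fB eB lk aT dT dS.
have aS := alt_on_ker c2 nE or_ r0 sS urk l0 fB eB aT dT.
have Bl : B *m l^T = 0 by apply/sub_kermxP; rewrite eB.
have on : ~~ odd n by rewrite nE /= negbK.
have urk' M : M \in S -> (\rank M < n)%N.
  by move=> MS; apply: leq_ltn_trans (urk _ MS) _; rewrite [ltnRHS]nE.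
have C1 : 'C(n.-2.-1, 2) = 'C(r.-1, 2) by rewrite nE.
have c0 : \dim (Sl S (kermx l^T)) = 0%N.
  apply/eqP; rewrite -leqn0 leqNgt; apply/negP=> cpos.
  have [Q QS Q0] : exists2 Q, Q \in Sl S (kermx l^T) & Q \notin (0%VS : {vspace 'M[K]_n}).
    by apply: ex_Sl; rewrite dimv0.
  rewrite memv0 in Q0; have [mu QE nml] := lk Q QS Q0.
  have QS' : prodf l mu \in S by move: QS; rewrite QE mem_Sl => /andP[].
  have := leq_trans dT (alt_Sl0 c2 nE or_ r0 sS aS urk l0 fB eB nml QS').
  by rewrite [X in (_ + X < _)%N](_ : n.-1 = r.+1) ?nE //; clear; lia.
rewrite -(Sl_basis S eB) in c0.
have dTS : \dim (rs B @: S) = \dim S by rewrite -(dim_rs S B) c0.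
have nl (y : 'rV_n.-1) : l \notin (vec (y *m B) @: S)%VS.
  apply/negP=> /memv_imgP[M0 M0S]; rewrite vecE => e.
  have d1 := dim_alt_vec hK c2 on sS aS urk' M0S (esym e) l0.
  have d2 : (\dim (vec (y *m B) @: S) <= n)%N.
    by rewrite -[leqRHS](dim_rV K); apply: dimvS; exact: subvf.
  have d3 : (\dim (Sl S (kermx l^T) :&: lker (vec (y *m B))) <= \dim (Sl S B))%N.
    by rewrite (Sl_basis S eB) dimvS // capvSl.
  rewrite c0 in d3; rewrite C1 in d1.
  have := leq_trans dS (leq_trans d1 (leq_add (leq_add d2 d3) (leqnn _))); clear; lia.
have [p pl] := sep0 l0.
pose del (M : 'M[K]_n) := B *m M *m p^T.
have dA := dim_alt (symsp_rs sS) aT; rewrite dTS in dA.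
have num := alt_corank2_num nE or_ r0 dA dS.
have [|||||||zeta [h hS]] := @glue_alt K c2 hK _ (fun M => M \in S) n.-1 (fun M => B *m M *m B^T) del (rs B @: S)
   ('C(n.-1, 2) - \dim S)%N.
- by move=> g /mem_rs[M MS ->]; exists M.
- by move=> M MS; exact: altf_congr (aS _ MS).
- exact: symsp_rs.
- exact: aT.
- move=> y; have [h hh] := ex_link sS eB pl (nl y); exists h => M MS.
  by have := hh M MS; rewrite /del !mulmxA.
- by rewrite dTS -leq_subLR.
- exact: num.
pose q := p - h *m B.
have ql : dot q l = 1 by rewrite /q !dotE pl (mulmx_tr0 Bl) subr0.
(* [w0] extends zeta from ker l to the whole space by the value 0 at q. *)
have [w0 [w0B w0q]] := ex_extend fB Bl ql zeta.
have qM M : M \in S -> exists a, q *m M = a *: w0.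
  move=> MS; have [a ea] : exists a, q *m M *m B^T = a *: zeta.
    apply: (@ker_rows_scal _ _ _ (kermx zeta^T)) => //.
    apply/mulmx_tr0P; apply/row_matrixP=> i; rewrite row_mul row0.
    have yz : dot (row i (kermx zeta^T)) zeta = 0 by apply/eqP; rewrite -dot_ker row_sub.
    have := hS _ yz M MS; rewrite /del /q => e.
    rewrite !trmx_mul trmxK (sS _ MS) linearB /= trmx_mul !mulmxBr.
    by rewrite !mulmxA in e *; rewrite e subrr.
  exists a; apply: dot_inj => u; have [c ->] := ker_decomp eB ql u.
  rewrite !dotDl !dotZl (dot_mulmxl c B (q *m M)) ea !dotZr (dot_mulmxl c B w0) w0B.
  by rewrite (dotC q w0) w0q (dotC q (q *m M)) (aS _ MS) !mulr0.
have q0 : q != 0 by apply: contra_eq_neq ql => ->; rewrite dot0l eq_sym oner_eq0.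
have [M1 M1S qM1] := red q q0.
have d1 := dim_alt_vec hK c2 on sS aS urk' M1S erefl qM1.
have d2 : (\dim (vec q @: S) <= 1)%N.
  by apply: (@vec_line _ _ _ _ w0) => M /qM[b ->]; exact: scalemx_sub.
have d3 : (\dim (Sl S (kermx (q *m M1)^T) :&: lker (vec q)) <= n.-1)%N.
  by apply: leq_trans (dim_Sl_alt_le sS aS qM1 (submx_refl _)); apply: dimvS; exact: capvSl.
rewrite C1 in d1.
have := leq_trans dS (leq_trans d1 (leq_add (leq_add d2 d3) (leqnn _))); clear -nE; lia.
Qed.
End CorankTwoAlt.

Lemma tau2E b e m : tau2 b.+1 e (m + e + b.+1).+1 = ('C(b.+1, 2) + 'C(3 + e, 2) + b * (m + e + 2))%N.
Proof. by rewrite /tau2 /= (_ : (m + e + b.+1).+1 - b = m + e + 2)%N //; lia. Qed.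

(** [lift_num1], [lift_num2] and [lift_num3] set the second threshold against the dimension counts
    of [lift_link], [lift_common] and [lift_near_iso]. *)
Lemma lift_num1 n s e m c d : (e <= 1)%N -> n = (m + e + s).+1 -> (c < s)%N -> (0 < m)%N ->
  (tau2 s e n < d)%N -> (d <= s.+1 + (c + 'C((s + e).+1, 2) + s.-1 * m.-1))%N -> False.
Proof.
move=> e1 -> cs m0 t2 dle; have := leq_trans t2 dle; move: cs m0 e1; clear.
case: s => // b cs; case: m => // a _; rewrite tau2E /=.
case: e => [|[|//]] _; rewrite ?addn0 ?addn1 !bin2S bin0n /= !mulnDr !mulnS; lia.
Qed.

Lemma lift_num2 n s e m c d t : (e <= 1)%N -> n = (m + e + s).+1 -> (c < s)%N -> (s < m)%N ->
  (tau2 s e n < d)%N -> (d <= c + 'C((s + e).+1, 2) + t)%N -> (m * s - t + 1 < m)%N.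
Proof.
move=> e1 -> cs sm t2 dle; have := leq_trans t2 dle; move: cs sm e1; clear.
case: s => // b cs sm; rewrite tau2E /=; move: sm.
case: e => [|[|//]] sm _; rewrite ?addn0 ?addn1 !bin2S bin0n /= !mulnDr !mulnS (mulnC m); lia.
Qed.

Lemma lift_num3 n s e m d : (e <= 1)%N -> n = (m + e + s).+1 -> (0 < s)%N ->
  (tau2 s e n < d)%N -> (d <= 'C(e.+2, 2) + (('C(s.+1, 2) + s * e.+1) + s.-1 * m))%N -> False.
Proof.
move=> e1 -> s0 t2 dle; have := leq_trans t2 dle; move: s0 e1; clear.
case: s => // b _; rewrite tau2E /=.
case: e => [|[|//]] _; rewrite ?addn0 ?addn1 !bin2S bin0n /= !mulnDr !mulnS; lia.
Qed.

Lemma half_rank a b s e : (b + 2 <= 2 * s + e)%N -> (2 * a <= b)%N -> (e <= 1)%N -> (a < s)%N.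
Proof. lia. Qed.

Section Lift.
Variable K : fieldType.
Hypothesis hK : exists x : K, x != 0 /\ x != 1.

Lemma full_decomp m1 m2 n (A : 'M[K]_(m1, n)) (B : 'M_(m2, n)) : row_full (col_mx A B) ->
  forall u : 'rV_n, exists a b, u = a *m A + b *m B.
Proof.
move=> full u; have /submxP[c ->] := submx_full u full.
by exists (lsubmx c), (rsubmx c); rewrite -{1}(hsubmxK c) mul_row_col.
Qed.

Lemma dim_ann n g (G : 'M[K]_(g, n)) (V : {vspace 'rV[K]_n}) : row_free G ->
  (forall v, v \in V -> G *m v^T = 0) -> (\dim V + g <= n)%N.
Proof.
move=> fG h; have [A [fA AV]] := vs_mx V.
have AG : A *m G^T = 0.
  apply/row_matrixP=> i; rewrite row_mul row0; apply/mulmx_tr0P; apply: h.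
  by rewrite -AV row_sub.
by have := mulmx0_rank_max AG; rewrite mxrank_tr (eqP fA) (eqP fG).
Qed.

Lemma zero_mx_of m k (X : 'M[K]_(m, k)) m1 m2 (A : 'M_(m1, k)) (B : 'M_(m2, k)) :
  row_full (col_mx A B) -> X *m A^T = 0 -> X *m B^T = 0 -> X = 0.
Proof.
move=> full XA XB; have : X *m (col_mx A B)^T = 0 by rewrite tr_col_mx mul_mx_row XA XB row_mx0.
have f : row_free (col_mx A B)^T by rewrite /row_free mxrank_tr -/(row_full _).
by rewrite -[0](mul0mx _ (col_mx A B)^T) => /(row_free_inj f).
Qed.

Lemma congr_rad m1 m2 k n' (X : 'M[K]_(m1, n')) (Z : 'M_(m2, n')) (P1 : 'M_(k, m1)) P2 M :
  X *m M *m X^T = 0 -> X *m M *m Z^T = 0 -> Z *m M *m X^T = 0 ->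
  (P1 *m X + P2 *m Z) *m M *m (P1 *m X + P2 *m Z)^T = P2 *m (Z *m M *m Z^T) *m P2^T.
Proof.
move=> XX XZ ZX; set G := P1 *m X + P2 *m Z.
have GT : G^T = X^T *m P1^T + Z^T *m P2^T by rewrite linearD /= !trmx_mul.
have XG : X *m M *m G^T = 0 by rewrite GT mulmxDr !mulmxA XX XZ !mul0mx addr0.
have ZG : Z *m M *m G^T = Z *m M *m Z^T *m P2^T.
  by rewrite GT mulmxDr !mulmxA ZX mul0mx add0r.
by rewrite {1}/G !mulmxDl -!(mulmxA P1) -!(mulmxA P2) XG ZG mulmx0 add0r mulmxA.
Qed.

(** In coordinates of ker l, [F] spans the subspace from case (ii), D F a part of dimension m = f -
    e orthogonal to it for all of [S], and [E] a complement of [F]. The aim is a vector outside ker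
    l that is orthogonal to D F as well. *)
Variables (n s e f m : nat) (S : {vspace 'M[K]_n}) (l p : 'rV[K]_n).
Variables (B : 'M[K]_(n.-1, n)) (F : 'M[K]_(f, n.-1)) (D : 'M[K]_(m, f)) (E : 'M[K]_(s, n.-1)).
Hypothesis e1 : (e <= 1)%N.
Hypothesis fE : f = (m + e)%N.
Hypothesis nE : n = (m + e + s).+1.
Hypothesis sm : (s < m)%N.
Hypothesis sS : symsp S.
Hypothesis urk : urk_le S (2 * s + e).
Hypothesis l0 : l != 0.
Hypothesis pl : dot p l = 1.
Hypothesis fB : row_free B.
Hypothesis eB : (B :=: kermx l^T)%MS.
Hypothesis cs : (\dim (Sl S B) < s)%N.
Hypothesis fF : row_free F.
Hypothesis fD : row_free D.
Hypothesis full : row_full (col_mx F E).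
Hypothesis rad : forall M, M \in S -> D *m F *m (B *m M *m B^T) *m F^T = 0.
Hypothesis t2 : (tau2 s e n < \dim S)%N.

Let F0 := D *m F.
Let Bl : B *m l^T = 0. Proof. by apply/sub_kermxP; rewrite eB. Qed.
Let fF0 : row_free F0.
Proof. by rewrite /row_free /F0 mxrankMfree. Qed.

Let radB M : M \in S -> F0 *m B *m M *m (F *m B)^T = 0.
Proof. by move=> MS; rewrite trmx_mul !mulmxA; have := rad MS; rewrite !mulmxA. Qed.

(** D F is orthogonal to [F] by hypothesis; orthogonality to [E] puts it in the radical of the trace
    on ker l, leaving a complement of dimension s + e. *)
Lemma lift_kernel (T : {vspace 'M[K]_n}) : (T <= S)%VS ->
  (forall M, M \in T -> F0 *m (B *m M *m B^T) *m E^T = 0) ->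
  (\dim T <= \dim (Sl S B) + 'C((s + e).+1, 2))%N.
Proof.
move=> TS TE; rewrite -(dim_rs T B) leq_add //.
  by apply: dimvS; apply/subvP=> M; rewrite !mem_Sl => /andP[/(subvP TS) -> ->].
apply: (@dim_rad_le _ _ _ _ F0).
- by apply: symsp_rs; exact: symsp_sub sS.
- by rewrite (eqP fF0); move: nE; clear; lia.
move=> _ /mem_rs[M MT ->]; apply: (zero_mx_of full); last exact: TE.
by apply: rad; exact: (subvP TS).
Qed.

(** If y M0 = l with y in D F, then for all M annihilating y [rank_hyper] lowers the rank of M0 + M
    on ker l by two, and [rank_anti] makes the pairing of D F with [E] have rank below s.
    [dim_sing_rect], on the m - 1 directions other than y, contradicts the threshold. *)
Lemma lift_link (y : 'rV_m) : l \notin (vec (y *m F0 *m B) @: S)%VS.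
Proof.
apply/negP=> /memv_imgP[M0 M0S]; rewrite vecE; set y1 := y *m F0 *m B => e0.
have y0 : y != 0 by apply: contraNneq l0 => y0; rewrite e0 /y1 y0 !mul0mx.
have [om yom] := sep0 y0; rewrite dotC in yom.
have om0 : om != 0 by apply: contra_eq_neq yom => ->; rewrite dot0r eq_sym oner_eq0.
have [W fW eW] := ex_kerbasis om0.
have y1l : dot y1 l = 0 by exact: mulmx_tr0.
set Sy := (S :&: lker (vec y1))%VS.
have SyS : (Sy <= S)%VS by exact: capvSl.
have d1 := vec_drop S y1; rewrite -/Sy in d1.
(* The rows y M vanish on [F], so they span at most n - f = s + 1 dimensions. *)
have d2 : (\dim (vec y1 @: S) + f <= n)%N.
  apply: (@dim_ann _ _ (F *m B)); first by rewrite /row_free mxrankMfree.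
  move=> _ /memv_imgP[M MS ->]; rewrite vecE /y1; apply/mulmx_tr0P.
  by rewrite -!(mulmxA y) radB // mulmx0.
pose g : 'Hom('M[K]_n, 'M[K]_(s, m.-1)) := linfun (mulmx E \o mulmxr (W *m F0)^T \o rs B).
have gE M : g M = E *m (B *m M *m B^T *m (W *m F0)^T) by rewrite lfunE /= rsE.
have d3 := limg_ker_dim g Sy.
have WT : (W *m F0)^T = F^T *m (W *m D)^T by rewrite /F0 mulmxA trmx_mul.
have d4 : (\dim (g @: Sy) <= s.-1 * m.-1)%N.
  apply: (@dim_sing_rect K s m.-1 (g M0)); first by move: sm; clear; lia.
  move=> _ /memv_imgP[M + ->]; rewrite memv_cap memv_ker vecE => /andP[MS /eqP yM].
  have MM : M0 + M \in S by rewrite rpredD.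
  have yMM : y1 *m (M0 + M) = l by rewrite mulmxDr -e0 yM addr0.
  rewrite -linearD /= gE.
  have r1 := leq_trans (rank_hyper (sS MM) yMM l0 y1l Bl) (urk MM).
  have X0 := rad MM; rewrite -/F0 in X0.
  have sN := sym_congr B (sS MM); set N := B *m (M0 + M) *m B^T in X0 r1 sN *.
  move: N X0 r1 sN => N X0 r1 sN.
  have FF : W *m F0 *m N *m (W *m F0)^T = 0.
    by rewrite WT mulmxA -(mulmxA W F0) -(mulmxA W (F0 *m N)) X0 mulmx0 mul0mx.
  have F0z : W *m F0 *m N *m (0 : 'M_(1, n.-1))^T = 0 by rewrite trmx0 mulmx0.
  have r2 := rank_anti E sN FF F0z.
  have -> : \rank (E *m (N *m (W *m F0)^T)) = \rank (W *m F0 *m N *m E^T).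
    by rewrite -mxrank_tr !trmx_mul !trmxK sN.
  exact: half_rank r1 (leq_trans (leq_addr _ _) r2) e1.
have d5 : (\dim (Sy :&: lker g) <= \dim (Sl S B) + 'C((s + e).+1, 2))%N.
  apply: lift_kernel; first exact: subv_trans (capvSl _ _) SyS.
  move=> M; rewrite !memv_cap !memv_ker gE vecE => /andP[/andP[MS /eqP yM] /eqP h].
  have fW2 : row_full (col_mx y W).
    rewrite -sub1mx; apply/row_subP=> i; set u := row i _.
    rewrite -(subrK (dot u om *: y) u) -addsmxE addrC addmx_sub_adds ?scalemx_sub //.
    by rewrite eW dot_ker !dotE yom mulr1 subrr.
  apply: trmx_inj; rewrite trmx0; apply: (zero_mx_of fW2).
    rewrite -trmx_mul; apply: trmx_inj; rewrite trmxK trmx0.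
    have -> : y *m (F0 *m (B *m M *m B^T) *m E^T) = y1 *m M *m B^T *m E^T by rewrite /y1 !mulmxA.
    by rewrite yM !mul0mx.
  suff -> : (F0 *m (B *m M *m B^T) *m E^T)^T *m W^T = E *m (B *m M *m B^T *m (W *m F0)^T) by [].
  by rewrite !trmx_mul !trmxK (sS MS) !mulmxA.
have m0 : (0 < m)%N := leq_trans (ltn0Sn s) sm.
have d6 : (\dim (vec y1 @: S) <= s.+1)%N by move: d2 nE fE; move: (\dim _) => a; clear; lia.
apply: (lift_num1 e1 nE cs m0 t2); rewrite -d1 addnC leq_add //.
by rewrite -d3 leq_add.
Qed.

(** The relations of [ex_link] involve all of ker l, but D F is orthogonal to [F], so only their [E]
    part matters; the matrices are m by s and [glue_tensor] applies. *)
Lemma lift_common : exists h : 'rV_s, forall M, M \in S -> F0 *m B *m M *m (p - h *m E *m B)^T = 0.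
Proof.
pose g : 'Hom('M[K]_n, 'M[K]_(m, s)) := linfun (mulmxr E^T \o mulmx F0 \o rs B).
have gE M : g M = F0 *m (B *m M *m B^T) *m E^T by rewrite lfunE /= rsE.
pose del (M : 'M[K]_n) := F0 *m B *m M *m p^T.
have d1 := limg_ker_dim g S.
have d2 : (\dim (S :&: lker g) <= \dim (Sl S B) + 'C((s + e).+1, 2))%N.
  apply: lift_kernel; first exact: capvSl.
  by move=> M; rewrite memv_cap memv_ker gE => /andP[_ /eqP].
have dS : (\dim S <= \dim (Sl S B) + 'C((s + e).+1, 2) + \dim (g @: S))%N.
  by rewrite -d1 leq_add2r.
have num := lift_num2 e1 nE cs sm t2 dS.
have [||||h hS] := @glue_tensor K _ (fun M => M \in S) m s g del (g @: S)%VS (m * s - \dim (g @: S))%N.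
- by move=> _ /memv_imgP[M MS ->]; exists M.
- move=> y; have [h' hh] := ex_link sS eB pl (lift_link y).
  have [a [b hE]] := full_decomp full h'.
  exists b => M MS; rewrite /del gE.
  have r0 : F0 *m B *m M *m B^T *m F^T = 0 by have := radB MS; rewrite trmx_mul !mulmxA.
  have key : F0 *m B *m M *m B^T *m h'^T = F0 *m (B *m M *m B^T) *m E^T *m b^T.
    rewrite hE [(_ + _)^T]linearD /= mulmxDr (trmx_mul a) (trmx_mul b) (mulmxA _ F^T) r0 mul0mx add0r.
    by rewrite !mulmxA.
  by rewrite -[RHS]mulmxA -key; have := hh M MS; rewrite !mulmxA.
- by rewrite -leq_subLR.
- exact: num.
exists h => M MS; rewrite linearB /= mulmxBr !trmx_mul !mulmxA.
apply/row_matrixP=> i; rewrite row0 linearB /= !rowE.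
have := hS (delta_mx 0 i) M MS; rewrite /del gE !mulmxA => ->.
by rewrite subrr.
Qed.

(** [F] and q together span the candidate [G] of dimension n - s, orthogonal to D F. An M1 of rank
    above e on [G] would be nonsingular on a complement [Z] of D F in [G], of dimension e + 1. Then
    [rank_anti] makes the pairing of D F with [E] singular for every M1 + M with M zero on [Z], and
    the count contradicts the threshold. *)
Lemma lift_near_iso : near_iso (n - s) e S.
Proof.
have [h hS] := lift_common.
set q := p - h *m E *m B in hS.
have ql : dot q l = 1 by rewrite /q !dotE pl (mulmx_tr0 Bl) subr0.
pose G := col_mx (F *m B) q.
have Gspan (u : 'rV_n) : exists a b c, u = a *m (F *m B) + b *m (E *m B) + c *: q.
  have [c uE] := ker_decomp eB ql u; have [a [b cE]] := full_decomp full c.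
  by exists a, b, (dot u l); rewrite {1}uE cE mulmxDl !mulmxA.
have XG M : M \in S -> F0 *m B *m M *m G^T = 0.
  by move=> MS; rewrite tr_col_mx mul_mx_row radB // hS // row_mx0.
have fG : row_free G.
  apply: inj_row_free => v; rewrite -(hsubmxK v) mul_row_col [rsubmx v]mx11_scalar mul_scalar_mx.
  move: (lsubmx v) (rsubmx v 0 0) => a c e0.
  have c0 : c = 0.
    have := congr1 (fun u => dot u l) e0.
    by rewrite dot0l dotDl dotZl ql mulr1 mulmxA (mulmx_tr0 Bl) add0r.
  move: e0; rewrite c0 scale0r addr0 => e0.
  have fFB : row_free (F *m B) by rewrite /row_free mxrankMfree.
  have -> : a = 0 by apply: (row_free_inj fFB); rewrite e0 mul0mx.
  by rewrite raddf0 row_mx0.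
have rG : (n - s <= \rank G)%N by rewrite (eqP fG); move: nE fE; clear; lia.
have [[M1 M1S big]|no] := classic (exists2 M, M \in S & (e < \rank (G *m M *m G^T))%N); last first.
  by apply: (near_iso_intro rG) => M MS; rewrite leqNgt; apply/negP=> big; apply: no; exists M.
exfalso.
have [W fullW] := @ex_compl K f e _ D ltac:(rewrite (eqP fD); move: fE; clear; lia).
pose Z := col_mx (W *m F *m B) q.
have GZ : exists P1 P2, G = P1 *m (F0 *m B) + P2 *m Z.
  have hZ : (Z <= col_mx (F0 *m B) Z)%MS by rewrite -(addsmxE (F0 *m B) Z) addsmxSr.
  have hq : (q <= Z)%MS by rewrite -(addsmxE (W *m F *m B) q) addsmxSr.
  have hW : (W *m F *m B <= Z)%MS by rewrite -(addsmxE (W *m F *m B) q) addsmxSl.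
  have : (G <= col_mx (F0 *m B) Z)%MS.
    rewrite col_mx_sub (submx_trans hq hZ) andbT.
    have : (F *m B <= col_mx D W *m (F *m B))%MS.
      by rewrite -[X in (X <= _)%MS]mul1mx submxMr // submx_full.
    move/submx_trans; apply; rewrite mul_col_mx col_mx_sub !mulmxA (submx_trans hW hZ) andbT.
    by rewrite -(addsmxE (D *m F *m B) Z) addsmxSl.
  case/submxP=> P PE; exists (lsubmx P), (rsubmx P).
  by rewrite PE -{1}(hsubmxK P) mul_row_col.
have [P1 [P2 GE]] := GZ.
have Zsub : exists P3, Z = P3 *m G.
  have qG : (q <= G)%MS by rewrite -(addsmxE (F *m B) q) addsmxSr.
  have FG : (F *m B <= G)%MS by rewrite -(addsmxE (F *m B) q) addsmxSl.
  apply/submxP; rewrite col_mx_sub qG andbT -mulmxA.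
  exact: submx_trans (submxMl _ _) FG.
have [P3 ZE] := Zsub.
have XZ M : M \in S -> F0 *m B *m M *m Z^T = 0.
  by move=> MS; rewrite ZE trmx_mul mulmxA XG // mul0mx.
have XX M : M \in S -> F0 *m B *m M *m (F0 *m B)^T = 0.
  move=> MS; have -> : (F0 *m B)^T = (F *m B)^T *m D^T by rewrite -trmx_mul mulmxA.
  by rewrite mulmxA radB // mul0mx.
have rZ : (e < \rank (Z *m M1 *m Z^T))%N.
  apply: leq_trans big _.
  have -> : G *m M1 *m G^T = P2 *m (Z *m M1 *m Z^T) *m P2^T.
    have ZX : Z *m M1 *m (F0 *m B)^T = 0.
      by apply: trmx_inj; rewrite trmx_mul trmxK trmx_mul (sS M1S) trmx0 mulmxA XZ.
    by rewrite GE; apply: congr_rad => //; [exact: XX | exact: XZ].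
  exact: rank_congr.
have rZ' : (\rank (Z *m M1 *m Z^T) = e.+1)%N.
  by apply/eqP; rewrite eqn_leq rZ andbT (leq_trans (rank_leq_row _)) ?addn1.
set S1 := Sl S Z.
have s0 : (0 < s)%N := leq_ltn_trans (leq0n _) cs.
pose g : 'Hom('M[K]_n, 'M[K]_(s, m)) := linfun (mulmx (E *m B) \o mulmxr (F0 *m B)^T).
have gE M : g M = E *m B *m (M *m (F0 *m B)^T) by rewrite lfunE.
have d1 := dim_rs S Z; rewrite -/S1 in d1.
have d2 : (\dim (rs Z @: S) <= 'C(e.+2, 2))%N.
  by apply: leq_trans (dim_sym (symsp_rs (B := Z) sS)) _; rewrite addn1.
have d3 := limg_ker_dim g S1.
have d4 : (\dim (g @: S1) <= s.-1 * m)%N.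
  apply: (@dim_sing_rect K s m (g M1)); first exact: ltnW.
  move=> _ /memv_imgP[M + ->]; rewrite mem_Sl => /andP[MS /eqP ZM].
  have MM : M1 + M \in S by rewrite rpredD.
  have r1 := leq_trans (rank_anti (E *m B) (sS MM) (XX _ MM) (XZ _ MM)) (urk MM).
  rewrite -linearD /= gE.
  have -> : \rank (E *m B *m ((M1 + M) *m (F0 *m B)^T)) = \rank (F0 *m B *m (M1 + M) *m (E *m B)^T).
    by rewrite -mxrank_tr trmx_mul trmx_mul trmxK (sS MM).
  have ZMM : \rank (Z *m (M1 + M) *m Z^T) = e.+1 by rewrite mulmxDr mulmxDl ZM addr0.
  by rewrite ZMM in r1; move: r1; move: (\rank _) => a; clear; lia.
have fullG : row_full (col_mx G (E *m B)).
  rewrite -sub1mx; apply/row_subP=> i; have [a [b [c ->]]] := Gspan (row i 1%:M).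
  have hG : (G <= col_mx G (E *m B))%MS by rewrite -(addsmxE G (E *m B)) addsmxSl.
  have hE : (E *m B <= col_mx G (E *m B))%MS by rewrite -(addsmxE G (E *m B)) addsmxSr.
  have hF : (F *m B <= G)%MS by rewrite -(addsmxE (F *m B) q) addsmxSl.
  have hq : (q <= G)%MS by rewrite -(addsmxE (F *m B) q) addsmxSr.
  apply: addmx_sub; last exact: scalemx_sub (submx_trans hq hG).
  apply: addmx_sub; first exact: submx_trans (submxMl _ _) (submx_trans hF hG).
  exact: submx_trans (submxMl _ _) hE.
pose W' := col_mx Z (E *m B).
have fullW' : row_full (col_mx (F0 *m B) W').
  rewrite -sub1mx; apply: submx_trans (submx_full _ fullG) _.
  have hX : (F0 *m B <= col_mx (F0 *m B) W')%MS by rewrite -(addsmxE (F0 *m B) W') addsmxSl.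
  have hW' : (W' <= col_mx (F0 *m B) W')%MS by rewrite -(addsmxE (F0 *m B) W') addsmxSr.
  have hZ : (Z <= W')%MS by rewrite -(addsmxE Z (E *m B)) addsmxSl.
  have hE : (E *m B <= W')%MS by rewrite -(addsmxE Z (E *m B)) addsmxSr.
  rewrite col_mx_sub (submx_trans hE hW') andbT GE; apply: addmx_sub.
    exact: submx_trans (submxMl _ _) hX.
  exact: submx_trans (submxMl _ _) (submx_trans hZ hW').
have d5 : (\dim (S1 :&: lker g) <= 'C(s.+1, 2) + s * e.+1)%N.
  set T := (S1 :&: lker g)%VS.
  have TP M : M \in T -> [/\ M \in S, Z *m M *m Z^T = 0 & F0 *m B *m M = 0].
    rewrite memv_cap memv_ker gE mem_Sl => /andP[/andP[MS /eqP ZM] /eqP gM]; split=> //.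
    apply: (zero_mx_of fullG); first exact: XG.
    apply: trmx_inj; rewrite trmx0 -[RHS]gM !trmx_mul !trmxK (sS MS).
    by rewrite !mulmxA.
  have sT : symsp T by move=> M /TP[/sS].
  have dW := dim_rs T W'.
  have -> : \dim T = \dim (rs W' @: T).
    rewrite -dW (_ : Sl T W' = 0)%VS ?dimv0 //; apply/eqP; rewrite -subv0; apply/subvP=> M.
    rewrite mem_Sl memv0 => /andP[MT /eqP WM]; have [MS _ XM] := TP M MT.
    by apply/eqP; exact: zero_compl (sS MS) fullW' XM WM.
  have fI : row_free (row_mx 1%:M 0 : 'M[K]_(e + 1, e + 1 + s)).
    apply: inj_row_free => v; rewrite mul_mx_row mulmx1 mulmx0 -row_mx0.
    by case/eq_row_mx.
  have -> : e.+1 = (e + 1)%N by rewrite addn1.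
  apply: (dim_zero_on (symsp_rs sT) fI) => // _ /mem_rs[M /TP[MS ZM _] ->].
  have IW : row_mx 1%:M 0 *m W' = Z by rewrite mul_row_col mul1mx mul0mx addr0.
  move: (row_mx _ _) IW => I IW.
  have -> : I *m (W' *m M *m W'^T) *m I^T = (I *m W') *m M *m (I *m W')^T by rewrite trmx_mul !mulmxA.
  by rewrite IW.
apply: (lift_num3 e1 nE s0 t2); rewrite -d1 addnC leq_add // -d3 leq_add //.
Qed.
End Lift.

(** A lost first threshold on ker l bounds dim S from above; against the second threshold this
    bounds n, which is what restriction to two kernels requires. *)
Lemma option_num n s e c d : (e <= 1)%N -> (1 < c)%N -> (c < s)%N ->
  (tau2 s e n < d)%N -> (d <= tau1 (2 * s + e) n.-1 + c)%N -> (2 * s + e < n)%N -> (c + n <= 4 * s + 2 * e - 2)%N.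
Proof.
move=> e1 c1 cs t2 dle sn; rewrite leqNgt; apply/negP=> big; have := leq_trans t2 dle.
(* The slacks t, b, u turn the claim into an inequality in nonnegative unknowns, the binomials
   entering only through [two_bin]. *)
have [t ct] : exists t, (s = c + t.+1)%N by exists (s - c.+1)%N; clear -cs; lia.
have [b cb] : exists b, c = b.+2 by exists (c - 2)%N; clear -c1; lia.
have [u nu] : exists u, n = (4 * s + 2 * e - 1 - c + u)%N.
  by exists (n - (4 * s + 2 * e - 1 - c))%N; clear -big; lia.
have h1 := two_bin (b + t + 2); have h2 := two_bin (2 * (b + t) + 4 + e).
have sE : s = (b + t + 2).+1 by clear -ct cb; lia.
have nE : n = (3 * (b + t + 3) + 2 * e + t + u)%N by clear -nu ct cb; lia.
have h4 : ('C(3 + e, 2) = 3 + 3 * e)%N by case: (e) e1 => [|[|]].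
have m1 : (n - s.-1 = 2 * (b + t) + 7 + 2 * e + t + u)%N by clear -nE sE; lia.
have m2 : ((2 * s + e).-1 = (2 * (b + t) + 4 + e).+1)%N by clear -sE; lia.
rewrite /tau1 /tau2 h4 m1 m2 sE cb nE; move: h1 h2; move: ('C(_, 2)) ('C(_, 2)) => X Y.
case: (e) e1 => [|[|//]] _; clear; nia.
Qed.

(** * The induction step *)

Section Main.
Variable K : fieldType.
Hypothesis hK : exists x : K, x != 0 /\ x != 1.

Lemma ex_min_nat (T : Type) (P : T -> Prop) (f : T -> nat) : (exists x, P x) ->
  exists2 x, P x & forall y, P y -> (f x <= f y)%N.
Proof.
case=> x Px; move e: (f x) => k; elim/ltn_ind: k x Px e => k IH x Px e.
have [[y [Py lt]]|no] := classic (exists y, P y /\ (f y < f x)%N).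
  by apply: (IH (f y) _ y) => //; rewrite -e.
by exists x => // y Py; rewrite leqNgt; apply/negP=> lt; apply: no; exists y.
Qed.

Section Quotient.
Variables (n : nat) (S : {vspace 'M[K]_n}) (x l : 'rV[K]_n) (B : 'M[K]_(n.-1, n)).
Hypothesis sS : symsp S.
Hypothesis xl : dot x l = 1.
Hypothesis xS : forall M, M \in S -> x *m M = 0.
Hypothesis fB : row_free B.
Hypothesis eB : (B :=: kermx l^T)%MS.

Let Bl : B *m l^T = 0. Proof. by apply/sub_kermxP; rewrite eB. Qed.

Lemma quot_full : row_full (col_mx x B).
Proof.
rewrite -sub1mx; apply/row_subP=> i; set u := row i _.
rewrite -(subrK (dot u l *: x) u) -addsmxE addrC addmx_sub_adds ?scalemx_sub //.
by rewrite eB dot_ker !dotE xl mulr1 subrr.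
Qed.

Lemma quot_rank m (F : 'M[K]_(m, n.-1)) k : (k <= \rank F)%N -> (k.+1 <= \rank (col_mx (F *m B) x))%N.
Proof.
move=> kF; rewrite -addsmxE; apply: leq_ltn_trans (_ : \rank (F *m B) < _)%N.
  by rewrite mxrankMfree.
rewrite ltnNge (geq_leqif (mxrank_leqif_sup (addsmxSl _ _))) addsmx_sub submx_refl /=.
apply/negP=> /submxP[c e]; move: xl; rewrite e mulmxA (mulmx_tr0 Bl) => /eqP.
by rewrite eq_sym oner_eq0.
Qed.

Lemma quot_dim : \dim (rs B @: S) = \dim S.
Proof.
rewrite -[RHS](dim_rs S B) (_ : Sl S B = 0)%VS ?dimv0 //.
apply/eqP; rewrite -subv0; apply/subvP=> M; rewrite mem_Sl memv0 => /andP[MS /eqP BM].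
by apply/eqP; exact: zero_compl (sS MS) quot_full (xS MS) BM.
Qed.

Lemma quot_rad k : has_rad k (rs B @: S)%VS -> has_rad k.+1 S.
Proof.
move=> [R rR RS]; apply: (has_rad_intro (quot_rank rR)) => M MS.
rewrite mul_col_mx (xS MS) (_ : R *m B *m M = 0) ?col_mx0 //.
apply: (zero_mx_of quot_full).
  by rewrite -!mulmxA (_ : M *m x^T = 0) ?mulmx0 //; apply/mulmx_tr0P; rewrite (sS MS) xS.
by have := RS _ (rs_mem B MS); rewrite !mulmxA.
Qed.

Lemma quot_near_iso k e : near_iso k e (rs B @: S)%VS -> near_iso k.+1 e S.
Proof.
move=> [F rF FS]; apply: (near_iso_intro (quot_rank rF)) => M MS.
have GE : col_mx (F *m B) x = col_mx 0 1%:M *m x + col_mx 1%:M 0 *m (F *m B).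
  by rewrite !mul_col_mx !mul1mx !mul0mx add_col_mx add0r addr0.
have FMx : F *m B *m M *m x^T = 0.
  by rewrite -!mulmxA (_ : M *m x^T = 0) ?mulmx0 //; apply/mulmx_tr0P; rewrite (sS MS) xS.
rewrite GE congr_rad ?xS ?mul0mx //; apply: leq_trans (rank_congr _ _) _.
by have := FS _ (rs_mem B MS); rewrite trmx_mul !mulmxA.
Qed.

Lemma quot_alt : altsp (rs B @: S)%VS -> altsp S.
Proof.
move=> aT M MS v; have [c ->] := ker_decomp eB xl v.
rewrite mulmxDl -scalemxAl xS // scaler0 addr0 dotDr dotZr (dot_sym _ x (sS MS)) xS // dot0l mulr0 addr0.
rewrite dot_mulmxr -!mulmxA (mulmxA B); exact: aT (rs_mem B MS) c.
Qed.
End Quotient.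

Lemma quotient_step n s e (S : {vspace 'M[K]_n}) (x : 'rV_n) : (0 < s)%N -> (e <= 1)%N -> (2 * s + e < n)%N ->
  symsp S -> urk_le S (2 * s + e) ->
  (tau1 (2 * s + e) n < \dim S)%N -> (tau2 s e n < \dim S)%N -> claim K n.-1 ->
  x != 0 -> (forall M, M \in S -> x *m M = 0) -> shapes (2 * s + e) s e S.
Proof.
move=> s0 e1 sn sS urk t1 t2 cl x0 xS.
have [l lx] := sep0 x0; rewrite dotC in lx.
have l0 : l != 0 by apply: contra_eq_neq lx => ->; rewrite dot0r eq_sym oner_eq0.
(* In corank one the line of [x] is already the radical required by (i). *)
have [nE|ne] := eqVneq n (2 * s + e).+1.
  constructor 1; apply: (@has_rad_intro _ _ _ _ 1 x) => //.
  by rewrite rank_rV x0 /= [X in (X - _)%N]nE subSnn.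
have [B fB eB] := ex_kerbasis l0.
have sn1 : (2 * s + e < n.-1)%N by move: sn ne; clear; lia.
have h2 := @tau2_drop1 s e n s0 ltac:(clear -sn; lia).
have dT := quot_dim sS lx xS eB.
have n1 k : (k < n)%N -> (n - k = (n.-1 - k).+1)%N by clear; lia.
case: (@cl s e (rs B @: S)%VS s0 e1 sn1 (symsp_rs sS)).
- by move=> _ /mem_rs[M MS ->]; apply: leq_trans (rank_congr _ _) (urk _ MS).
- by rewrite dT; apply: leq_ltn_trans t1; rewrite /tau1 leq_add2l leq_pred.
- by rewrite dT; apply: leq_ltn_trans t2; rewrite h2 leq_addr.
- by move=> h; constructor 1; rewrite n1 //; exact: (quot_rad sS lx xS fB eB h).
- by move=> h; constructor 2; rewrite n1; [exact: (quot_near_iso sS lx xS fB eB h) | move: sn; clear; lia].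
- move=> [c2 oe aT h]; constructor 3; split=> //; first exact: (quot_alt sS lx xS eB aT).
  rewrite n1; first exact: (quot_rad sS lx xS fB eB h).
  by move: sn ne; clear; lia.
Qed.

Lemma lift_shape n s e (S : {vspace 'M[K]_n}) (l : 'rV_n) (B : 'M[K]_(n.-1, n)) : (e <= 1)%N ->
  (2 * s + e + 2 <= n)%N -> symsp S -> urk_le S (2 * s + e) ->
  l != 0 -> row_free B -> (B :=: kermx l^T)%MS -> (\dim (Sl S (kermx l^T)) < s)%N ->
  (tau2 s e n < \dim S)%N -> near_iso (n.-1 - s) e (rs B @: S)%VS -> near_iso (n - s) e S.
Proof.
move=> e1 sn sS urk l0 fB eB cs t2 [F' rF' FS'].
have [F fF /submxP[P FE]] := sub_free rF'.
have FB M : M \in S -> (\rank (F *m B *m M *m (F *m B)^T) <= e)%N.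
  move=> MS; apply: leq_trans (FS' _ (rs_mem B MS)).
  have -> : F *m B *m M *m (F *m B)^T = P *m (F' *m (B *m M *m B^T) *m F'^T) *m P^T.
    by rewrite FE !trmx_mul !mulmxA.
  exact: rank_congr.
have [D' rD' D'S] := near_iso_rad sS e1 FB.
have [D fD /submxP[P' DE]] := sub_free rD'.
have [E full] := @ex_compl K n.-1 s _ F ltac:(by rewrite (eqP fF)).
have [p pl] := sep0 l0.
have rad M : M \in S -> D *m F *m (B *m M *m B^T) *m F^T = 0.
  move=> MS; have -> : D *m F *m (B *m M *m B^T) *m F^T = P' *m (D' *m (F *m B *m M *m (F *m B)^T)).
    by rewrite DE trmx_mul !mulmxA.
  by rewrite D'S // mulmx0.
rewrite -(Sl_basis S eB) in cs.
by apply: (lift_near_iso e1 _ _ _ sS urk l0 pl fB eB cs fF fD full rad t2); move: sn e1; clear; lia.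
Qed.

Lemma claim_step n : claim K n.-1 -> claim K n.-2 -> claim K n.
Proof.
move=> cl1 cl2 s e S s0 e1 sn sS urk t1 t2.
have [[x [x0 xS]]|nred] := classic (exists x : 'rV_n, x != 0 /\ forall M, M \in S -> x *m M = 0).
  exact: (quotient_step s0 e1 sn sS urk t1 t2 cl1 x0 xS).
have red : reduced S.
  move=> x x0; apply: NNPP => no; apply: nred; exists x; split=> // M MS.
  by apply/eqP; apply: contraT => h; case: no; exists M.
(* For n = r + 1 an alternating [S] in characteristic 2 is case (iii), whose radical has dimension
   zero. *)
have [[nE [c2 [oe aS]]]|nalt'] := classic (n = (2 * s + e).+1 /\ (2%:R : K) = 0 /\ ~~ odd e /\ altsp S).
  constructor 3; split=> //; apply: (@has_rad_intro _ _ _ _ _ (0 : 'M_n)); last by move=> M _; rewrite mul0mx.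
  by rewrite mxrank0 leqn0 subn_eq0 [leqLHS]nE.
have nalt : n = (2 * s + e).+1 -> (2%:R : K) = 0 -> ~~ odd e -> exists2 M, M \in S & ~ altf M.
  move=> nE c2 oe; apply: NNPP => no; apply: nalt'; split=> //; split=> //; split=> // M MS.
  by apply: NNPP => h; apply: no; exists M.
have [|[N [rN lk [l1 Nl1 cl1']]]] := link_dichotomy hK sS urk erefl e1 sn nalt; first by constructor 2.
have [l Nl lmin] := @ex_min_nat _ (fun l : 'rV_n => N *m l^T != 0) (fun l => \dim (Sl S (kermx l^T)))
  (ex_intro _ l1 Nl1).
have cs : (\dim (Sl S (kermx l^T)) < s)%N := leq_ltn_trans (lmin _ Nl1) cl1'.
have l0 : l != 0 by apply: contraNneq Nl => ->; rewrite trmx0 mulmx0.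
have getmu P : P \in Sl S (kermx l^T) -> P != 0 ->
    exists mu : 'rV_n, [/\ N *m mu^T = 0, P = prodf l mu & ~~ (mu <= l)%MS].
  move=> PS P0; have [mu Nm e0] := lk l Nl P PS; exists mu; split=> //.
  by apply: linked_indep Nl Nm _; apply: contraNneq P0 => m0; rewrite e0 m0 prodf0.
have [nE|ne] := eqVneq n (2 * s + e).+1.
  exfalso; have [c0|c0] := posnP (\dim (Sl S (kermx l^T))); last first.
    exact: (corank1_step hK e1 nE sS urk red t1 t2 (nalt nE) lk Nl c0 cs cl2).
  apply: (corank1_base hK sS _ red _ l0 c0).
  - by move=> M MS; apply: leq_ltn_trans (urk _ MS) sn.
  - by move: sn s0; clear; lia.
  - have n2 : n.-2 = (2 * s + e).-1 by move: nE; clear; lia.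
    by move: t1; rewrite /tau1 n2.
have sn2 : (2 * s + e + 2 <= n)%N by move: sn ne; clear; lia.
have sn1 : (2 * s + e < n.-1)%N by move: sn2; clear; lia.
have r0 : (0 < 2 * s + e)%N by move: s0; clear; lia.
have [B fB eB] := ex_kerbasis l0.
have dB := dim_rs S B; rewrite (Sl_basis S eB) in dB.
have sT := symsp_rs (B := B) sS.
have h2 := @tau2_drop1 s e n s0 ltac:(clear -sn; lia).
have lift := lift_shape e1 sn2 sS urk l0 fB eB cs t2.
(* Only the first threshold can fail on ker l; the second drops by s - 1, which is at least dim
   S_l. *)
have [tA|tB] := ltnP (tau1 (2 * s + e) n.-1) (\dim (rs B @: S)).
  have t2A : (tau2 s e n.-1 < \dim (rs B @: S))%N.
    rewrite h2 -dB in t2; move: t2 cs; move: (\dim (rs B @: S)) (\dim _) => a b; clear; lia.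
  have urkT M : M \in (rs B @: S)%VS -> (\rank M <= 2 * s + e)%N.
    by move=> /mem_rs[M' MS ->]; apply: leq_trans (rank_congr _ _) (urk _ MS).
  have small k : (0 < k)%N -> has_rad k (rs B @: S)%VS -> (\dim (Sl S (kermx l^T)) <= 1)%N.
    move=> k0 /(rad_vec k0)[y' y'0 y'S].
    apply: (min_rad1 lk Nl lmin (x := y' *m B)).
      by apply: contraNneq y'0 => e0; apply/eqP/(row_free_inj fB); rewrite e0 mul0mx.
    by move=> M MS; apply: (ker_rows_scal eB); rewrite -!mulmxA (mulmxA B) y'S // rs_mem.
  case: (cl1 s e _ s0 e1 sn1 sT urkT tA t2A) => [h|h|[c2 oe aT h]].
  - have c1 : (\dim (Sl S (kermx l^T)) <= 1)%N by apply: small h; rewrite subn_gt0.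
    have sn1' : ((2 * s + e).+1 < n)%N by move: sn2; clear; lia.
    have := leq_trans t1 (rad_dim hK sS urk red l0 fB eB r0 sn1' h).
    have -> : 'C(2 * s + e, 2) = ('C((2 * s + e).-1, 2) + (2 * s + e).-1)%N by rewrite -bin2S prednK.
    by rewrite /tau1; move: c1 sn2; move: (\dim _) ('C(_.-1, 2)) => c d; clear; lia.
  - by constructor 2; exact: lift.
  - exfalso; have or_ : ~~ odd (2 * s + e) by rewrite oddD mul2n odd_double.
    (* For n = r + 2 the radical in (iii) may be zero and provides no vector; [corank2_alt] takes
       over. *)
    have [n2|n2] := eqVneq n (2 * s + e).+2.
      apply: (corank2_alt hK c2 n2 or_ r0 sS urk red l0 fB eB _ aT tA t1).
      by move=> Q QS Q0; have [mu [_ h1 h3]] := getmu Q QS Q0; exists mu.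
    have n3 : ((2 * s + e).+2 < n)%N by move: sn2 n2; clear; lia.
    have c1 : (\dim (Sl S (kermx l^T)) <= 1)%N by apply: small h; move: n3; clear; lia.
    have := leq_trans t1 (alt_rad_dim hK c2 or_ sS urk red l0 fB eB r0 n3 aT h).
    rewrite /tau1; move: c1 n3; move: (\dim _) ('C(_, 2)) => c d; clear; lia.
have dle : (\dim S <= tau1 (2 * s + e) n.-1 + \dim (Sl S (kermx l^T)))%N by rewrite -dB addnC leq_add2r.
(* The first threshold drops by one only, so it is lost only when dim S_l is at least two. *)
have c2 : (1 < \dim (Sl S (kermx l^T)))%N.
  move: (leq_trans t1 dle) sn; rewrite /tau1; move: (\dim _) => c; clear; lia.
have nc := option_num e1 c2 cs t2 dle sn.
have [Q QS Q0] : exists2 Q, Q \in Sl S (kermx l^T) & Q \notin (0%VS : {vspace 'M[K]_n}).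
  by apply: ex_Sl; rewrite dimv0; exact: ltnW.
rewrite memv0 in Q0; have [mu [Nm QE nml]] := getmu Q QS Q0.
have pS : prodf l mu \in S by move: QS; rewrite QE mem_Sl => /andP[].
have [C [fC Cl Cmu sC]] := ex_ker2basis l0 nml.
have s1 : (1 < s)%N := ltn_trans c2 cs.
have rN2 : (1 < \rank N)%N by apply: leq_trans rN; move: sn2; clear; lia.
have norad k : (0 < k)%N -> has_rad k (rs C @: S)%VS -> False.
  move=> k0 /(rad_vec k0)[y' y'0 y'S].
  suff : (\dim (Sl S (kermx l^T)) <= 1)%N by rewrite leqNgt c2.
  apply: (min_rad2 lk Nl lmin (x := y' *m C) _ rN2 Nm).
    by apply: contraNneq y'0 => e0; apply/eqP/(row_free_inj fC); rewrite e0 mul0mx.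
  move=> M MS; apply: (ker2_span l0 nml sC).
  by rewrite -!mulmxA (mulmxA C) y'S // rs_mem.
constructor 2; apply: lift.
case: (shapes_ker2 hK e1 sS urk l0 nml fC Cl Cmu sC pS cl2 s1 sn nc cs t1 t2).
- by move/norad; case; move: sn2 s1; clear; lia.
- have [D [CD _ _]] := ker2_factor nml fB eB Cl sC.
  (* The subspace found has dimension n - 2 - (s - 1), which is the n - 1 - s needed on ker l. *)
  move=> [F rF FS]; apply: (@near_iso_intro _ _ _ _ _ _ (F *m D)).
    have fD : row_free D by apply: (@row_free_mull _ _ _ _ D B); rewrite -CD.
    by rewrite mxrankMfree //; apply: leq_trans rF; move: s1; clear; lia.
  move=> _ /mem_rs[M MS ->]; have := FS _ (rs_mem C MS).
  by rewrite CD !trmx_mul !mulmxA.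
- by case=> _ _ _ /norad; case; move: sn2 s1; clear; lia.
Qed.

Lemma claim_all n : claim K n.
Proof.
elim/ltn_ind: n => n IH; have [n0|n0] := posnP n.
  by subst n => s e S s0 _; rewrite ltn0.
apply: claim_step; apply: IH; move: n0; clear; lia.
Qed.
End Main.

(** * The thresholds in the notation of the theorem *)

Lemma s_dim_tau1 n r : (1 < r)%N -> (0 < n)%N -> s_dim n 1 (r - 2) = tau1 r n.
Proof.
case: r => [|[|r]] // _; case: n => // n _.
by rewrite /s_dim /tau1 subSS subSS subn0 mul1n subSS subn0 binn /=; lia.
Qed.

Lemma s_dim_tau2 n s e : (0 < s)%N -> s_dim n s.-1 (2 + e) = tau2 s e n.
Proof. by case: s. Qed.

Theorem theorem1p3 (K : fieldType) (n r s eps : nat) (S : {vspace 'M[K]_n})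
  (hK : exists x : K, x != 0 /\ x != 1)
  (hn : (0 < n)%N) (hr1 : (1 < r)%N) (hrn : (r < n)%N)
  (hs : (0 < s)%N) (heps : (eps <= 1)%N) (hr : r = (2 * s + eps)%N)
  (hsym : forall M, M \in S -> sym_mx M)
  (hdim : (maxn (s_dim n 1 (r - 2)) (s_dim n s.-1 (2 + eps)) < \dim S)%N)
  (hurk : urk_le S r) :
  congr_into S (inWS 0 r) \/
  congr_into S (inWS s eps) \/
  [/\ 2%N \in [pchar K], ~~ odd r & congr_into S (inWA 0 r.+1)].
Proof.
have sS : symsp S := hsym.
move: hdim; rewrite gtn_max s_dim_tau1 // s_dim_tau2 // => /andP[t1 t2].
case: (@claim_all K hK n s eps S hs heps); rewrite -?hr //.
- by move=> h; left; exact: has_rad_congr.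
- by move=> h; right; left; exact: near_iso_congr.
- move=> [c2 oe aS h]; right; right; split; last exact: alt_rad_congr.
    by rewrite inE /= c2 eqxx.
  by rewrite hr oddD mul2n odd_double.
Qed.
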